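(* Let $\mathcal{G} = (\mathcal{C},\mathcal{E})$ be a finite simple graph with vertex set $\mathcal{C}$, let $\mathcal{S}$ be a finite set, and for each $c\in\mathcal{C}$ let $\mathcal{S}_c\subseteq\mathcal{S}$ be a non-empty subset, such that for all $c,c'\in\mathcal{C}$ we have $\mathcal{S}_c\cap\mathcal{S}_{c'}=\varnothing$ if and only if $(c,c')\in\mathcal{E}$. For $N\in\mathbb{N}$ let $\Delta_{N^{\#\mathcal{S}}}$ be the conditional expectation onto the diagonal $*$-subalgebra $D_N$ of $\bigotimes_{\mathcal{S}}M_N(\mathbb{C})$. Let $k\in\mathbb{N}$, let $\chi:[k]\to\mathcal{C}$ be such that $\chi(1)\cdots\chi(k)$ is a $\mathcal{G}$-reduced word, let $\ell:[k]\to\mathbb{N}$, and for $i=1,\dots,k$, $j=1,\dots,\ell(i)$ and $N\in\mathbb{N}$ let $\Lambda_{i,j}^{(N)}\in D_N$ and $X_{i,j}^{(N)}\in\bigotimes_{\mathcal{S}_{\chi(i)}}M_N(\mathbb{C})$ be deterministic, with $\sup_{N,i,j}\|\Lambda_{i,j}^{(N)}\|<\infty$ and $\sup_{N,i,j}\|X_{i,j}^{(N)}\|<\infty$. Further, for each $N$ let $\{\Sigma_c^{(N)}:c\in\mathcal{C}\}$ be a family of independent uniformly random permutation matrices, with $\Sigma_c^{(N)}\in\bigotimes_{\mathcal{S}_c}M_N(\mathbb{C})$, and write \[ \underline{\underline{X}}_{i,j}^{(N)}=\bigl(\Sigma_{\chi(i)}^{(N)}\bigr)^*X_{i,j}^{(N)}\Sigma_{\chi(i)}^{(N)}\otimes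 I_N^{\otimes\mathcal{S}\setminus\mathcal{S}_{\chi(i)}}\in\bigotimes_{\mathcal{S}}M_N(\mathbb{C}). \] Then, setting \[ Y_i^{(N)}=\Lambda_{i,1}^{(N)}\underline{\underline{X}}_{i,1}^{(N)}\cdots\Lambda_{i,\ell(i)}^{(N)}\underline{\underline{X}}_{i,\ell(i)}^{(N)}\in\bigotimes_{\mathcal{S}}M_N(\mathbb{C}), \] we have \[ \lim_{N\to\infty}\left\|\Delta_{N^{\#\mathcal{S}}}\Bigl[\bigl(Y_1^{(N)}-\Delta_{N^{\#\mathcal{S}}}[Y_1^{(N)}]\bigr)\cdots\bigl(Y_k^{(N)}-\Delta_{N^{\#\mathcal{S}}}[Y_k^{(N)}]\bigr)\Bigr]\right\|_2=0\quad\text{almost surely.} \]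
   Context: $\mathbb{N}=\{1,2,\dots\}$ and $[k]=\{1,\dots,k\}$. A simple graph $(\mathcal{C},\mathcal{E})$ has a finite vertex set and a symmetric edge relation $\mathcal{E}\subset\mathcal{C}\times\mathcal{C}$ with $(c,c)\notin\mathcal{E}$ for all $c$. The word $\chi(1)\cdots\chi(k)$ is $\mathcal{G}$-reduced if whenever $1\le i<j\le k$ and $\chi(i)=\chi(j)$, there is $m$ with $i<m<j$ and $(\chi(i),\chi(m))\notin\mathcal{E}$. For a finite set $S$, $\bigotimes_S M_N(\mathbb{C})$ is the tensor product of copies of $M_N(\mathbb{C})$ indexed by $S$, identified with the algebra of matrices with rows and columns indexed by $[N]^S$; diagonal matrices and permutation matrices in it are understood with respect to this index set, so a uniformly random permutation matrix in $\bigotimes_{\mathcal{S}_c}M_N(\mathbb{C})$ is the matrix of a uniformly random permutation of $[N]^{\mathcal{S}_c}$. A tensor product over a subset of $\mathcal{S}$ is embedded in $\bigotimes_{\mathcal{S}}M_N(\mathbb{C})$ by tensoring with identities $I_N$ in the remaining factors. $\Delta_{N^{\#\mathcal{S}}}[A]$ is the matrix obtained from $A$ by replacing all off-diagonal entries by $0$. $\|\cdot\|$ is the operator norm and $\|A\|_2=\operatorname{tr}(A^*A)^{1/2}$ with $\operatorname{tr}$ the normalized trace. The random matrices for all $N$ are defined on a common probability space; independence is required among the different $c\in\mathcal{C}$ for each fixed $N$. *)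

(* Defs.v *)
From HB Require Import structures.
From mathcomp Require Import all_boot all_order all_fingroup all_algebra.
From mathcomp Require Import complex.
From mathcomp Require Import all_classical all_reals all_analysis.

Set Implicit Arguments.
Unset Strict Implicit.
Unset Printing Implicit Defensive.

Import Order.TTheory GRing.Theory Num.Theory.
Import numFieldNormedType.Exports.

Local Open Scope classical_set_scope.
Local Open Scope ring_scope.

(* Complex square matrices whose rows and columns are indexed by a finite type
   T, through the enumeration enum_val : 'I_#|T| -> T. *)
Notation fmatrix R T := ('M[R[i]%C]_#|T|).

Section FiniteDimensional.
Variable R : realType.

Definition adjmx m n (A : 'M[R[i]]_(m, n)) : 'M[R[i]]_(n, m) :=
  (map_mx Num.conj A)^T.

Definition l2norm n (v : 'cV[R[i]]_n) : R :=
  Num.sqrt (\sum_(a < n) Normc.normc (v a 0) ^+ 2).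

Definition opnorm n (A : 'M[R[i]]_n) : R :=
  sup [set l2norm (A *m v) | v in [set v : 'cV[R[i]]_n | l2norm v <= 1]].

Definition ntr n (A : 'M[R[i]]_n) : R[i] := \tr A / n%:R.

(* The normalized trace of A^* A is a nonnegative real number, so taking its
   real part loses nothing. *)
Definition norm2 n (A : 'M[R[i]]_n) : R :=
  Num.sqrt (complex.Re (ntr (adjmx A *m A))).

Definition Delta n (A : 'M[R[i]]_n) : 'M[R[i]]_n :=
  \matrix_(a, b) if a == b then A a b else 0.

Definition perm_matrix (T : finType) (s : {perm T}) : fmatrix R T :=
  \matrix_(a, b) (enum_val a == s (enum_val b))%:R.

End FiniteDimensional.

(* [N]^S and, for a subset A of S, [N]^A. *)
Notation idx S N := {ffun S -> 'I_N}.
Notation sidx N A := {ffun {s | s \in A} -> 'I_N}.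

Section TensorProducts.
Variable S : finType.

Definition restr N (A : {set S}) (f : idx S N) : sidx N A :=
  [ffun s => f (val s)].

(* X tensored with the identity I_N in the factors outside A. *)
Definition tensor_id (R : realType) N (A : {set S})
    (X : fmatrix R (sidx N A)) : fmatrix R (idx S N) :=
  \matrix_(a, b)
    let f := enum_val a in let g := enum_val b in
    X (enum_rank (restr A f)) (enum_rank (restr A g))
    * [forall s, (s \notin A) ==> (f s == g s)]%:R.

End TensorProducts.

Section Graphs.
Variable C : finType.

Definition simple_graph (E : rel C) := symmetric E /\ irreflexive E.

Definition reduced_word (E : rel C) k (chi : 'I_k -> C) :=
  forall i j : 'I_k, (i < j)%N -> chi i = chi j ->
    exists m : 'I_k, [/\ (i < m)%N, (m < j)%N & ~~ E (chi i) (chi m)].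

End Graphs.

(* Random elements of a finite set T, carrying the discrete sigma-algebra. *)
Section RandomElements.
Context d (Omega : measurableType d) (R : realType).
Variable P : probability Omega R.

Definition random_element (T : finType) (X : Omega -> T) :=
  forall B : {set T}, measurable (X @^-1` [set` B]).

Definition uniformly_distributed (T : finType) (X : Omega -> T) :=
  forall t : T, P (X @^-1` [set t]) = (#|T|%:R^-1)%:E.

Definition independent (C : finType) (T : C -> finType)
    (X : forall c, Omega -> T c) :=
  forall (J : {set C}) (B : forall c, {set T c}),
    P (\bigcap_(c in [set` J]) (X c @^-1` [set` B c]))
    = (\prod_(c in J) P (X c @^-1` [set` B c]))%E.

End RandomElements.

Section Words.
Variables (R : realType) (S C : finType) (Sc : C -> {set S}).

(* The matrix (Sigma^* X Sigma) (x) I, where Sigma is the matrix of s. *)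
Definition conj_tensor N (A : {set S}) (s : {perm sidx N A})
    (X : fmatrix R (sidx N A)) : fmatrix R (idx S N) :=
  tensor_id (adjmx (perm_matrix R s) *m X *m perm_matrix R s).

(* Y_i, for given values sigma of the random permutations. *)
Definition Yword k (chi : 'I_k -> C) (ell : 'I_k -> nat) N
    (Lam : forall i : 'I_k, 'I_(ell i) -> fmatrix R (idx S N))
    (X : forall i : 'I_k, 'I_(ell i) -> fmatrix R (sidx N (Sc (chi i))))
    (sigma : forall c, {perm sidx N (Sc c)}) (i : 'I_k) :
    fmatrix R (idx S N) :=
  \prod_(j < ell i) (Lam i j *m conj_tensor (sigma (chi i)) (X i j)).

End Words.

(* Main.v *)
Require Import Defs.
From HB Require Import structures.
From mathcomp Require Import all_boot all_order all_fingroup all_algebra.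
From mathcomp Require Import complex ring lra.
From mathcomp Require Import all_classical all_reals all_analysis.
Set Implicit Arguments.
Unset Strict Implicit.
Unset Printing Implicit Defensive.
Import Order.TTheory GRing.Theory Num.Theory.
Import numFieldNormedType.Exports.
Local Open Scope classical_set_scope.
Local Open Scope ring_scope.

(** The idea. For a site s let Delta_s be the pinching that keeps the entries
    whose row and column multi-indices agree at s.  It keeps more entries than
    Delta does, so it suffices to bound the normalized 2-norm of Delta_s Z, where Z
    is the product of the centred words and s is a site of the first colour.  We
    bound its moments: [moment_small] says that, for a reduced word Z and a site
    s that belongs to the colour of some letter, some power of
    || Delta_s Z ||_2, averaged over all families of permutations, is O(N^-2).
    Markov's inequality and the Borel--Cantelli lemma then give almost sure
    convergence ([joint_markov], [as_cvg0]).

    The bound is proved by induction on the number of letters.  Write Z = Y W with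
    Y the first letter, c its colour, U = [N]^(S_c), and n = N^#|S|.  If s is not
    in S_c, then Delta_s (Y W) = Y (Delta_s W) because Y does not change the
    coordinate s, and W is shorter.  Otherwise put F = || Delta_s Z ||_2 ^ 2; then
    n F is the sum over u in U of the pairings of Delta_s Z with Y Q_u W, where
    Q_u projects onto the vectors with S_c-coordinates u.  Composing sigma_c with
    a transposition (u v) permutes the families of permutations, so in the sum of
    F ^ P.+1 over all families one may replace sigma by its transposed version
    and average over v as well.  Three facts make this average small.

    - [decouple], [half_center_decouple]: after the transposition, Y Q_u is a
      bounded sum of terms A E_uv D, where E_uv moves the slice u to the slice v,
      D is diagonal, and A and D do not depend on (u, v).  The errors have total
      squared Hilbert--Schmidt norm O(n) over all pairs (u, v), much less than
      the trivial bound.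
    - [word_val_diff]: W and Delta_s Z can be put back to their values before
      the transposition.  For W the price is a sum of norms of pinchings of
      words that are Z without its first letter, broken off inside a later letter
      of colour c.  As the word is reduced, between two letters of colour c there
      is a letter whose colour shares a site with c, so these norms are small by
      induction ([cut_piece], [cut_error_moment]).  Delta_s Z moves by a matrix of
      norm O(n^(1/2) #|U|^(-1/2)), which is paired with pinchings of terms A E_uv D,
      and these are small ([fro_word_val_swap], [hs_pin_transfer]).
    - [hs_sum_transfer]: once everything else is frozen, the pair (u, v) enters
      only through the sum of all E_uv, which is the all-ones matrix on U tensored
      with the identity.  Its Hilbert--Schmidt norm is so small that the pairing is
      smaller than the trivial bound by the factor #|U|^(-1/2) <= N^(-1/2).

    Together ([recursion_ineq]) they bound the average of F ^ P.+1 by that of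
    (F + rho) ^ P.-1 * (rho + e) up to a constant, where rho = N^(-1/2) and e
    collects the norms of the broken words; Young's inequality ([young]) absorbs F
    into the left-hand side. *)

(** * Hilbert--Schmidt geometry of complex matrices *)

Section RealInner.
Variable R : realType.
Local Notation Cx := R[i]%C.
Local Notation Re := (@complex.Re R).
Local Notation Im := (@complex.Im R).

Lemma cReD (x y : Cx) : Re (x + y) = Re x + Re y.
Proof. by case: x; case: y. Qed.
Lemma cReN (x : Cx) : Re (- x) = - Re x.
Proof. by case: x. Qed.
Lemma cReM (x y : Cx) : Re (x * y) = Re x * Re y - Im x * Im y.
Proof. by case: x => a b; case: y. Qed.
Lemma Re_sum I (r : seq I) (P : pred I) (F : I -> Cx) :
  Re (\sum_(i <- r | P i) F i) = \sum_(i <- r | P i) Re (F i).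
Proof. exact: (big_morph Re cReD). Qed.
Lemma Re_conjM (x y : Cx) : Re (Num.conj x * y) = Re x * Re y + Im x * Im y.
Proof.
by case: x => a b; case: y => c d; rewrite /= mulNr opprK.
Qed.
Lemma normc_sqr (x : Cx) : Normc.normc x ^+ 2 = Re x ^+ 2 + Im x ^+ 2.
Proof. by case: x => a b /=; rewrite sqr_sqrtr// addr_ge0// sqr_ge0. Qed.

Lemma adjmxE m n (A : 'M[Cx]_(m, n)) i j : adjmx A i j = Num.conj (A j i).
Proof. by rewrite !mxE. Qed.

Lemma adjmxK m n (A : 'M[Cx]_(m, n)) : adjmx (adjmx A) = A.
Proof. by apply/matrixP => i j; rewrite !adjmxE conjCK. Qed.

Lemma adjmxM m n p (A : 'M[Cx]_(m, n)) (B : 'M[Cx]_(n, p)) :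
  adjmx (A *m B) = adjmx B *m adjmx A.
Proof. by rewrite /adjmx map_mxM trmx_mul. Qed.

(** The real part of the trace pairing; all estimates then are inequalities
    between real numbers. *)
Definition ip m n (A B : 'M[Cx]_(m, n)) : R := Re (\tr (adjmx A *m B)).
(** The squared, unnormalized Hilbert--Schmidt norm; [fro] below is its root,
    and [nrm] the normalized version. *)
Definition hs m n (A : 'M[Cx]_(m, n)) : R := ip A A.

Lemma ipE m n (A B : 'M[Cx]_(m, n)) :
  ip A B = \sum_j \sum_i (Re (A i j) * Re (B i j) + Im (A i j) * Im (B i j)).
Proof.
rewrite /ip /mxtrace Re_sum; apply: eq_bigr => j _.
by rewrite mxE Re_sum; apply: eq_bigr => i _; rewrite adjmxE Re_conjM.
Qed.

Lemma hsE m n (A : 'M[Cx]_(m, n)) :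
  hs A = \sum_i \sum_j Normc.normc (A i j) ^+ 2.
Proof.
rewrite /hs ipE exchange_big; apply: eq_bigr => i _; apply: eq_bigr => j _.
by rewrite normc_sqr !expr2.
Qed.

Lemma ipC m n (A B : 'M[Cx]_(m, n)) : ip A B = ip B A.
Proof.
rewrite !ipE; apply: eq_bigr => i _; apply: eq_bigr => j _; ring.
Qed.

Lemma ipDr m n (A B D : 'M[Cx]_(m, n)) : ip A (B + D) = ip A B + ip A D.
Proof. by rewrite /ip mulmxDr raddfD cReD. Qed.
Lemma ipDl m n (A B D : 'M[Cx]_(m, n)) : ip (A + B) D = ip A D + ip B D.
Proof. by rewrite ipC ipDr !(ipC D). Qed.
Lemma ipNr m n (A B : 'M[Cx]_(m, n)) : ip A (- B) = - ip A B.
Proof. by rewrite /ip mulmxN raddfN cReN. Qed.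
Lemma ipBr m n (A B D : 'M[Cx]_(m, n)) : ip A (B - D) = ip A B - ip A D.
Proof. by rewrite ipDr ipNr. Qed.
Lemma ipBl m n (A B D : 'M[Cx]_(m, n)) : ip (A - B) D = ip A D - ip B D.
Proof. by rewrite ipC ipBr !(ipC D). Qed.
Lemma ip0r m n (A : 'M[Cx]_(m, n)) : ip A 0 = 0.
Proof. by rewrite /ip mulmx0 raddf0. Qed.
Lemma ip_sumr m n (A : 'M[Cx]_(m, n)) I (r : seq I) (P : pred I) F :
  ip A (\sum_(i <- r | P i) F i) = \sum_(i <- r | P i) ip A (F i).
Proof. exact: (big_morph _ (ipDr A) (ip0r A)). Qed.

Lemma ip_mulL m n p (A : 'M[Cx]_(m, n)) (B : 'M[Cx]_(m, p)) (D : 'M[Cx]_(p, n)) :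
  ip A (B *m D) = ip (adjmx B *m A) D.
Proof. by rewrite /ip adjmxM adjmxK mulmxA. Qed.

Lemma ip_mulR m n p (A : 'M[Cx]_(m, n)) (B : 'M[Cx]_(m, p)) (D : 'M[Cx]_(p, n)) :
  ip A (B *m D) = ip (A *m adjmx D) B.
Proof. by rewrite /ip adjmxM adjmxK mulmxA mxtrace_mulC mulmxA. Qed.

Lemma ip_adj m n (A B : 'M[Cx]_(m, n)) : ip (adjmx A) (adjmx B) = ip A B.
Proof. by rewrite ipC /ip adjmxK mxtrace_mulC. Qed.

Lemma hs_adj m n (A : 'M[Cx]_(m, n)) : hs (adjmx A) = hs A.
Proof. exact: ip_adj. Qed.

Lemma hs_ge0 m n (A : 'M[Cx]_(m, n)) : 0 <= hs A.
Proof. by rewrite hsE !sumr_ge0// => i _; rewrite sumr_ge0// => j _; rewrite sqr_ge0. Qed.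
Hint Resolve hs_ge0 : core.

Lemma hs0 m n : hs (0 : 'M[Cx]_(m, n)) = 0.
Proof. by rewrite /hs ip0r. Qed.
Lemma hsN m n (A : 'M[Cx]_(m, n)) : hs (- A) = hs A.
Proof. by rewrite /hs ipNr ipC ipNr opprK. Qed.

Lemma hs_le m n (A B : 'M[Cx]_(m, n)) :
  (forall i j, Normc.normc (A i j) <= Normc.normc (B i j)) -> hs A <= hs B.
Proof.
move=> h; rewrite !hsE ler_sum// => i _; rewrite ler_sum// => j _.
by rewrite ler_sqr ?nnegrE// ?normc_ge0//; case: (A i j) (B i j) => ? ? [? ?] /=; rewrite sqrtr_ge0.
Qed.

Lemma hs_subr m n (A B : 'M[Cx]_(m, n)) : hs (A - B) = hs A - 2 * ip A B + hs B.
Proof. by rewrite /hs ipBr !ipBl (ipC B A); ring. Qed.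
Lemma hs_add m n (A B : 'M[Cx]_(m, n)) : hs (A + B) = hs A + 2 * ip A B + hs B.
Proof. by rewrite /hs ipDr !ipDl (ipC B A); ring. Qed.

Definition fro m n (A : 'M[Cx]_(m, n)) : R := Num.sqrt (hs A).

Lemma fro_ge0 m n (A : 'M[Cx]_(m, n)) : 0 <= fro A.
Proof. exact: sqrtr_ge0. Qed.
Hint Resolve fro_ge0 : core.
Lemma fro_sqr m n (A : 'M[Cx]_(m, n)) : fro A ^+ 2 = hs A.
Proof. by rewrite sqr_sqrtr. Qed.
Lemma froN m n (A : 'M[Cx]_(m, n)) : fro (- A) = fro A.
Proof. by rewrite /fro hsN. Qed.
Lemma fro_adj m n (A : 'M[Cx]_(m, n)) : fro (adjmx A) = fro A.
Proof. by rewrite /fro hs_adj. Qed.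
Lemma fro_le m n p q (A : 'M[Cx]_(m, n)) (B : 'M[Cx]_(p, q)) : hs A <= hs B -> fro A <= fro B.
Proof. exact: ler_wsqrtr. Qed.

End RealInner.

#[local] Hint Extern 0 (is_true (0 <= hs _)) => exact: hs_ge0 : core.
#[local] Hint Extern 0 (is_true (0 <= fro _)) => exact: fro_ge0 : core.

(** * Contractions and pinchings *)

Section Contractions.
Variable R : realType.
Local Notation Cx := R[i]%C.

Lemma normc_nonneg (x : Cx) : 0 <= Normc.normc x.
Proof. by case: x => a b; rewrite sqrtr_ge0. Qed.

Lemma normc_real (r : R) : Normc.normc (r%:C)%C = `|r|.
Proof. by rewrite /= expr0n /= addr0 sqrtr_sqr. Qed.

Lemma hsZ m n (c : Cx) (A : 'M[Cx]_(m, n)) : hs (c *: A) = Normc.normc c ^+ 2 * hs A.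
Proof.
rewrite !hsE mulr_sumr; apply: eq_bigr => i _; rewrite mulr_sumr.
by apply: eq_bigr => j _; rewrite mxE Normc.normcM exprMn.
Qed.

Lemma ipZl m n (r : R) (A B : 'M[Cx]_(m, n)) : ip ((r%:C)%C *: A) B = r * ip A B.
Proof.
rewrite !ipE mulr_sumr; apply: eq_bigr => j _; rewrite mulr_sumr.
by apply: eq_bigr => i _; rewrite mxE; case: (A i j) => a b /=; ring.
Qed.
Lemma ipZr m n (r : R) (A B : 'M[Cx]_(m, n)) : ip A ((r%:C)%C *: B) = r * ip A B.
Proof. by rewrite ipC ipZl ipC. Qed.

Lemma hs_eq0 m n (A : 'M[Cx]_(m, n)) : hs A = 0 -> A = 0.
Proof.
move=> h; apply/matrixP => i j; rewrite mxE; apply: Normc.eq0_normc.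
have h2 : \sum_i \sum_j Normc.normc (A i j) ^+ 2 = 0 by rewrite -hsE.
have := @psumr_eq0P _ _ _ _ (fun i _ => sumr_ge0 _ (fun j _ => sqr_ge0 (Normc.normc (A i j)))) h2 i isT.
move=> h3.
have := @psumr_eq0P _ _ _ _ (fun j _ => sqr_ge0 (Normc.normc (A i j))) h3 j isT.
by move/eqP; rewrite sqrf_eq0 => /eqP.
Qed.

Lemma ip_le m n (A B : 'M[Cx]_(m, n)) : ip A B <= fro A * fro B.
Proof.
have [/eqP A0|A0] := boolP (fro A == 0).
  by rewrite A0 mul0r (@hs_eq0 _ _ A) -?fro_sqr ?A0 ?expr0n// ipC ip0r.
have [/eqP B0|B0] := boolP (fro B == 0).
  by rewrite B0 mulr0 (@hs_eq0 _ _ B) -?fro_sqr ?B0 ?expr0n// ip0r.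
have p : 0 < fro A * fro B by rewrite mulr_gt0// lt_def ?A0 ?B0 fro_ge0.
have := hs_ge0 (((fro B)%:C)%C *: A - ((fro A)%:C)%C *: B).
rewrite hs_subr ipZl ipZr !hsZ !normc_real !ger0_norm// -!fro_sqr => h.
rewrite -(ler_pM2l p) -subr_ge0; nra.
Qed.

Lemma ip_le_abs m n (A B : 'M[Cx]_(m, n)) : `|ip A B| <= fro A * fro B.
Proof. by rewrite ler_norml ip_le andbT lerNl -ipNr -(froN B) ip_le. Qed.

Lemma fro_add m n (A B : 'M[Cx]_(m, n)) : fro (A + B) <= fro A + fro B.
Proof.
rewrite -(@ler_sqr R) ?nnegrE ?addr_ge0// fro_sqr hs_add sqrrD !fro_sqr.
have := ip_le A B; lra.
Qed.
Lemma fro_sub m n (A B : 'M[Cx]_(m, n)) : fro (A - B) <= fro A + fro B.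
Proof. by rewrite -(froN B) fro_add. Qed.
Lemma fro0 m n : fro (0 : 'M[Cx]_(m, n)) = 0.
Proof. by rewrite /fro hs0 sqrtr0. Qed.
Lemma fro_sum m n I (r : seq I) (P : pred I) (F : I -> 'M[Cx]_(m, n)) :
  fro (\sum_(i <- r | P i) F i) <= \sum_(i <- r | P i) fro (F i).
Proof.
elim/big_ind2 : _ => [|A a B b ha hb|//]; first by rewrite fro0.
exact: le_trans (fro_add _ _) (lerD _ _).
Qed.
Lemma fro_dist m n (A B : 'M[Cx]_(m, n)) : fro A <= fro B + fro (A - B).
Proof. by apply: le_trans (fro_add _ _); rewrite addrC subrK. Qed.
Lemma froZ m n (r : R) (A : 'M[Cx]_(m, n)) : fro ((r%:C)%C *: A) = `|r| * fro A.
Proof.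
by rewrite /fro hsZ normc_real sqrtrM ?sqr_ge0// sqrtr_sqr normr_id.
Qed.
Lemma hs_add2 m n (A B : 'M[Cx]_(m, n)) : hs (A + B) <= 2 * hs A + 2 * hs B.
Proof. have := hs_ge0 (A - B); rewrite hs_subr hs_add; lra. Qed.
Lemma hs_sub2 m n (A B : 'M[Cx]_(m, n)) : hs (A - B) <= 2 * hs A + 2 * hs B.
Proof. by rewrite -(hsN B) hs_add2. Qed.
Lemma hs_sum m n I (r : seq I) (F : I -> 'M[Cx]_(m, n)) :
  hs (\sum_(i <- r) F i) <= (size r)%:R * \sum_(i <- r) hs (F i).
Proof.
elim: r => [|i r IH]; first by rewrite !big_nil hs0 mulr0.
rewrite !big_cons hs_add /= -natr1.
have c := ip_le (F i) (\sum_(j <- r) F j).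
have q : 2 * (fro (F i) * fro (\sum_(j <- r) F j)) <= (size r)%:R * hs (F i) + \sum_(j <- r) hs (F j).
  have [s0|s0] := posnP (size r).
    by move: (size0nil s0) => ->; rewrite !big_nil fro0 !mulr0 addr0 mulr_ge0.
  rewrite -fro_sqr; set x := fro _; set y := fro _.
  have hy : y ^+ 2 <= (size r)%:R * \sum_(j <- r) hs (F j) by rewrite fro_sqr.
  have s1 : 0 < (size r)%:R :> R by rewrite ltr0n.
  rewrite -(ler_pM2l s1).
  have := sqr_ge0 ((size r)%:R * x - y); nra.
nra.
Qed.

(** Operator norm at most 1, stated by its action on vectors, which is the form
    that passes directly to products, pinchings and tensor products. *)
Definition contr n (A : 'M[Cx]_n) := forall v : 'cV[Cx]_n, hs (A *m v) <= hs v.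

Lemma hs_col m n (A : 'M[Cx]_(m, n)) : hs A = \sum_j hs (col j A).
Proof.
rewrite hsE exchange_big; apply: eq_bigr => j _; rewrite hsE.
by apply: eq_bigr => i _; rewrite big_ord1 mxE.
Qed.

Lemma hs_contr n p (A : 'M[Cx]_n) (B : 'M[Cx]_(n, p)) : contr A -> hs (A *m B) <= hs B.
Proof.
move=> cA; rewrite !(hs_col _ ) ler_sum// => j _.
rewrite (_ : col j (A *m B) = A *m col j B) ?cA//.
by apply/matrixP => a b; rewrite !mxE; apply: eq_bigr => k _; rewrite !mxE.
Qed.

Lemma contr1 n : contr (1%:M : 'M[Cx]_n).
Proof. by move=> v; rewrite mul1mx. Qed.
Lemma contrM n (A B : 'M[Cx]_n) : contr A -> contr B -> contr (A *m B).
Proof. by move=> cA cB v; rewrite -mulmxA; apply: le_trans (cA _) (cB _). Qed.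
Lemma contrN n (A : 'M[Cx]_n) : contr A -> contr (- A).
Proof. by move=> cA v; rewrite mulNmx hsN. Qed.

(** Pair A^* v with itself, move one A^* to the other side, and apply
    Cauchy--Schwarz. *)
Lemma contr_adj n (A : 'M[Cx]_n) : contr A -> contr (adjmx A).
Proof.
move=> cA v.
have h : hs (adjmx A *m v) <= fro v * fro (adjmx A *m v).
  rewrite {1}/hs ip_mulL adjmxK ipC; apply: le_trans (ip_le _ _) _.
  by rewrite ler_wpM2l// fro_le.
rewrite -!fro_sqr in h *; rewrite ler_sqr ?nnegrE//.
have [/eqP ->//|A0] := boolP (fro (adjmx A *m v) == 0).
have p : 0 < fro (adjmx A *m v) by rewrite lt_def A0 fro_ge0.
by rewrite -(ler_pM2r p) -expr2.
Qed.

Lemma hs_contr_r n p (A : 'M[Cx]_(p, n)) (B : 'M[Cx]_n) : contr B -> hs (A *m B) <= hs A.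
Proof. by move=> cB; rewrite -hs_adj adjmxM -(hs_adj A) hs_contr//; apply: contr_adj. Qed.

Lemma hs_diffl n p (A B : 'M[Cx]_n) (M : 'M[Cx]_(n, p)) :
  contr A -> contr B -> hs ((A - B) *m M) <= 4 * hs M.
Proof.
move=> cA cB; rewrite mulmxBl; apply: le_trans (hs_sub2 _ _) _.
by have := hs_contr M cA; have := hs_contr M cB; move: (hs _) (hs _) (hs _) => a b c; lra.
Qed.
Lemma hs_diffr n p (A B : 'M[Cx]_n) (M : 'M[Cx]_(p, n)) :
  contr A -> contr B -> hs (M *m (A - B)) <= 4 * hs M.
Proof.
move=> cA cB; rewrite mulmxBr; apply: le_trans (hs_sub2 _ _) _.
by have := hs_contr_r M cA; have := hs_contr_r M cB; move: (hs _) (hs _) (hs _) => a b c; lra.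
Qed.

Lemma fro_contr n p (A : 'M[Cx]_n) (B : 'M[Cx]_(n, p)) : contr A -> fro (A *m B) <= fro B.
Proof. by move=> cA; rewrite fro_le// hs_contr. Qed.
Lemma fro_contr_r n p (A : 'M[Cx]_(p, n)) (B : 'M[Cx]_n) : contr B -> fro (A *m B) <= fro A.
Proof. by move=> cA; rewrite fro_le// hs_contr_r. Qed.

Lemma contr_half n (A B : 'M[Cx]_n) : contr A -> contr B ->
  contr (((2^-1)%:C)%C *: (A - B)).
Proof.
move=> cA cB v; rewrite -scalemxAl mulmxBl hsZ normc_real ger0_norm ?invr_ge0//.
have := hs_sub2 (A *m v) (B *m v); have := cA v; have := cB v; lra.
Qed.

Lemma hs1 n : hs (1%:M : 'M[Cx]_n) = n%:R.
Proof.
rewrite hsE (eq_bigr (fun _ => 1)) ?sumr_const ?card_ord// => i _.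
rewrite (bigD1 i)//= big1 ?addr0 ?mxE ?eqxx ?Normc.normc1 ?expr1n// => j ji.
by rewrite mxE eq_sym (negPf ji) Normc.normc0 expr0n.
Qed.

Lemma hs_contr_le n (A : 'M[Cx]_n) : contr A -> hs A <= n%:R.
Proof. by move=> cA; rewrite -hs1 -{1}(mulmx1 A) hs_contr. Qed.

Lemma perm_mulE m n (s : {perm 'I_m}) (A : 'M[Cx]_(m, n)) i j :
  (perm_mx s *m A) i j = A (s i) j.
Proof. by rewrite -row_permE mxE. Qed.

Lemma contr_perm n (s : {perm 'I_n}) : contr (perm_mx s : 'M[Cx]_n).
Proof.
move=> v; rewrite !hsE [X in _ <= X](reindex_inj (@perm_inj _ s)) /=.
by apply: ler_sum => i _; apply: ler_sum => j _; rewrite perm_mulE.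
Qed.

Lemma mul_diagE m n (D : 'M[Cx]_m) (A : 'M[Cx]_(m, n)) i j :
  is_diag_mx D -> (D *m A) i j = D i i * A i j.
Proof. by move=> /diag_mxP[d ->]; rewrite mul_diag_mx !mxE eqxx mulr1n. Qed.

Lemma mulmx_diagE m n (D : 'M[Cx]_n) (A : 'M[Cx]_(m, n)) i j :
  is_diag_mx D -> (A *m D) i j = A i j * D j j.
Proof. by move=> /diag_mxP[d ->]; rewrite mul_mx_diag !mxE eqxx mulr1n. Qed.

Lemma diagM n (D E : 'M[Cx]_n) : is_diag_mx D -> is_diag_mx E -> is_diag_mx (D *m E).
Proof.
move=> dD dE; apply/is_diag_mxP => i j ij; rewrite mul_diagE//.
by rewrite (is_diag_mxP dE)// mulr0.
Qed.

Lemma diagC n (D E : 'M[Cx]_n) : is_diag_mx D -> is_diag_mx E -> D *m E = E *m D.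
Proof. by move=> /diag_mxP[d ->] /diag_mxP[e ->]; rewrite diag_mxC. Qed.

Lemma diag0 n (D : 'M[Cx]_n) i j : is_diag_mx D -> i != j -> D i j = 0.
Proof. by move=> /is_diag_mxP h ij; apply: h. Qed.

Lemma contr_diag n (D : 'M[Cx]_n) : is_diag_mx D ->
  (forall i, Normc.normc (D i i) ^+ 2 <= 1) -> contr D.
Proof.
move=> dD h v; rewrite !hsE; apply: ler_sum => i _; apply: ler_sum => j _.
by rewrite mul_diagE// Normc.normcM exprMn ler_piMl ?sqr_ge0.
Qed.

Section Pinching.
Variables (n : nat) (L : eqType) (f : 'I_n -> L).

(** The conditional expectation onto the matrices that are block diagonal for the
    fibres of f: [f := id] gives Delta, and a coordinate of a multi-index gives the
    pinching in one tensor factor. *)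
Definition pin (A : 'M[Cx]_n) : 'M[Cx]_n :=
  \matrix_(a, b) if f a == f b then A a b else 0.

Lemma pinD A B : pin (A + B) = pin A + pin B.
Proof. by apply/matrixP => a b; rewrite !mxE; case: ifP; rewrite ?addr0. Qed.
Lemma pinN A : pin (- A) = - pin A.
Proof. by apply/matrixP => a b; rewrite !mxE; case: ifP; rewrite ?oppr0. Qed.
Lemma pinB A B : pin (A - B) = pin A - pin B.
Proof. by rewrite pinD pinN. Qed.
Lemma pinZ c A : pin (c *: A) = c *: pin A.
Proof. by apply/matrixP => a b; rewrite !mxE; case: ifP; rewrite ?mulr0. Qed.
Lemma pin_id A : pin (pin A) = pin A.
Proof. by apply/matrixP => a b; rewrite !mxE; case: (f a == f b). Qed.

Lemma hs_pin A : hs (pin A) <= hs A.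
Proof.
apply: hs_le => a b; rewrite mxE; case: ifP => // _.
by rewrite Normc.normc0 normc_nonneg.
Qed.
Lemma fro_pin A : fro (pin A) <= fro A.
Proof. exact: fro_le (hs_pin A). Qed.

(** A pinching is an orthogonal projection for the trace pairing. *)
Lemma ip_pin A B : ip (pin A) B = ip (pin A) (pin B).
Proof.
rewrite !ipE; apply: eq_bigr => j _; apply: eq_bigr => i _; rewrite !mxE.
by case: ifP => //; rewrite /= !mul0r.
Qed.

Lemma pin_mulr A D : is_diag_mx D -> pin (A *m D) = pin A *m D.
Proof.
move=> dD; apply/matrixP => a b; rewrite mulmx_diagE// !mxE; case: ifP => _.
  by rewrite -mulmx_diagE// mxE.
by rewrite mul0r.
Qed.

(** A pinching is a bimodule map over the matrices that respect the fibres. *)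
Lemma pin_mull (Y A : 'M[Cx]_n) : (forall a b, f a != f b -> Y a b = 0) ->
  pin (Y *m A) = Y *m pin A.
Proof.
move=> hY; apply/matrixP => a b; rewrite !mxE; case: ifP => ab.
  apply: eq_bigr => k _; rewrite mxE; have [ak|ak] := eqVneq (f a) (f k).
    by rewrite -ak ab.
  by rewrite hY// !mul0r.
rewrite big1// => k _; rewrite mxE; have [ak|ak] := eqVneq (f a) (f k).
  by rewrite -ak ab mulr0.
by rewrite hY// !mul0r.
Qed.

Definition fiber_part (t : L) (v : 'cV[Cx]_n) : 'cV[Cx]_n :=
  \col_a if f a == t then v a 0 else 0.

End Pinching.

(** The pinched matrix is the direct sum of the compressions of A to the fibres
    of f, and each compression is a contraction. *)
Lemma contr_pin n (L : finType) (f : 'I_n -> L) A : contr A -> contr (pin f A).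
Proof.
move=> cA v.
have -> : hs (pin f A *m v) = \sum_t hs (fiber_part f t (A *m fiber_part f t v)).
  rewrite hsE [RHS](_ : _ = \sum_t \sum_a \sum_b Normc.normc (fiber_part f t (A *m fiber_part f t v) a b) ^+ 2);
    last by apply: eq_bigr => t _; rewrite hsE.
  rewrite [RHS]exchange_big /=; apply: eq_bigr => a _.
  rewrite (bigD1 (f a))//= !big_ord1 big1 ?addr0; last first.
    move=> t ta; rewrite big_ord1 mxE eq_sym (negPf ta) Normc.normc0 expr0n//.
  congr (Normc.normc _ ^+ 2); rewrite !mxE eqxx; apply: eq_bigr => b _.
  by rewrite !mxE eq_sym; case: ifP; rewrite ?mulr0 ?mul0r.
have -> : hs v = \sum_t hs (fiber_part f t v).
  rewrite hsE [RHS](_ : _ = \sum_t \sum_a \sum_b Normc.normc (fiber_part f t v a b) ^+ 2);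
    last by apply: eq_bigr => t _; rewrite hsE.
  rewrite [RHS]exchange_big /=; apply: eq_bigr => a _.
  rewrite (bigD1 (f a))//= !big_ord1 big1 ?addr0 ?mxE ?eqxx// => t ta.
  by rewrite big_ord1 mxE eq_sym (negPf ta) Normc.normc0 expr0n.
apply: ler_sum => t _; apply: le_trans (cA _); apply: hs_le => a b.
by rewrite mxE ord1; case: ifP => //; rewrite Normc.normc0 normc_nonneg.
Qed.

Lemma hs_pin_refine n (L L' : eqType) (f : 'I_n -> L) (g : 'I_n -> L') A :
  (forall a b, f a = f b -> g a = g b) -> hs (pin f A) <= hs (pin g A).
Proof.
move=> fg; apply: hs_le => a b; rewrite !mxE; case: ifP => [/eqP/fg ->|_].
  by rewrite eqxx.
by rewrite Normc.normc0 normc_nonneg.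
Qed.

Lemma Delta_pin n (A : 'M[Cx]_n) : Delta A = pin id A.
Proof. by apply/matrixP => a b; rewrite !mxE. Qed.

Lemma is_diag_Delta n (A : 'M[Cx]_n) : is_diag_mx (Delta A).
Proof. by apply/is_diag_mxP => i j ij; rewrite mxE -val_eqE (negPf ij). Qed.

Lemma contr_Delta n (A : 'M[Cx]_n) : contr A -> contr (Delta A).
Proof. by rewrite Delta_pin; apply: contr_pin. Qed.

End Contractions.

(** * Slices and transpositions of a product index set *)

(** An index set of size n presented as a product U x V.  In the application U is
    [N]^(S_c) and V is [N]^(S \ S_c). *)
Record splitting n (U V : finType) := Splitting {
  spi : 'I_n -> U;
  srho : 'I_n -> V;
  smk : U -> V -> 'I_n;
  spimk : forall u v, spi (smk u v) = u;
  srhomk : forall u v, srho (smk u v) = v;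
  smkK : forall a, smk (spi a) (srho a) = a }.

Section Splitting.
Variable R : realType.
Local Notation Cx := R[i]%C.
Variables (n : nat) (U V : finType) (sp : splitting n U V).
Local Notation pi := (spi sp).
Local Notation rho := (srho sp).

Lemma split_inj a b : pi a = pi b -> rho a = rho b -> a = b.
Proof. by move=> h1 h2; rewrite -(smkK sp a) h1 h2 smkK. Qed.

Lemma lift_fun_inj (p : {perm U}) : injective (fun a => smk sp (p (pi a)) (rho a)).
Proof.
move=> a b e; have := congr1 pi e; have := congr1 rho e.
by rewrite !srhomk !spimk => h2 /perm_inj h1; apply: split_inj.
Qed.
Definition lift_left (p : {perm U}) : {perm 'I_n} := perm (@lift_fun_inj p).

Lemma pi_lift_left p a : pi (lift_left p a) = p (pi a).
Proof. by rewrite permE spimk. Qed.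
Lemma rho_lift_left p a : rho (lift_left p a) = rho a.
Proof. by rewrite permE srhomk. Qed.
Lemma lift_leftM p q : lift_left (p * q)%g = (lift_left p * lift_left q)%g.
Proof.
apply/permP => a; apply: split_inj; rewrite permM ?pi_lift_left ?rho_lift_left ?permM//.
Qed.
Lemma lift_left1 : lift_left 1%g = 1%g.
Proof. by apply/permP => a; apply: split_inj; rewrite ?pi_lift_left ?rho_lift_left !perm1. Qed.

(** The matrices that preserve the V-coordinate, i.e. families of U x U matrices
    indexed by V.  They contain the diagonal matrices and M_U (x) I, hence all words
    of a single colour. *)
Definition blk (A : 'M[Cx]_n) := forall a b, rho a != rho b -> A a b = 0.

Lemma blk_diag D : is_diag_mx D -> blk D.
Proof. by move=> dD a b ab; rewrite diag0//; apply: contraNneq ab => ->. Qed.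
Lemma blk1 : blk 1%:M.
Proof. exact/blk_diag/scalar_mx_is_diag. Qed.
Lemma blkM A B : blk A -> blk B -> blk (A *m B).
Proof.
move=> bA bB a b ab; rewrite mxE big1// => k _.
have [ak|ak] := eqVneq (rho a) (rho k); last by rewrite bA// mul0r.
by rewrite bB ?mulr0// -ak.
Qed.
Lemma blkB A B : blk A -> blk B -> blk (A - B).
Proof. by move=> bA bB a b ab; rewrite !mxE bA// bB// subrr. Qed.
Lemma blkN A : blk A -> blk (- A).
Proof. by move=> bA a b ab; rewrite !mxE bA// oppr0. Qed.
Lemma blkZ c A : blk A -> blk (c *: A).
Proof. by move=> bA a b ab; rewrite !mxE bA// mulr0. Qed.
Lemma blk_Delta A : blk (Delta A).
Proof. exact/blk_diag/is_diag_Delta. Qed.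

Definition slice (u : U) : 'M[Cx]_n := \matrix_(a, b) ((a == b) && (pi a == u))%:R.
Local Notation Q := slice.

Lemma Q_diag u : is_diag_mx (Q u).
Proof. by apply/is_diag_mxP => i j ij; rewrite mxE -val_eqE (negPf ij). Qed.
Lemma QmulE m u (A : 'M[Cx]_(n, m)) i j : (Q u *m A) i j = if pi i == u then A i j else 0.
Proof. by rewrite mul_diagE ?Q_diag// mxE eqxx; case: eqP; rewrite ?mul1r ?mul0r. Qed.
Lemma mulQE m u (A : 'M[Cx]_(m, n)) i j : (A *m Q u) i j = if pi j == u then A i j else 0.
Proof. by rewrite mulmx_diagE ?Q_diag// mxE eqxx; case: eqP; rewrite ?mulr1 ?mulr0. Qed.
Lemma contr_Q u : contr (Q u).
Proof.
apply: contr_diag; first exact: Q_diag.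
by move=> i; rewrite mxE eqxx; case: eqP; rewrite /= expr0n /= addr0 sqr_sqrtr ?expr1n ?expr0n//= ler01.
Qed.
Lemma QQ u : Q u *m Q u = Q u.
Proof. by apply/matrixP => i j; rewrite QmulE mxE; case: eqP; rewrite ?andbF. Qed.

Lemma hs_sumQl m (A : 'M[Cx]_(n, m)) : \sum_u hs (Q u *m A) = hs A.
Proof.
rewrite hsE (eq_bigr (fun u => \sum_i \sum_j if pi i == u then Normc.normc (A i j) ^+ 2 else 0)).
  rewrite exchange_big /=; apply: eq_bigr => i _.
  rewrite (bigD1 (pi i))//= eqxx [X in _ + X]big1 ?addr0// => u ui.
  by rewrite eq_sym (negPf ui) big1.
move=> u _; rewrite hsE; apply: eq_bigr => i _; apply: eq_bigr => j _.
by rewrite QmulE; case: ifP; rewrite // Normc.normc0 expr0n.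
Qed.

Lemma Q_adj u : adjmx (Q u) = Q u.
Proof.
apply/matrixP => i j; rewrite adjmxE !mxE eq_sym rmorph_nat.
by have [->|] := eqVneq i j.
Qed.

Lemma hs_sumQr m (A : 'M[Cx]_(m, n)) : \sum_v hs (A *m Q v) = hs A.
Proof.
rewrite -(hs_adj A) -hs_sumQl; apply: eq_bigr => v _.
by rewrite -hs_adj adjmxM Q_adj.
Qed.

Lemma hs_sumQQ (A : 'M[Cx]_n) : \sum_u \sum_v hs (Q u *m A *m Q v) = hs A.
Proof. by rewrite -hs_sumQl; apply: eq_bigr => u _; rewrite hs_sumQr. Qed.

Lemma hs_pin_pi (A : 'M[Cx]_n) : \sum_u hs (Q u *m A *m Q u) = hs (pin pi A).
Proof.
rewrite hsE (eq_bigr (fun u => \sum_i \sum_j if (pi i == u) && (pi j == u) then Normc.normc (A i j) ^+ 2 else 0)).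
  rewrite exchange_big /=; apply: eq_bigr => i _.
  rewrite exchange_big /=; apply: eq_bigr => j _.
  rewrite (bigD1 (pi i))//= eqxx /= [X in _ + X]big1 ?addr0.
    by rewrite mxE eq_sym; case: ifP; rewrite // Normc.normc0 expr0n.
  by move=> u ui; rewrite eq_sym (negPf ui).
move=> u _; rewrite hsE; apply: eq_bigr => i _; apply: eq_bigr => j _.
by rewrite mulQE QmulE andbC; case: (pi j == u); case: (pi i == u); rewrite // Normc.normc0 expr0n.
Qed.

Lemma hs_Q u : hs (Q u) = #|V|%:R.
Proof.
rewrite hsE.
transitivity (\sum_i (pi i == u)%:R : R).
  apply: eq_bigr => i _; rewrite (bigD1 i)//= big1 ?addr0.
    by rewrite mxE eqxx; case: eqP => _ /=; rewrite expr0n /= addr0 sqr_sqrtr ?sqr_ge0 ?expr1n ?expr0n.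
  by move=> j ji; rewrite mxE eq_sym (negPf ji) Normc.normc0 expr0n.
have inj : injective (smk sp u).
  by move=> v v' e; rewrite -(srhomk sp u v) e srhomk.
rewrite -natr_sum -(fintype.card_image inj); congr (_%:R).
transitivity #|[pred i | pi i == u]|.
  rewrite -sum1_card [RHS]big_mkcond /=. apply: eq_bigr => i _. rewrite /in_mem /=. by case: (pi i == u).
apply: eq_card => i; rewrite !inE.
apply/idP/fintype.imageP => [/eqP <-|[v _ ->]]; last by rewrite spimk.
by exists (rho i); rewrite ?smkK.
Qed.

Lemma fro_Q u : fro (Q u) = Num.sqrt #|V|%:R.
Proof. by rewrite /fro hs_Q. Qed.

Lemma card_split : n = (#|U| * #|V|)%N.
Proof.
rewrite -card_prod -{1}(card_ord n); apply: (@bij_eq_card _ _ (fun a => (pi a, rho a))).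
exists (fun p => smk sp p.1 p.2) => [a|[u v]] /=; first by rewrite smkK.
by rewrite spimk srhomk.
Qed.

Definition slice_swap (u v : U) : 'M[Cx]_n := perm_mx (lift_left (tperm u v)).
Local Notation T := slice_swap.

Lemma contr_T u v : contr (T u v).
Proof. exact: contr_perm. Qed.
Lemma TT u v : T u v *m T u v = 1%:M.
Proof. by rewrite -perm_mxM -lift_leftM tperm2 lift_left1 perm_mx1. Qed.

Lemma TmulE m u v (A : 'M[Cx]_(n, m)) i j : (T u v *m A) i j = A (lift_left (tperm u v) i) j.
Proof. exact: perm_mulE. Qed.

Lemma lift_left_tpermK u v : involutive (lift_left (tperm u v)).
Proof. by move=> i; rewrite -permM -lift_leftM tperm2 lift_left1 perm1. Qed.

Lemma mulTE m u v (A : 'M[Cx]_(m, n)) i j : (A *m T u v) i j = A i (lift_left (tperm u v) j).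
Proof.
rewrite mxE (bigD1 (lift_left (tperm u v) j))//= big1 ?addr0.
  by rewrite mxE mxE lift_left_tpermK eqxx mulr1.
move=> k kj; rewrite mxE mxE; case: eqP; rewrite ?mulr0// => e.
by rewrite -e lift_left_tpermK eqxx in kj.
Qed.

Lemma T_blk u v A : blk A -> blk (T u v *m A *m T u v).
Proof. by move=> bA a b ab; rewrite mulTE TmulE bA// !rho_lift_left. Qed.

Lemma T_diag u v D : is_diag_mx D -> is_diag_mx (T u v *m D *m T u v).
Proof.
move=> dD; apply/is_diag_mxP => i j ij; rewrite mulTE TmulE diag0//.
by apply: contraNneq ij => /perm_inj ->.
Qed.

Lemma TE u v i j : T u v i j = (lift_left (tperm u v) i == j)%:R.
Proof. by rewrite /slice_swap !mxE. Qed.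

Lemma QT u v : Q v *m T u v = T u v *m Q u.
Proof.
apply/matrixP => i j; rewrite QmulE mulQE TE.
case: (lift_left (tperm u v) i =P j) => [<-|_]; last by rewrite !if_same.
rewrite pi_lift_left; case: tpermP => [->|->|/eqP/negPf -> /eqP/negPf ->//]; rewrite ?eqxx//.
by rewrite eq_sym.
Qed.

(** The partial isometry that carries the slice u to the slice v and keeps the
    V-coordinate. *)
Definition transfer (v u : U) : 'M[Cx]_n := Q v *m T u v.
Local Notation Tr := transfer.

Lemma transferQ v u : Tr v u *m Q u = Tr v u.
Proof. by rewrite /transfer QT -mulmxA QQ. Qed.
Lemma Qtransfer v u : Q v *m Tr v u = Tr v u.
Proof. by rewrite /transfer mulmxA QQ. Qed.

Lemma transferE v u a b : Tr v u a b = [&& pi a == v, pi b == u & rho a == rho b]%:R.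
Proof.
rewrite /transfer QmulE TE; case: (eqVneq (pi a) v) => [av|]//=.
congr (nat_of_bool _)%:R; apply/eqP/andP => [<-|[/eqP bu /eqP ab]].
  by rewrite pi_lift_left rho_lift_left av tpermR !eqxx.
apply: split_inj; first by rewrite pi_lift_left av tpermR.
by rewrite rho_lift_left.
Qed.

(** Within a slice a matrix of [blk] is diagonal, since the V-coordinate
    determines the index. *)
Lemma QAQ v A : blk A -> Q v *m A *m Q v = Delta A *m Q v.
Proof.
move=> bA; apply/matrixP => a b; rewrite !mulQE QmulE [Delta _ _ _]mxE.
have [bv|//] := eqVneq (pi b) v; have [->|ab] := eqVneq a b; first by rewrite bv eqxx.
have [av|//] := eqVneq (pi a) v; apply: bA; apply: contraNneq ab => ab.
by apply/eqP/split_inj => //; rewrite av.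
Qed.

(** The word of w with each diagonal factor conjugated by the transposition.
    Composing a permutation with (u v) conjugates the other factors instead; the two
    agree up to a global conjugation ([mono_swap]), and in this form (u, v) enters
    through diagonal matrices only. *)
Definition twisted_mono u v (w : seq ('M[Cx]_n * 'M[Cx]_n)) : 'M[Cx]_n :=
  foldr (fun p M => (T u v *m p.1 *m T u v) *m p.2 *m M) 1%:M w.

Definition good_factor (p : 'M[Cx]_n * 'M[Cx]_n) :=
  [/\ is_diag_mx p.1, contr p.1, contr p.2 & blk p.2].

Lemma twisted_mono_rcons u v w p :
  twisted_mono u v (rcons w p) = twisted_mono u v w *m (T u v *m p.1 *m T u v) *m p.2.
Proof. by elim: w => [|q w IH] /=; rewrite ?mul1mx ?mulmx1// IH !mulmxA. Qed.

Lemma contr_TDT u v A : contr A -> contr (T u v *m A *m T u v).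
Proof. by move=> cA; apply: contrM; [apply: contrM|]; rewrite //; apply: contr_T. Qed.

Lemma contr_twisted_mono u v w : (forall p, p \in w -> good_factor p) -> contr (twisted_mono u v w).
Proof.
elim: w => [|p w IH] h /=; first exact: contr1.
have [_ c1 c2 _] := h p (mem_head _ _).
apply: contrM; last by apply: IH => q qw; apply: h; rewrite in_cons qw orbT.
by apply: contrM => //; apply: contr_TDT.
Qed.

Lemma blk_twisted_mono u v w : (forall p, p \in w -> good_factor p) -> blk (twisted_mono u v w).
Proof.
elim: w => [|p w IH] h /=; first exact: blk1.
have [d1 c1 c2 b2] := h p (mem_head _ _).
apply: blkM; last by apply: IH => q qw; apply: h; rewrite in_cons qw orbT.
by apply: blkM => //; apply/T_blk/blk_diag.
Qed.

(** The normal form reached by decoupling: the coefficients in s are independent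
    of (u, v), which enters through the transfer alone. *)
Definition transfer_sum (s : seq ('M[Cx]_n * 'M[Cx]_n)) u v : 'M[Cx]_n :=
  \sum_(p <- s) p.1 *m Tr v u *m p.2.

Definition good_pair (p : 'M[Cx]_n * 'M[Cx]_n) :=
  [/\ contr p.1, blk p.1, contr p.2 & is_diag_mx p.2].

End Splitting.

(** * Decoupling a transposed word *)

Section Decoupling.
Variable R : realType.
Local Notation Cx := R[i]%C.
Local Notation Q := (@slice R _ _ _).
Local Notation T := (@slice_swap R _ _ _).
Local Notation Tr := (@transfer R _ _ _).

Lemma diagB n (D E : 'M[Cx]_n) : is_diag_mx D -> is_diag_mx E -> is_diag_mx (D - E).
Proof.
move=> dD dE; apply/is_diag_mxP => i j ij; rewrite mxE [in X in _ + X]mxE.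
by rewrite (diag0 dD)// (diag0 dE)// subr0.
Qed.

Lemma transfer_TDT n U V (sp : splitting n U V) u v (D : 'M[Cx]_n) : is_diag_mx D ->
  Tr sp v u *m (T sp u v *m D *m T sp u v) = D *m Tr sp v u.
Proof.
move=> dD; rewrite /transfer !mulmxA -(mulmxA (Q sp v)) TT mulmx1.
by rewrite (diagC (Q_diag R _ _)).
Qed.

Lemma TDTT n U V (sp : splitting n U V) u v (D : 'M[Cx]_n) :
  T sp u v *m (T sp u v *m D *m T sp u v) *m T sp u v = D.
Proof. by rewrite !mulmxA TT mul1mx -mulmxA TT mulmx1. Qed.

(** Conjugation by the transposition changes only the entries in the slices
    u and v. *)
Lemma slice_swap_offslice n U V (sp : splitting n U V) u v (D : 'M[Cx]_n) : is_diag_mx D ->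
  (T sp u v *m D *m T sp u v - D) *m (1%:M - Q sp v)
  = (T sp u v *m D *m T sp u v - D) *m (1%:M - Q sp v) *m Q sp u.
Proof.
move=> dD; have dT := T_diag sp u v dD.
apply/matrixP => a b; rewrite mulQE mulmxBr mulmx1 !mxE.
have -> : \sum_j (T sp u v *m D *m T sp u v - D) a j * Q sp v j b =
    ((T sp u v *m D *m T sp u v - D) *m Q sp v) a b by rewrite mxE.
rewrite mulQE !mxE -/(T sp u v *m D *m T sp u v).
have -> : \sum_j (T sp u v *m D) a j * T sp u v j b = (T sp u v *m D *m T sp u v) a b.
  by rewrite mxE.
case: (eqVneq (spi sp b) u) => // bu; case: (eqVneq (spi sp b) v) => bv.
  by rewrite subrr.
rewrite subr0 mulTE TmulE.
have [ab|ab] := eqVneq a b; last first.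
  by rewrite !(diag0 dD)// ?subrr//; apply: contra ab => /eqP/perm_inj ->.
suff e : lift_left sp (tperm u v) b = b by rewrite ab e subrr.
by apply: (split_inj (sp := sp)); rewrite ?pi_lift_left ?rho_lift_left// tpermD// eq_sym.
Qed.

(** Induction on the word from its right end (L, x), with B absorbing what has been
    treated.  Split T L T = L + (T L T - L).  The term with L is of the same form for
    the shorter word, with L x B for B.  Next to Q_v the difference T L T - L sees x B
    only through its block diagonal part for the slice v, which is the diagonal matrix
    d = Delta (x B), and its (u, v) block.  The part with d commutes with the other
    diagonal matrices, and gives two sums in normal form from the shorter word with
    B = 1.  The (u, v) blocks of x B have total squared norm hs (x B) <= n when u and
    v vary, and form the new error. *)
Lemma decouple l : exists (C : R) (r : nat), 0 <= C /\
  forall n U V (sp : splitting n U V) (w : seq ('M[Cx]_n * 'M[Cx]_n)) (B : 'M[Cx]_n),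
  size w = l -> (forall p, p \in w -> good_factor sp p) -> contr B -> blk sp B ->
  exists s, [/\ (size s <= r)%N, forall p, p \in s -> good_pair sp p &
    \sum_u \sum_v hs (twisted_mono sp u v w *m B *m Q sp v *m T sp u v - transfer_sum sp s u v)
      <= C * n%:R].
Proof.
elim: l => [|l [C [r [C0 IH]]]].
  exists 0, 1%N; split; first exact: lexx.
  move=> n U V sp w B /size0nil -> _ cB bB.
  exists [:: (B, 1%:M)]; split; first exact: leqnn.
    move=> p; rewrite inE => /eqP ->; split; rewrite /=; [exact: cB|exact: bB|exact: contr1|].
    exact: scalar_mx_is_diag.
  rewrite mul0r big1// => u _; rewrite big1// => v _.
  by rewrite /transfer_sum big_seq1 /= mul1mx mulmx1 /transfer mulmxA subrr hs0.
exists (2 * C + 16 * C + 64), (r + (r + r))%N; split; first by lra.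
move=> n U V sp w B.
case/lastP: w => [|w [L x]]; rewrite ?size_rcons// => -[sw] good cB bB.
have [/= dL cL cx bx] : good_factor sp (L, x).
  by apply: good; rewrite mem_rcons mem_head.
have goodw p : p \in w -> good_factor sp p.
  by move=> pw; apply: good; rewrite mem_rcons in_cons pw orbT.
have cxB : contr (x *m B) := contrM cx cB.
have bxB : blk sp (x *m B) := blkM bx bB.
have [|s1 [z1 g1 e1]] := IH n U V sp w (L *m (x *m B)) sw goodw (contrM cL cxB).
  exact (blkM (blk_diag dL) bxB).
have [s2 [z2 g2 e2]] := IH n U V sp w 1%:M sw goodw (@contr1 R n) (@blk1 R n U V sp).
set d := Delta (x *m B).
have dd : is_diag_mx d by exact: is_diag_Delta.
have cd : contr d by apply: contr_Delta.
exists (s1 ++ ([seq (q.1 *m d, q.2 *m L) | q <- s2] ++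
               [seq (- (q.1 *m d *m L), q.2) | q <- s2])); split.
- by rewrite !size_cat !size_map !leq_add.
- move=> p; rewrite !mem_cat => /or3P[/g1| |]; first exact.
    move=> /mapP[q /g2[h1 h2 h3 h4] ->]; split; rewrite /=.
    + exact: contrM.
    + exact (blkM h2 (blk_diag dd)).
    + exact: contrM.
    + exact: diagM.
  move=> /mapP[q /g2[h1 h2 h3 h4] ->]; split; rewrite /=.
  + exact (contrN (contrM (contrM h1 cd) cL)).
  + exact (blkN (blkM (blkM h2 (blk_diag dd)) (blk_diag dL))).
  + exact: h3.
  + exact: h4.
(* X1 and X2 are the errors for L x B and for 1, supplied by the induction; X3 is
   the new one, from the (u, v) block of x B. *)
pose X1 u v := twisted_mono sp u v w *m (L *m (x *m B)) *m Q sp v *m T sp u v - transfer_sum sp s1 u v.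
pose X2 u v := twisted_mono sp u v w *m 1%:M *m Q sp v *m T sp u v - transfer_sum sp s2 u v.
pose tT u v D := T sp u v *m D *m T sp u v.
pose X3 u v := twisted_mono sp u v w *m ((tT u v L - L) *m (1%:M - Q sp v) *m (Q sp u *m (x *m B) *m Q sp v)) *m T sp u v.
have key u v : twisted_mono sp u v (rcons w (L, x)) *m B *m Q sp v *m T sp u v -
   transfer_sum sp (s1 ++ ([seq (q.1 *m d, q.2 *m L) | q <- s2] ++
               [seq (- (q.1 *m d *m L), q.2) | q <- s2])) u v =
   X1 u v + (X2 u v *m (L - tT u v L) *m tT u v d + X3 u v).
  have m2 : transfer_sum sp s2 u v *m (L - tT u v L) *m tT u v d =
     transfer_sum sp [seq (q.1 *m d, q.2 *m L) | q <- s2] u v +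
     transfer_sum sp [seq (- (q.1 *m d *m L), q.2) | q <- s2] u v.
    rewrite /transfer_sum !big_map -big_split /= !mulmx_suml big_seq [RHS]big_seq.
    apply: eq_bigr => q /g2[h1 h2 h3 h4].
    have dtd := T_diag sp u v dd; have dtL := T_diag sp u v dL.
    have E1 : q.1 *m Tr sp v u *m q.2 *m L *m tT u v d = q.1 *m d *m Tr sp v u *m (q.2 *m L).
      rewrite -(mulmxA _ q.2) -(mulmxA _ (q.2 *m L)) (diagC (diagM h4 dL) dtd).
      by rewrite (mulmxA _ (tT u v d)) -(mulmxA q.1) (transfer_TDT sp u v dd) (mulmxA q.1).
    have E2 : q.1 *m Tr sp v u *m q.2 *m tT u v L *m tT u v d = q.1 *m d *m L *m Tr sp v u *m q.2.
      rewrite -(mulmxA _ q.2) (diagC h4 dtL) (mulmxA _ (tT u v L)) -(mulmxA _ q.2) (diagC h4 dtd).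
      rewrite (mulmxA _ (tT u v d)) -(mulmxA q.1) (transfer_TDT sp u v dL) (mulmxA q.1) -(mulmxA (q.1 *m L)) (transfer_TDT sp u v dd).
      by rewrite (mulmxA (q.1 *m L)) -(mulmxA q.1) (diagC dL dd) (mulmxA q.1).
    by rewrite mulmxBr mulmxBl E1 E2 mulNmx mulNmx.
  have x3 : X3 u v = twisted_mono sp u v w *m (tT u v L - L) *m (x *m B) *m Q sp v *m T sp u v -
      twisted_mono sp u v w *m (tT u v L - L) *m d *m Q sp v *m T sp u v.
    have a1 : (tT u v L - L) *m (1%:M - Q sp v) *m (Q sp u *m (x *m B) *m Q sp v) =
       (tT u v L - L) *m (x *m B) *m Q sp v - (tT u v L - L) *m d *m Q sp v.
      rewrite -(mulmxA (Q sp u)) mulmxA -(slice_swap_offslice sp u v dL) mulmxBr mulmx1 mulmxBl -/(tT u v L).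
      rewrite (mulmxA _ (x *m B)); congr (_ - _).
      by rewrite -(mulmxA _ (Q sp v)) (mulmxA (Q sp v)) (QAQ v bxB) !mulmxA.
    rewrite /X3 a1 mulmxBr mulmxBl; congr (_ - _).
      by rewrite !mulmxA.
    by rewrite !mulmxA.
  have x2 : twisted_mono sp u v w *m Q sp v *m T sp u v *m (L - tT u v L) *m tT u v d =
     twisted_mono sp u v w *m (tT u v L - L) *m d *m Q sp v *m T sp u v.
    have -> : tT u v d = T sp u v *m d *m T sp u v by [].
    have -> : L - tT u v L = T sp u v *m (tT u v L - L) *m T sp u v.
      by rewrite mulmxBr mulmxBl TDTT.
    rewrite !mulmxA -(mulmxA _ (T sp u v) (T sp u v)) TT mulmx1.
    rewrite -(mulmxA _ (T sp u v) (T sp u v)) TT mulmx1.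
    congr (_ *m _); rewrite -!mulmxA; congr (_ *m _); rewrite !mulmxA.
    have dl : is_diag_mx (tT u v L - L) by apply: diagB => //; apply: T_diag.
    by rewrite (diagC (Q_diag _ sp v) dl) -mulmxA (diagC (Q_diag R sp v) dd) mulmxA.
  have mE : transfer_sum sp (s1 ++ ([seq (q.1 *m d, q.2 *m L) | q <- s2] ++
               [seq (- (q.1 *m d *m L), q.2) | q <- s2])) u v =
      transfer_sum sp s1 u v + transfer_sum sp s2 u v *m (L - tT u v L) *m tT u v d.
    by rewrite m2 /transfer_sum !big_cat.
  have N1 : twisted_mono sp u v (rcons w (L, x)) *m B *m Q sp v *m T sp u v =
      twisted_mono sp u v w *m L *m (x *m B) *m Q sp v *m T sp u v +
      twisted_mono sp u v w *m (tT u v L - L) *m (x *m B) *m Q sp v *m T sp u v.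
    rewrite -!mulmxDl -mulmxDr addrC subrK twisted_mono_rcons.
    by rewrite !mulmxA.
  rewrite mE N1 x3 -x2 /X1 /X2 mulmx1 !mulmxBl (mulmxA _ L).
  move: (twisted_mono sp u v w *m L *m (x *m B) *m Q sp v *m T sp u v) (transfer_sum sp s1 u v).
  move: (twisted_mono sp u v w *m (tT u v L - L) *m (x *m B) *m Q sp v *m T sp u v).
  move: (_ *m (L - tT u v L) *m tT u v d) (transfer_sum _ _ _ _ *m _ *m _) => z m2' a b m1.
  by apply/matrixP => i j; rewrite !mxE; ring.
have b2 u v : hs (X2 u v *m (L - tT u v L) *m tT u v d) <= 4 * hs (X2 u v).
  apply: le_trans (hs_contr_r _ (contr_TDT sp u v cd)) _.
  exact: hs_diffr _ cL (contr_TDT sp u v cL).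
have b3 u v : hs (X3 u v) <= 16 * hs (Q sp u *m (x *m B) *m Q sp v).
  apply: le_trans (hs_contr_r _ (contr_T sp u v)) _.
  apply: le_trans (hs_contr _ (contr_twisted_mono _ _ goodw)) _.
  move: (Q sp u *m _ *m _) => M.
  rewrite -mulmxA; apply: le_trans (hs_diffl _ (contr_TDT sp u v cL) cL) _.
  apply: le_trans (ler_wpM2l _ (hs_diffl M (@contr1 R n) (contr_Q sp v))) _; first by [].
  by rewrite mulrA -natrM.
have hxB := hs_contr_le cxB; rewrite -(hs_sumQQ sp) in hxB.
(* ||a + b||^2 <= 2 ||a||^2 + 2 ||b||^2, used twice, with b2 and b3. *)
apply: le_trans (_ : \sum_u \sum_v (2 * hs (X1 u v) + 16 * hs (X2 u v) +
   64 * hs (Q sp u *m (x *m B) *m Q sp v)) <= _).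
  apply: ler_sum => u _; apply: ler_sum => v _; rewrite key.
  apply: le_trans (hs_add2 _ _) _.
  have := hs_add2 (X2 u v *m (L - tT u v L) *m tT u v d) (X3 u v).
  have := b2 u v; have := b3 u v.
  move: (hs _) (hs _) (hs _) (hs _) (hs _) (hs _) => a1 a2 a3 a4 a5 a6; lra.
rewrite (eq_bigr (fun u => 2 * (\sum_v hs (X1 u v)) + 16 * (\sum_v hs (X2 u v)) + 64 * \sum_v hs (Q sp u *m (x *m B) *m Q sp v))); last first.
  by move=> u _; rewrite !big_split /= -!mulr_sumr.
rewrite !big_split /= -!mulr_sumr.
lra.
Qed.
End Decoupling.

(** * Centring a decoupled word *)

Section Centring.
Variable R : realType.
Local Notation Cx := R[i]%C.
Local Notation Q := (@slice R _ _ _).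
Local Notation T := (@slice_swap R _ _ _).
Local Notation Tr := (@transfer R _ _ _).

(** The factor 1/2 keeps centred contractions contractive. *)
Definition half_center n (M : 'M[Cx]_n) : 'M[Cx]_n := ((2^-1)%:C)%C *: (M - Delta M).

Lemma contr_half_center n (M : 'M[Cx]_n) : contr M -> contr (half_center M).
Proof. by move=> cM; apply: contr_half => //; apply: contr_Delta. Qed.

Lemma blk_half_center n U V (sp : splitting n U V) (M : 'M[Cx]_n) : blk sp M -> blk sp (half_center M).
Proof. by move=> bM; apply/blkZ/blkB => //; apply: blk_Delta. Qed.

Lemma sum_sqr_le (I : finType) (x : I -> R) :
  (\sum_i x i) ^+ 2 <= #|I|%:R * \sum_i x i ^+ 2.
Proof.
set c : R := _%:R; set S := \sum_i x i.
have [c0|c0] := eqVneq c 0.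
  have e : #|I| = 0%N by apply/eqP; rewrite -(@pnatr_eq0 R) -/c c0.
  have e' (i : I) : False by have : (0 < #|I|)%N by [apply/card_gt0P; exists i]; rewrite e.
  by rewrite /S !big1 ?expr0n ?mulr0// => i; case: (e' i).
have p : 0 < c by rewrite lt_def c0 ler0n.
have : 0 <= \sum_i (c * x i - S) ^+ 2 by apply: sumr_ge0 => i _; apply: sqr_ge0.
have -> : \sum_i (c * x i - S) ^+ 2 = c * (c * \sum_i x i ^+ 2 - S ^+ 2).
  rewrite (eq_bigr (fun i => c ^+ 2 * x i ^+ 2 + - (2 * c * S) * x i + S ^+ 2)); last by move=> i _; ring.
  rewrite !big_split /= sumr_const -!mulr_sumr -/S -mulr_natl -/c; ring.
by rewrite pmulr_rge0// subr_ge0.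
Qed.

(** Cauchy--Schwarz, to pass from a total squared error to a total error. *)
Lemma fro_sum_le (I : finType) n (X : I -> I -> 'M[Cx]_n) (c : R) : 0 <= c ->
  \sum_i \sum_j hs (X i j) <= c ->
  \sum_i \sum_j fro (X i j) <= #|I|%:R * Num.sqrt c.
Proof.
move=> c0 h; rewrite -[leLHS]ger0_norm; last first.
  by apply: sumr_ge0 => i _; apply: sumr_ge0 => j _.
rewrite -(ger0_norm (ler0n R #|I|)) -!sqrtr_sqr -sqrtrM ?sqr_ge0// ler_wsqrtr// pair_bigA /=.
apply: le_trans (sum_sqr_le _) _.
rewrite card_prod natrM expr2 ler_wpM2l ?mulr_ge0//.
apply: le_trans h; rewrite pair_bigA /=.
by apply: ler_sum => p _; rewrite fro_sqr.
Qed.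

(** T - 1 is supported in the slices u and v. *)
Lemma slice_swap_sub1 n U V (sp : splitting n U V) u v :
  (T sp u v - 1%:M) *m (Q sp u + Q sp v) = T sp u v - 1%:M :> 'M[Cx]_n.
Proof.
have [->|uv] := eqVneq u v.
  by rewrite /slice_swap tperm1 lift_left1 perm_mx1 subrr mul0mx.
apply/matrixP => a b; rewrite mulmxDr mxE !mulQE.
have [bu|bu] := eqVneq (spi sp b) u; first by rewrite bu (negPf uv) addr0.
have [bv|bv] := eqVneq (spi sp b) v; first by rewrite add0r.
rewrite addr0 mxE [in X in _ + X]mxE TE [1%:M _ _]mxE.
have sb : lift_left sp (tperm u v) b = b.
  by apply: (split_inj (sp := sp)); rewrite ?pi_lift_left ?rho_lift_left// tpermD// eq_sym.
have -> : (lift_left sp (tperm u v) a == b) = (a == b).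
  apply/eqP/eqP => [e|->]; last exact: sb.
  by apply: (@perm_inj _ (lift_left sp (tperm u v))); rewrite e sb.
by rewrite subrr.
Qed.

(** D commutes with Q_u and E Q_u = E. *)
Lemma transfer_sum_slice n U V (sp : splitting n U V) s u v :
  (forall p, p \in s -> good_pair sp p) -> transfer_sum sp s u v *m Q sp u = transfer_sum sp s u v :> 'M[Cx]_n.
Proof.
move=> g; rewrite /transfer_sum mulmx_suml big_seq [RHS]big_seq; apply: eq_bigr => p /g[_ _ _ dp].
by rewrite -mulmxA (diagC dp (Q_diag _ sp u)) mulmxA -(mulmxA p.1) transferQ.
Qed.

(** Within a slice the diagonal part is the compression ([QAQ]), so centring
    Y Q_u removes Q_u Y Q_u.  Write the leftmost T as 1 + (T - 1).  The term with 1
    replaces A by A - Delta A in the normal form of [decouple], so the coefficients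
    remain independent of (u, v).  The term with T - 1 becomes (T - 1) Q_u A E D, whose
    squared norms sum to O(n) because only the (u, v) blocks of A occur. *)
Lemma half_center_decouple l : exists (C : R) (r : nat), 0 <= C /\
  forall n U V (sp : splitting n U V) (w : seq ('M[Cx]_n * 'M[Cx]_n)),
  size w = l -> (forall p, p \in w -> good_factor sp p) ->
  exists s, [/\ (size s <= r)%N, forall p, p \in s -> good_pair sp p &
    \sum_u \sum_v hs (half_center (T sp u v *m twisted_mono sp u v w *m T sp u v) *m Q sp u - transfer_sum sp s u v)
      <= C * n%:R].
Proof.
have [C [r [C0 H]]] := decouple R l.
exists (6 * C + 4 * r%:R ^+ 2), r; split.
  by rewrite addr_ge0 ?mulr_ge0 ?exprn_ge0.
move=> n U V sp w sw good.
have [s0 [z0 g0 e0]] := H n U V sp w 1%:M sw good (@contr1 R n) (@blk1 R n U V sp).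
exists [seq (half_center q.1, q.2) | q <- s0]; split.
- by rewrite size_map.
- move=> p /mapP[q /g0[h1 h2 h3 h4] ->]; split; rewrite /=.
  + exact: contr_half_center.
  + exact: blk_half_center.
  + exact: h3.
  + exact: h4.
pose err u v := twisted_mono sp u v w *m 1%:M *m Q sp v *m T sp u v - transfer_sum sp s0 u v.
have e0' : \sum_u \sum_v hs (err u v) <= C * n%:R by exact: e0.
pose h : Cx := ((2^-1)%:C)%C.
have mE u v : transfer_sum sp [seq (half_center q.1, q.2) | q <- s0] u v =
    h *: ((1%:M - Q sp v) *m transfer_sum sp s0 u v).
  rewrite /transfer_sum big_map mulmx_sumr scaler_sumr big_seq [RHS]big_seq.
  apply: eq_bigr => q /g0[h1 h2 h3 h4] /=.
  rewrite /half_center -!scalemxAl; congr (_ *: _).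
  rewrite !mulmxBl mul1mx; congr (_ - _).
  rewrite (mulmxA (Q sp v)); congr (_ *m _).
  rewrite -{2}(Qtransfer R sp v u) (mulmxA q.1) (mulmxA (Q sp v)) (mulmxA (Q sp v)) (QAQ v h2).
  by rewrite -mulmxA Qtransfer.
have lE u v : half_center (T sp u v *m twisted_mono sp u v w *m T sp u v) *m Q sp u =
    h *: ((1%:M - Q sp v) *m (transfer_sum sp s0 u v + err u v) +
          (T sp u v - 1%:M) *m (Q sp u *m (transfer_sum sp s0 u v + err u v))).
  have -> : transfer_sum sp s0 u v + err u v = twisted_mono sp u v w *m Q sp v *m T sp u v.
    by rewrite /err mulmx1 addrC subrK.
  rewrite /half_center -scalemxAl; congr (_ *: _).
  have bN := blk_twisted_mono u v good.
  rewrite mulmxBl -(QAQ u (T_blk u v bN)).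
  have -> : T sp u v *m twisted_mono sp u v w *m T sp u v *m Q sp u =
      T sp u v *m (twisted_mono sp u v w *m Q sp v *m T sp u v).
    by rewrite -!mulmxA QT.
  have -> : Q sp u *m (T sp u v *m twisted_mono sp u v w *m T sp u v) *m Q sp u =
      T sp u v *m Q sp v *m (twisted_mono sp u v w *m Q sp v *m T sp u v).
    rewrite -(mulmxA (Q sp u)) -!(mulmxA (T sp u v)) -(mulmxA (twisted_mono _ _ _ _) (T _ _ _)) -QT.
    have tq : Q sp u *m T sp u v = T sp u v *m Q sp v.
      by rewrite /slice_swap tpermC; apply: (QT R sp v u).
    by rewrite (mulmxA (Q sp u)) tq !mulmxA.
  move: (_ *m T sp u v) => X.
  rewrite -(mulmxA (T sp u v)) (_ : T sp u v *m X = (T sp u v - 1%:M) *m X + X); last first.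
    by rewrite mulmxBl mul1mx subrK.
  rewrite -[in X in X *m _ + _](slice_swap_sub1 sp u v) (mulmxBl _ _ X) mul1mx.
  rewrite -(mulmxA (_ - _)) (mulmxDl (Q sp u)) (mulmxDr (_ - _)) !(mulmxBl _ _ (Q sp v *m X)) !mul1mx.
  move: (T sp u v *m (Q sp v *m X)) (Q sp v *m X) ((_ - _) *m _) => a b c.
  by apply/matrixP => i j; rewrite !mxE; ring.
have hE u v : hs (half_center (T sp u v *m twisted_mono sp u v w *m T sp u v) *m Q sp u -
    transfer_sum sp [seq (half_center q.1, q.2) | q <- s0] u v) <=
    6 * hs (err u v) + 4 * hs (Q sp u *m transfer_sum sp s0 u v).
  rewrite lE mE -scalerBr [(1%:M - _) *m (_ + _)]mulmxDr.
  have -> (a b c : 'M[Cx]_n) : a + b + c - a = b + c.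
    by rewrite addrC !addrA addNr add0r.
  rewrite hsZ normc_real ger0_norm ?invr_ge0//.
  have a1 := hs_add2 ((1%:M - Q sp v) *m err u v) ((T sp u v - 1%:M) *m (Q sp u *m (transfer_sum sp s0 u v + err u v))).
  have a2 := hs_diffl (err u v) (@contr1 R n) (contr_Q sp v).
  have a3 := hs_diffl (Q sp u *m (transfer_sum sp s0 u v + err u v)) (contr_T sp u v) (@contr1 R n).
  have a4 := hs_add2 (Q sp u *m transfer_sum sp s0 u v) (Q sp u *m err u v).
  have a5 := hs_contr (err u v) (contr_Q sp u).
  rewrite -mulmxDr in a4.
  move: (hs _) (hs _) (hs _) (hs _) (hs _) (hs _) (hs _) a1 a2 a3 a4 a5 => b1 b2 b3 b4 b5 b6 b7.
  lra.
have qb : \sum_u \sum_v hs (Q sp u *m transfer_sum sp s0 u v) <= r%:R ^+ 2 * n%:R.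
  apply: le_trans (_ : \sum_u \sum_v r%:R * \sum_(p <- s0) hs (Q sp u *m p.1 *m Q sp v) <= _).
    apply: ler_sum => u _; apply: ler_sum => v _.
    rewrite /transfer_sum mulmx_sumr; apply: le_trans (hs_sum _ _) _.
    apply: ler_pM; rewrite ?ler_nat//; first exact: sumr_ge0.
    rewrite big_seq [leRHS]big_seq; apply: ler_sum => p /g0[_ _ cp _].
    rewrite (mulmxA (Q sp u)); apply: le_trans (hs_contr_r _ cp) _.
    rewrite (mulmxA (Q sp u)) /transfer (mulmxA (Q sp u *m p.1)).
    exact: hs_contr_r _ (contr_T sp u v).
  rewrite (eq_bigr (fun u => r%:R * \sum_(p <- s0) \sum_v hs (Q sp u *m p.1 *m Q sp v))); last first.
    by move=> u _; rewrite -mulr_sumr exchange_big.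
  rewrite -mulr_sumr exchange_big /= expr2 -mulrA ler_wpM2l//.
  apply: le_trans (_ : \sum_(p <- s0) n%:R <= _).
    rewrite big_seq [leRHS]big_seq; apply: ler_sum => p /g0[c1 _ _ _].
    by rewrite hs_sumQQ; apply: hs_contr_le.
  by rewrite big_const_seq count_predT iter_addr_0 -[leLHS]mulr_natl ler_wpM2r// ler_nat.
apply: le_trans (_ : \sum_u \sum_v (6 * hs (err u v) + 4 * hs (Q sp u *m transfer_sum sp s0 u v)) <= _).
  by apply: ler_sum => u _; apply: ler_sum => v _; apply: hE.
rewrite (eq_bigr (fun u => 6 * (\sum_v hs (err u v)) + 4 * \sum_v hs (Q sp u *m transfer_sum sp s0 u v))); last first.
  by move=> u _; rewrite big_split /= -!mulr_sumr.
rewrite big_split /= -!mulr_sumr.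
move: (\sum_u _) (\sum_u _) e0' qb => a b; lra.
Qed.
End Centring.

(** * Trace pairings summed over transpositions *)

Section Transfers.
Variable R : realType.
Local Notation Cx := R[i]%C.
Local Notation Q := (@slice R _ _ _).
Local Notation T := (@slice_swap R _ _ _).
Local Notation Tr := (@transfer R _ _ _).

Lemma sum_split n U V (sp : splitting n U V) (F : 'I_n -> R) :
  \sum_a F a = \sum_r \sum_u F (smk sp u r).
Proof.
rewrite exchange_big pair_bigA /=.
rewrite (reindex (fun p => smk sp p.1 p.2))//=.
exists (fun a => (spi sp a, srho sp a)) => [[u r] _|a _] /=.
  by rewrite spimk srhomk.
by rewrite smkK.
Qed.

Lemma contr_row n (A : 'M[Cx]_n) a : contr A -> \sum_b Normc.normc (A a b) ^+ 2 <= 1.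
Proof.
move=> cA.
have e1 : hs (delta_mx 0 a : 'rV[Cx]_n) = 1.
  rewrite hsE big_ord1 (bigD1 a)//= big1 ?addr0.
    by rewrite mxE !eqxx Normc.normc1 expr1n.
  by move=> k kj; rewrite mxE (negPf kj) andbF Normc.normc0 expr0n.
have := hs_contr_r (delta_mx 0 a : 'rV[Cx]_n) cA; rewrite e1 -rowE hsE big_ord1.
by apply: le_trans; apply: ler_sum => b _; rewrite mxE.
Qed.

Lemma transfer_entry n U V (sp : splitting n U V) (A B : 'M[Cx]_n) u v x y : blk sp A ->
  (A *m Tr sp v u *m B) x y = A x (smk sp v (srho sp x)) * B (smk sp u (srho sp x)) y.
Proof.
move=> bA.
have h b : (A *m Tr sp v u) x b =
    A x (smk sp v (srho sp x)) * ((spi sp b == u) && (srho sp x == srho sp b))%:R.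
  rewrite mxE (bigD1 (smk sp v (srho sp x)))//= big1 ?addr0.
    by rewrite transferE spimk srhomk eqxx.
  move=> a ax; rewrite transferE; have [av|] := eqVneq (spi sp a) v; last by rewrite mulr0.
  have [ar|ar] := eqVneq (srho sp x) (srho sp a); last by rewrite bA// mul0r.
  by rewrite ar -av smkK eqxx in ax.
rewrite mxE (bigD1 (smk sp u (srho sp x)))//= big1 ?addr0.
  by rewrite h spimk srhomk !eqxx mulr1.
move=> b bx; rewrite h; case: eqP => [bu|_]; last by rewrite mulr0 mul0r.
case: eqP => [br|_]; last by rewrite mulr0 mul0r.
by rewrite br -bu smkK eqxx in bx.
Qed.

(** The (x, y) entry of A E B is A x (v, rho x) * B (u, rho x) y.  Summing over v
    uses up a row of A, of norm at most 1.  The pinching leaves for each y at most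
    #|U| / N values of the U-coordinate of x, whence the gain of the factor N. *)
Lemma hs_pin_transfer n U V (sp : splitting n U V) (L : finType) (fU : U -> L) (N : nat)
  (A B : 'M[Cx]_n) : blk sp A -> contr A -> contr B ->
  (forall t, (#|[pred u | fU u == t]| * N <= #|U|)%N) ->
  N%:R * (\sum_u \sum_v hs (pin (fun a => fU (spi sp a)) (A *m Tr sp v u *m B)))
    <= (n * #|U|)%:R.
Proof.
move=> bA cA cB hf.
pose nB (a b : 'I_n) : R := Normc.normc (B a b) ^+ 2.
have nB0 a b : 0 <= nB a b by rewrite sqr_ge0.
apply: le_trans (_ : N%:R * (\sum_u \sum_x \sum_y
   (if fU (spi sp x) == fU (spi sp y) then nB (smk sp u (srho sp x)) y else 0)) <= _).
  rewrite ler_wpM2l//; apply: ler_sum => u _.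
  rewrite (eq_bigr (fun v => \sum_x \sum_y if fU (spi sp x) == fU (spi sp y) then
     Normc.normc (A x (smk sp v (srho sp x))) ^+ 2 * nB (smk sp u (srho sp x)) y else 0)); last first.
    move=> v _; rewrite hsE; apply: eq_bigr => x _; apply: eq_bigr => y _.
    rewrite mxE; case: ifP => _; last by rewrite Normc.normc0 expr0n.
    by rewrite transfer_entry// Normc.normcM exprMn.
  rewrite exchange_big /=; apply: ler_sum => x _.
  rewrite exchange_big /=; apply: ler_sum => y _.
  case: ifP => _; last by rewrite big1.
  rewrite -mulr_suml ler_piMl//.
  apply: le_trans (contr_row x cA).
  rewrite (sum_split sp) (bigD1 (srho sp x))//= lerDl.
  by apply: sumr_ge0 => r _; apply: sumr_ge0 => v _; rewrite sqr_ge0.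
apply: le_trans (_ : \sum_u \sum_r \sum_y (#|U|%:R * nB (smk sp u r) y) <= _); last first.
  have -> : \sum_u \sum_r \sum_y #|U|%:R * nB (smk sp u r) y = #|U|%:R * hs B.
    rewrite hsE (sum_split sp) mulr_sumr exchange_big /=; apply: eq_bigr => r _.
    by rewrite mulr_sumr; apply: eq_bigr => u _; rewrite mulr_sumr.
  by rewrite natrM mulrC ler_wpM2r// hs_contr_le.
rewrite mulr_sumr; apply: ler_sum => u _.
rewrite (sum_split sp) mulr_sumr; apply: ler_sum => r _.
rewrite exchange_big mulr_sumr /=; apply: ler_sum => y _.
under eq_bigr do rewrite spimk srhomk.
rewrite -big_mkcond /= sumr_const -[X in _ * X]mulr_natl [leLHS]mulrA ler_wpM2r// -natrM ler_nat mulnC.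
by apply: leq_trans (hf (fU (spi sp y))); rewrite leq_mul2r; apply/orP; right.
Qed.

(** The sum is J (x) I with J the all-ones matrix on U. *)
Lemma hs_sum_transfer n U V (sp : splitting n U V) :
  hs (\sum_u \sum_v Tr sp v u) <= (n * #|U|)%:R :> R.
Proof.
set J := \sum_u _.
have JE a b : J a b = (srho sp a == srho sp b)%:R.
  rewrite /J summxE (bigD1 (spi sp b))//= [X in _ + X]big1 ?addr0; last first.
    move=> u ub; rewrite summxE big1// => v _; rewrite transferE.
    by rewrite [spi sp b == _]eq_sym (negPf ub) andbF.
  rewrite summxE (bigD1 (spi sp a))//= big1 ?addr0 ?transferE ?eqxx//.
  by move=> v va; rewrite transferE eq_sym (negPf va).
have QJQ u v : Q sp v *m J *m Q sp u = Tr sp v u.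
  apply/matrixP => a b; rewrite mulQE QmulE transferE JE.
  by case: eqP => ?; case: eqP => ?.
rewrite -(hs_sumQQ sp).
apply: le_trans (_ : \sum_(v : U) \sum_(u : U) #|V|%:R <= _).
  apply: ler_sum => v _; apply: ler_sum => u _; rewrite QJQ -(hs_Q R sp v).
  by rewrite /transfer; apply: hs_contr_r; apply: contr_T.
rewrite !sumr_const -!mulrnA ler_nat [X in (_ <= X * _)%N](card_split sp).
by move: #|U| #|V| => a b; apply: eq_leq; ring.
Qed.

End Transfers.

Section TraceEstimate.
Variable R : realType.
Local Notation Cx := R[i]%C.
Local Notation Q := (@slice R _ _ _).
Local Notation T := (@slice_swap R _ _ _).
Local Notation Tr := (@transfer R _ _ _).

Lemma fro_contr_le n (A : 'M[Cx]_n) : contr A -> fro A <= Num.sqrt n%:R.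
Proof. by move=> cA; apply: ler_wsqrtr; apply: hs_contr_le. Qed.

(** In the pairing of G' with Y Q_u W' one wants to freeze W' and G' at W and G:
    e bounds the cost for W', and k0 measures the cost for G', which lies in the range
    of the pinching.  The frozen pairing t is of the trivial order #|U| * n in absolute
    values but smaller by N^(-1/2) in total, so that t can be multiplied by weights that
    are nearly constant in (u, v). *)
Definition trace_bound l (K : R) := forall n U V (sp : splitting n U V)
    (L : finType) (fU : U -> L) (N : nat)
    (w : seq ('M[Cx]_n * 'M[Cx]_n)) (W G : 'M[Cx]_n) (W' G' : U -> U -> 'M[Cx]_n)
    (k0 : R) (e : U -> U -> R),
  let f a := fU (spi sp a) in
  (0 < N)%N -> (N <= #|U|)%N -> (forall t, (#|[pred u | fU u == t]| * N <= #|U|)%N) ->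
  size w = l -> (forall p, p \in w -> good_factor sp p) ->
  contr W -> contr G -> (forall u v, contr (W' u v)) -> (forall u v, contr (G' u v)) ->
  pin f G = G -> (forall u v, pin f (G' u v) = G' u v) ->
  0 <= k0 -> (forall u v, fro (G' u v - G) <= k0 * Num.sqrt #|V|%:R) ->
  (forall u v H, contr H -> `|ip H (Q sp u *m (W' u v - W))| <= e u v) ->
  exists t : U -> U -> R,
  [/\ \sum_u \sum_v `|ip (G' u v) (half_center (T sp u v *m twisted_mono sp u v w *m T sp u v) *m Q sp u *m W' u v) - t u v|
        <= K * (1 + k0) * (#|U|%:R * n%:R) / Num.sqrt N%:R + \sum_u \sum_v e u v,
      `|\sum_u \sum_v t u v| <= K * (#|U|%:R * n%:R) / Num.sqrt N%:R &
      \sum_u \sum_v `|t u v| <= K * (#|U|%:R * n%:R)].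

(** Take for t the pairing of G with the normal form of Y Q_u times W.  The decoupling error
    has total norm O(#|U| sqrt n), and is paired with Q_u, of norm #|V|^(1/2).
    Replacing G' by G is paid through [hs_pin_transfer], as G' - G is in the range of
    the pinching, and the sum of t is bounded by [hs_sum_transfer]. *)
Lemma trace_estimate l : exists K : R, 0 <= K /\ trace_bound l K.
Proof.
have [C [r [C0 H]]] := half_center_decouple R l.
exists (Num.sqrt C + r%:R); split; first by rewrite addr_ge0.
move=> n U V sp L fU N w W G W' G' k0 e f N0 NU hf sw good cW cG cW' cG' pG pG' k00 hG he.
have [s [zs gs es]] := H n U V sp w sw good.
exists (fun u v => ip G (transfer_sum sp s u v *m W)).
pose Y u v := half_center (T sp u v *m twisted_mono sp u v w *m T sp u v).
pose err u v := Y u v *m Q sp u - transfer_sum sp s u v.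
pose x : R := Num.sqrt #|U|%:R; pose y : R := Num.sqrt #|V|%:R.
pose rho : R := (Num.sqrt N%:R)^-1.
have x0 : 0 <= x by exact: sqrtr_ge0.
have y0 : 0 <= y by exact: sqrtr_ge0.
have xx : #|U|%:R = x ^+ 2 by rewrite sqr_sqrtr.
have yy : #|V|%:R = y ^+ 2 by rewrite sqr_sqrtr.
have nE : n%:R = x ^+ 2 * y ^+ 2 by rewrite -xx -yy -natrM -(card_split sp).
have sn : Num.sqrt n%:R = x * y :> R.
  by rewrite nE -exprMn sqrtr_sqr ger0_norm ?mulr_ge0.
have N0' : 0 < N%:R :> R by rewrite ltr0n.
have rho0 : 0 < rho by rewrite invr_gt0 sqrtr_gt0.
have rN : rho ^+ 2 * N%:R = 1.
  by rewrite exprVn sqr_sqrtr ?ltW// mulVf// gt_eqF.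
have xrho : x <= x ^+ 2 * rho.
  have [x00|x00] := eqVneq x 0; first by rewrite x00 expr0n mul0r.
  rewrite expr2 -mulrA ler_peMr//.
  rewrite -(@expr_ge1 R 2) ?mulr_ge0 ?(ltW rho0)// exprMn -xx -[leLHS]rN [leRHS]mulrC.
  by rewrite ler_wpM2l ?sqr_ge0// ler_nat.
have cY u v : contr (Y u v).
  by apply: contr_half_center; apply: contr_TDT; apply: contr_twisted_mono.
(* The decoupling error has Q_u to its right, which supplies the factor y. *)
have ea u v : `|ip (G' u v) (err u v *m W)| <= y * fro (err u v).
  have -> : err u v = err u v *m Q sp u.
    by rewrite /err mulmxBl (transfer_sum_slice u v gs) -mulmxA QQ.
  rewrite -mulmxA ip_mulR; apply: le_trans (ip_le_abs _ _) _.
  have -> : err u v *m Q sp u = err u v by rewrite /err mulmxBl (transfer_sum_slice u v gs) -mulmxA QQ.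
  apply: ler_wpM2r; first exact: fro_ge0.
  apply: le_trans (fro_contr _ (cG' u v)) _; rewrite fro_adj.
  by apply: le_trans (fro_contr_r _ cW) _; rewrite fro_Q.
have eb u v : `|ip (G' u v) (Y u v *m Q sp u *m (W' u v - W))| <= e u v.
  rewrite -mulmxA ip_mulL; apply: he.
  exact (contrM (contr_adj (cY u v)) (cG' u v)).
have ec u v : `|ip (G' u v - G) (transfer_sum sp s u v *m W)| <=
    \sum_(p <- s) k0 * y * fro (pin f (p.1 *m Tr sp v u *m (p.2 *m W))).
  rewrite /transfer_sum mulmx_suml ip_sumr; apply: le_trans (ler_norm_sum _ _ _) _.
  apply: ler_sum => p _; rewrite -(mulmxA _ p.2).
  have -> : G' u v - G = pin f (G' u v - G) by rewrite pinB pG pG'.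
  rewrite ip_pin; apply: le_trans (ip_le_abs _ _) _.
  rewrite ler_wpM2r ?fro_ge0//; apply: le_trans (hG u v).
  exact: fro_pin.
have sc : \sum_u \sum_v \sum_(p <- s) k0 * y * fro (pin f (p.1 *m Tr sp v u *m (p.2 *m W)))
    <= r%:R * (k0 * (x ^+ 2 * n%:R) * rho).
  rewrite (eq_bigr (fun u => \sum_(p <- s) \sum_v k0 * y * fro (pin f (p.1 *m Tr sp v u *m (p.2 *m W))))); last first.
    by move=> u _; rewrite exchange_big.
  rewrite exchange_big /=.
  apply: le_trans (_ : \sum_(p <- s) k0 * (x ^+ 2 * n%:R) * rho <= _); last first.
    rewrite big_const_seq count_predT iter_addr_0 -[leLHS]mulr_natl ler_wpM2r ?ler_nat//.
    by rewrite !mulr_ge0// ltW.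
  rewrite big_seq [leRHS]big_seq; apply: ler_sum => p /gs[c1 b1 c2 d2].
  rewrite (eq_bigr (fun u => k0 * y * (\sum_v fro (pin f (p.1 *m Tr sp v u *m (p.2 *m W)))))); last first.
    by move=> u _; rewrite mulr_sumr.
  rewrite -mulr_sumr.
  have := hs_pin_transfer (B := p.2 *m W) b1 c1 (contrM c2 cW) hf.
  rewrite -/f natrM nE xx => hp.
  have hp' : \sum_u \sum_v hs (pin f (p.1 *m Tr sp v u *m (p.2 *m W))) <= (x ^+ 2 * y * rho) ^+ 2.
    rewrite -(ler_pM2l N0'); apply: le_trans hp _.
    have -> : N%:R * (x ^+ 2 * y * rho) ^+ 2 = (rho ^+ 2 * N%:R) * (x ^+ 2 * y ^+ 2 * x ^+ 2) by ring.
    by rewrite rN mul1r.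
  have := fro_sum_le (sqr_ge0 _) hp'.
  rewrite sqrtr_sqr ger0_norm ?mulr_ge0 ?sqr_ge0 ?(ltW rho0)//.
  rewrite xx.
  move: (\sum_u _) => S hS.
  have -> : k0 * (x ^+ 2 * (x ^+ 2 * y ^+ 2)) * rho = k0 * y * (x ^+ 2 * (x ^+ 2 * y * rho)) by ring.
  by rewrite ler_wpM2l ?mulr_ge0.
have sa : \sum_u \sum_v y * fro (err u v) <= Num.sqrt C * (x ^+ 2 * n%:R) * rho.
  rewrite (eq_bigr (fun u => y * \sum_v fro (err u v))); last by move=> u _; rewrite mulr_sumr.
  rewrite -mulr_sumr.
  have := fro_sum_le _ es; rewrite mulr_ge0// => /(_ isT).
  rewrite xx sqrtrM// sn.
  have -> : \sum_i \sum_j fro (half_center (T sp i j *m twisted_mono sp i j w *m T sp i j) *m Q sp i - transfer_sum sp s i j) = \sum_u \sum_v fro (err u v) by [].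
  move: (\sum_u _) => S hS.
  apply: le_trans (ler_wpM2l y0 hS) _.
  have -> : y * (x ^+ 2 * (Num.sqrt C * (x * y))) = Num.sqrt C * (x ^+ 2 * y ^+ 2) * x by ring.
  have -> : Num.sqrt C * (x ^+ 2 * n%:R) * rho = Num.sqrt C * (x ^+ 2 * y ^+ 2) * (x ^+ 2 * rho).
    by rewrite nE; ring.
  by rewrite ler_wpM2l// !mulr_ge0// ?sqr_ge0 ?sqrtr_ge0.
split.
- apply: le_trans (_ : \sum_u \sum_v (y * fro (err u v) + e u v +
      \sum_(p <- s) k0 * y * fro (pin f (p.1 *m Tr sp v u *m (p.2 *m W)))) <= _).
    apply: ler_sum => u _; apply: ler_sum => v _.
    have -> : ip (G' u v) (Y u v *m Q sp u *m W' u v) - ip G (transfer_sum sp s u v *m W) =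
       ip (G' u v) (err u v *m W) + ip (G' u v) (Y u v *m Q sp u *m (W' u v - W)) +
       ip (G' u v - G) (transfer_sum sp s u v *m W).
      rewrite /err mulmxBl mulmxBr ipBl !ipBr; ring.
    apply: le_trans (ler_normD _ _) _; apply: lerD (ec u v).
    by apply: le_trans (ler_normD _ _) _; apply: lerD.
  rewrite (eq_bigr (fun u => \sum_v y * fro (err u v) + \sum_v e u v +
      \sum_v \sum_(p <- s) k0 * y * fro (pin f (p.1 *m Tr sp v u *m (p.2 *m W))))); last first.
    by move=> u _; rewrite !big_split.
  rewrite !big_split /= -/rho xx.
  have q1 : 0 <= Num.sqrt C * k0 * (x ^+ 2 * n%:R * rho) by rewrite !mulr_ge0 ?sqrtr_ge0 ?(ltW rho0).
  have q2 : 0 <= r%:R * (x ^+ 2 * n%:R * rho) by rewrite !mulr_ge0 ?(ltW rho0).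
  move: (\sum_u _) (\sum_u _) (\sum_u _) sa sc => S1 S2 S3 sa sc.
  have -> : (Num.sqrt C + r%:R) * (1 + k0) * (x ^+ 2 * n%:R) * rho =
    Num.sqrt C * (x ^+ 2 * n%:R) * rho + r%:R * (k0 * (x ^+ 2 * n%:R) * rho) +
    Num.sqrt C * k0 * (x ^+ 2 * n%:R * rho) + r%:R * (x ^+ 2 * n%:R * rho) by ring.
  lra.
- have -> : \sum_u \sum_v ip G (transfer_sum sp s u v *m W) =
      \sum_(p <- s) ip G (p.1 *m (\sum_u \sum_v Tr sp v u) *m (p.2 *m W)).
    rewrite (eq_bigr (fun u => ip G (\sum_v transfer_sum sp s u v *m W))); last first.
      by move=> u _; rewrite ip_sumr.
    rewrite -ip_sumr -ip_sumr; congr (ip _ _).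
    rewrite (eq_bigr (fun u => \sum_(p <- s) \sum_v p.1 *m Tr sp v u *m (p.2 *m W))); last first.
      move=> u _; rewrite exchange_big; apply: eq_bigr => v _.
      by rewrite /transfer_sum mulmx_suml; apply: eq_bigr => p _; rewrite mulmxA.
    rewrite exchange_big; apply: eq_bigr => p _.
    rewrite mulmx_sumr mulmx_suml; apply: eq_bigr => u _.
    by rewrite mulmx_sumr mulmx_suml.
  apply: le_trans (ler_norm_sum _ _ _) _.
  apply: le_trans (_ : \sum_(p <- s) (x ^+ 2 * n%:R) * rho <= _); last first.
    rewrite big_const_seq count_predT iter_addr_0 -[leLHS]mulr_natl -/rho xx -[leRHS]mulrA.
    rewrite ler_wpM2r ?mulr_ge0 ?sqr_ge0 ?(ltW rho0)//.
    by apply: le_trans (_ : r%:R <= _); rewrite ?ler_nat// lerDr sqrtr_ge0.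
  rewrite big_seq [leRHS]big_seq; apply: ler_sum => p /gs[c1 b1 c2 d2].
  rewrite -mulmxA ip_mulL ip_mulR; apply: le_trans (ip_le_abs _ _) _.
  have cL : contr (adjmx p.1 *m G *m adjmx (p.2 *m W)).
    exact (contrM (contrM (contr_adj c1) cG) (contr_adj (contrM c2 cW))).
  apply: le_trans (ler_pM (fro_ge0 _) (fro_ge0 _) (fro_contr_le cL) (ler_wsqrtr (hs_sum_transfer R sp))) _.
  rewrite natrM nE xx.
  have -> : x ^+ 2 * y ^+ 2 * x ^+ 2 = (x ^+ 2 * y) ^+ 2 by ring.
  rewrite -nE sn sqrtr_sqr ger0_norm ?mulr_ge0 ?sqr_ge0//.
  have -> : x * y * (x ^+ 2 * y) = (x ^+ 2 * y ^+ 2) * x by ring.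
  have -> : x ^+ 2 * n%:R * rho = (x ^+ 2 * y ^+ 2) * (x ^+ 2 * rho) by rewrite nE; ring.
  by rewrite ler_wpM2l// !mulr_ge0// ?sqr_ge0.
apply: le_trans (_ : \sum_(u : U) \sum_(v : U) r%:R * y ^+ 2 <= _); last first.
  rewrite !sumr_const -!mulrnA -[leLHS]mulr_natr natrM !xx nE.
  have -> : r%:R * y ^+ 2 * (x ^+ 2 * x ^+ 2) = r%:R * (x ^+ 2 * (x ^+ 2 * y ^+ 2)) by ring.
  by rewrite ler_wpM2r ?mulr_ge0 ?sqr_ge0// lerDr sqrtr_ge0.
apply: ler_sum => u _; apply: ler_sum => v _.
rewrite /transfer_sum mulmx_suml ip_sumr; apply: le_trans (ler_norm_sum _ _ _) _.
apply: le_trans (_ : \sum_(p <- s) y ^+ 2 <= _); last first.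
  by rewrite big_const_seq count_predT iter_addr_0 -[leLHS]mulr_natl ler_wpM2r ?ler_nat ?sqr_ge0.
rewrite big_seq [leRHS]big_seq; apply: ler_sum => p /gs[c1 b1 c2 d2].
rewrite -(mulmxA _ p.2) -mulmxA ip_mulL ip_mulR -{1}Qtransfer ip_mulL Q_adj.
apply: le_trans (ip_le_abs _ _) _.
have cL : contr (adjmx p.1 *m G *m adjmx (p.2 *m W)).
  exact (contrM (contrM (contr_adj c1) cG) (contr_adj (contrM c2 cW))).
rewrite expr2 ler_pM ?fro_ge0//.
  by apply: le_trans (fro_contr_r _ cL) _; rewrite fro_Q.
by apply: le_trans (fro_contr_r _ (contr_T sp u v)) _; rewrite fro_Q.
Qed.

Lemma trace_bound_le l (K K' : R) : K <= K' -> trace_bound l K -> trace_bound l K'.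
Proof.
move=> KK' H n U V sp L fU N w W G W' G' k0 e f N0 NU hf sw gw cW cG cW' cG' pG pG' k00 hG he.
have [t [t1 t2 t3]] :=
  H n U V sp L fU N w W G W' G' k0 e N0 NU hf sw gw cW cG cW' cG' pG pG' k00 hG he.
have s0 : 0 <= (Num.sqrt N%:R)^-1 :> R by rewrite invr_ge0 sqrtr_ge0.
have mn0 : 0 <= (#|U|%:R * n%:R) :> R by rewrite mulr_ge0.
exists t; split.
- apply: le_trans t1 _; rewrite lerD2r ler_wpM2r// ler_wpM2r// ler_wpM2r// addr_ge0//.
- by apply: le_trans t2 _; rewrite ler_wpM2r// ler_wpM2r.
- by apply: le_trans t3 _; rewrite ler_wpM2r.
Qed.

(** A constant common to all lengths up to L, as the letters of a word differ in
    length. *)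
Lemma trace_estimate_unif L : exists K : R, 0 <= K /\ forall l, (l <= L)%N -> trace_bound l K.
Proof.
elim: L => [|L [K1 [K10 H1]]].
  have [K [K0 H]] := trace_estimate 0; exists K; split=> // l.
  by rewrite leqn0 => /eqP ->.
have [K2 [K20 H2]] := trace_estimate L.+1.
exists (K1 + K2); split; first exact: addr_ge0.
move=> l; rewrite leq_eqVlt => /orP[/eqP ->|lL].
  by apply: trace_bound_le H2; rewrite lerDr.
by apply: trace_bound_le (H1 l lL); rewrite lerDl.
Qed.

End TraceEstimate.

(** * Words with several colours *)

Section Signs.
Variable R : realType.
Local Notation Cx := R[i]%C.

Definition sign_mx n (e : {ffun 'I_n -> bool}) : 'M[Cx]_n :=
  diag_mx (\row_a (-1) ^+ (e a)).

Lemma sign_mx_diag n (e : {ffun 'I_n -> bool}) : is_diag_mx (sign_mx e).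
Proof. exact: diag_mx_is_diag. Qed.

Lemma contr_sign_mx n (e : {ffun 'I_n -> bool}) : contr (sign_mx e).
Proof.
apply: contr_diag => [|a]; first exact: sign_mx_diag.
rewrite !mxE eqxx mulr1n; case: (e a); rewrite ?expr1 ?expr0 ?Normc.normc1 ?expr1n//.
by rewrite /= oppr0 expr0n /= addr0 sqrrN expr1n sqrtr1 expr1n.
Qed.

Lemma sum_signs n (a b : 'I_n) : a != b ->
  \sum_(e : {ffun 'I_n -> bool}) ((-1) ^+ (e a) * (-1) ^+ (e b) : Cx) = 0.
Proof.
move=> ab; set s := \sum_e _.
pose fl (e : {ffun 'I_n -> bool}) := [ffun x => if x == a then ~~ e x else e x].
have flK : involutive fl.
  by move=> e; apply/ffunP => x; rewrite !ffunE; case: eqP => // _; rewrite negbK.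
have : s = - s.
  rewrite {1}/s (reindex_inj (inv_inj flK)) /= -sumrN; apply: eq_bigr => e _.
  rewrite !ffunE eqxx eq_sym (negPf ab) -mulNr; congr (_ * _).
  by case: (e a); rewrite /= ?expr1 ?expr0 ?opprK.
by move/eqP; rewrite -addr_eq0 -mulr2n mulrn_eq0 => /eqP.
Qed.

(** The diagonal part as an average of conjugations by diagonal sign matrices.  It
    turns the centring of a letter into products, which telescope like the letter
    itself. *)
Lemma Delta_signs n (D : 'M[Cx]_n) :
  Delta D *+ #|{ffun 'I_n -> bool}| = \sum_e sign_mx e *m D *m sign_mx e.
Proof.
apply/matrixP => a b; rewrite summxE mulmxnE mxE.
transitivity (\sum_(e : {ffun 'I_n -> bool}) ((-1) ^+ (e a) * (-1) ^+ (e b)) * D a b); last first.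
  apply: eq_bigr => e _; rewrite mulmx_diagE ?sign_mx_diag// mul_diagE ?sign_mx_diag//.
  by rewrite !mxE !eqxx !mulr1n mulrAC.
rewrite -mulr_suml; have [<-|ab] := eqVneq a b; last by rewrite sum_signs// mul0r mul0rn.
rewrite (eq_bigr (fun=> 1)); first by rewrite sumr_const mulr_natl.
by move=> e _; rewrite -signr_addb addbb.
Qed.

End Signs.

Section Words.
Variable R : realType.
Local Notation Cx := R[i]%C.
Local Notation Q := (@slice R _ _ _).
Local Notation T := (@slice_swap R _ _ _).
Variables (n : nat) (C : finType) (U V : C -> finType)
  (sp : forall c, splitting n (U c) (V c)).
Local Notation M := 'M[Cx]_n.
Local Notation perms := {dffun forall c, {perm U c}}.
Implicit Types (sg : perms) (c : C) (w : seq (M * M)).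

Definition conj_lift c (s : {perm U c}) (X : M) : M :=
  perm_mx (lift_left (sp c) s) *m X *m perm_mx (lift_left (sp c) s)^-1%g.

Definition factor sg c (p : M * M) : M := p.1 *m conj_lift (sg c) p.2.
Definition mono sg c w : M := foldr (fun p A => factor sg c p *m A) 1%:M w.
Definition letter sg (l : C * seq (M * M)) : M := half_center (mono sg l.1 l.2).
(** A letter is encoded as its colour together with its list of factors (Lambda, X). *)
Definition word_val sg (ws : seq (C * seq (M * M))) : M :=
  foldr (fun l A => letter sg l *m A) 1%:M ws.

Definition good_word (ws : seq (C * seq (M * M))) :=
  forall l, l \in ws -> forall p, p \in l.2 -> good_factor (sp l.1) p.

(** The colour c permutation composed with the transposition (u v).  For fixed (u, v)
    this is an involution of the families of permutations, so sums over all families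
    are invariant under it. *)
Definition swap c (u v : U c) sg : perms :=
  finfun (@eqtype.dfwith C (fun c => {perm U c}) (fun c => sg c) c (tperm u v * sg c)%g).

Lemma swapE c (u v : U c) sg : swap u v sg c = (tperm u v * sg c)%g.
Proof. by rewrite /swap ffunE eqtype.dfwith_in. Qed.
Lemma swap_out c (u v : U c) sg c' : c != c' -> swap u v sg c' = sg c'.
Proof. by move=> cc; rewrite /swap ffunE eqtype.dfwith_out. Qed.

Lemma swapK c (u v : U c) : involutive (swap u v).
Proof.
move=> sg; apply/ffunP => c'; have [<-|cc] := eqVneq c c'.
  by rewrite !swapE mulgA tperm2 mul1g.
by rewrite !swap_out.
Qed.

Lemma conj_liftE c (s : {perm U c}) X a b :
  conj_lift s X a b = X (lift_left (sp c) s a) (lift_left (sp c) s b).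
Proof.
rewrite /conj_lift mxE (bigD1 (lift_left (sp c) s b))//= big1 ?addr0.
  by rewrite perm_mulE !mxE permK eqxx mulr1.
move=> k kb; rewrite perm_mulE !mxE; case: eqP; rewrite ?mulr0// => e.
by rewrite -e permKV eqxx in kb.
Qed.

Lemma contr_conj_lift c (s : {perm U c}) X : contr X -> contr (conj_lift s X).
Proof. by move=> cX; apply: contrM (contrM (contr_perm _) cX) (contr_perm _). Qed.

Lemma blk_conj_lift c (s : {perm U c}) X : blk (sp c) X -> blk (sp c) (conj_lift s X).
Proof. by move=> bX a b ab; rewrite conj_liftE bX// !rho_lift_left. Qed.

Lemma conj_lift1 c (s : {perm U c}) : conj_lift s 1%:M = 1%:M.
Proof.
by apply/matrixP => a b; rewrite conj_liftE !mxE (inj_eq perm_inj).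
Qed.

Lemma conj_lift_swap c (u v : U c) sg X :
  conj_lift (swap u v sg c) X = T (sp c) u v *m conj_lift (sg c) X *m T (sp c) u v.
Proof.
by apply/matrixP => a b; rewrite mulTE TmulE !conj_liftE swapE lift_leftM !permM.
Qed.

Definition conj_factors sg c w := [seq (p.1, conj_lift (sg c) p.2) | p <- w].

Lemma conj_factors_good sg c w :
  (forall p, p \in w -> good_factor (sp c) p) ->
  forall p, p \in conj_factors sg c w -> good_factor (sp c) p.
Proof.
move=> g p /mapP[q /g[d1 c1 c2 b2] ->]; split=> //=; first exact: contr_conj_lift.
exact: blk_conj_lift.
Qed.

(** Composing sigma_c with (u v) conjugates each X by T.  Conjugating the whole
    word by T transfers this to the factors Lambda. *)
Lemma mono_swap c (u v : U c) sg w :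
  mono (swap u v sg) c w = T (sp c) u v *m twisted_mono (sp c) u v (conj_factors sg c w) *m T (sp c) u v.
Proof.
elim: w => [|p w IH] /=; first by rewrite mulmx1 TT.
rewrite IH /factor conj_lift_swap -!(mulmxA (T (sp c) u v) p.1).
rewrite !mulmxA TT mul1mx -(mulmxA _ (T (sp c) u v) (T (sp c) u v)) TT mulmx1.
by rewrite -!mulmxA.
Qed.

Lemma mono_swap_out c (u v : U c) sg c' w : c != c' ->
  mono (swap u v sg) c' w = mono sg c' w.
Proof. by move=> cc; elim: w => [//|p w IH] /=; rewrite IH /factor swap_out. Qed.

Lemma contr_factor sg c p : good_factor (sp c) p -> contr (factor sg c p).
Proof. by move=> [d1 c1 c2 b2]; apply: contrM c1 (contr_conj_lift _ c2). Qed.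

Lemma contr_mono sg c w : (forall p, p \in w -> good_factor (sp c) p) -> contr (mono sg c w).
Proof.
elim: w => [|p w IH] g /=; first exact: contr1.
apply: contrM; first by apply: contr_factor; apply: g; rewrite mem_head.
by apply: IH => q qw; apply: g; rewrite in_cons qw orbT.
Qed.

Lemma blk_mono sg c w : (forall p, p \in w -> good_factor (sp c) p) -> blk (sp c) (mono sg c w).
Proof.
elim: w => [|p w IH] g /=; first exact: blk1.
apply: blkM; last by apply: IH => q qw; apply: g; rewrite in_cons qw orbT.
have [d1 c1 c2 b2] := g p (mem_head _ _).
exact: blkM (blk_diag d1) (blk_conj_lift _ b2).
Qed.

Lemma good_word_cons l ws : good_word (l :: ws) ->
  (forall p, p \in l.2 -> good_factor (sp l.1) p) /\ good_word ws.
Proof.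
move=> g; split; first by apply: g; rewrite mem_head.
by move=> l' lw; apply: g; rewrite in_cons lw orbT.
Qed.

Lemma contr_word_val sg ws : good_word ws -> contr (word_val sg ws).
Proof.
elim: ws => [|l ws IH] /=; first by move=> _; exact: contr1.
move=> /good_word_cons[g1 g2]; apply: contrM; last exact: IH.
by apply: contr_half_center; apply: contr_mono.
Qed.

(** The cost of inserting T - 1 to the right of Q_u A, see [ip_cut_le]. *)
Definition cut_bound c (u v : U c) (A : M) : R :=
  2 * Num.sqrt #|V c|%:R * (fro (Q (sp c) u *m A *m Q (sp c) u) + fro (Q (sp c) u *m A *m Q (sp c) v)).

(** T - 1 is supported in the slices u and v, so only the blocks (u, u) and (u, v) of
    A matter; the slice next to T - 1 contributes #|V|^(1/2). *)
Lemma ip_cut_le c (u v : U c) (H A K : M) : contr H -> contr K ->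
  `|ip H (Q (sp c) u *m A *m (T (sp c) u v - 1%:M) *m K)| <= cut_bound u v A.
Proof.
move=> cH cK.
have e : T (sp c) u v - 1%:M = (Q (sp c) u + Q (sp c) v) *m (T (sp c) u v - 1%:M) :> M.
  rewrite -{1}(slice_swap_sub1 R (sp c)) mulmxBl mulmxBr mul1mx mulmx1; congr (_ - _).
  rewrite mulmxDl mulmxDr QT addrC -QT; congr (_ + _).
  by rewrite /slice_swap tpermC (QT R (sp c) v u).
have h (x : U c) : `|ip H (Q (sp c) u *m A *m Q (sp c) x *m ((T (sp c) u v - 1%:M) *m K))| <=
    2 * Num.sqrt #|V c|%:R * fro (Q (sp c) u *m A *m Q (sp c) x).
  have -> : Q (sp c) u *m A *m Q (sp c) x = Q (sp c) u *m (Q (sp c) u *m A *m Q (sp c) x).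
    by rewrite !mulmxA QQ.
  rewrite ip_mulR; apply: le_trans (_ : `|ip (Q (sp c) u *m (H *m adjmx ((T (sp c) u v - 1%:M) *m K))) (Q (sp c) u *m A *m Q (sp c) x)| <= _).
    by rewrite ip_mulL Q_adj.
  apply: le_trans (ip_le_abs _ _) _; rewrite [X in _ <= _ * fro X]mulmxA [X in _ <= _ * fro (X *m _)]mulmxA QQ.
  rewrite ler_wpM2r ?fro_ge0//.
  rewrite adjmxM !mulmxA -fro_adj adjmxM adjmxK.
  rewrite -(@ler_sqr R) ?nnegrE ?mulr_ge0 ?fro_ge0 ?sqrtr_ge0// fro_sqr.
  apply: le_trans (hs_diffl _ (contr_T (sp c) u v) (@contr1 R n)) _.
  rewrite exprMn -natrX sqr_sqrtr// -(hs_Q R (sp c) u) ler_wpM2l// hs_adj.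
  apply: le_trans (hs_contr_r _ (contr_adj cK)) _.
  exact: hs_contr_r.
rewrite e mulmxDl mulmxDr mulmxDl ipDr !(mulmxA (Q (sp c) u *m A)) -!(mulmxA (Q (sp c) u *m A *m _)).
apply: le_trans (ler_normD _ _) _; rewrite /cut_bound mulrDr lerD//.
Qed.

End Words.

(** * Effect of a transposition on a word *)

Lemma sub_sub_swap (Z : zmodType) (a b d e : Z) : a - d - (b - e) = a - b - (d - e).
Proof. by rewrite !opprB addrACA [RHS]addrACA (addrC (- d)). Qed.

Section MatrixIdentities.
Variables (K : comNzRingType) (n : nat).

(** One factor X becomes T X T, so T - 1 is inserted before it and after it. *)
Lemma swap_telescope (q b l t x y z k : 'M[K]_n) :
  q *m b *m (l *m (t *m x *m t) *m y - l *m x *m z) *m k =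
  q *m (b *m l) *m (t - 1%:M) *m (x *m t *m y *m k) +
  (q *m (b *m (l *m x)) *m (t - 1%:M) *m (y *m k) + q *m (b *m (l *m x)) *m (y - z) *m k).
Proof.
rewrite !mulmxBr !mulmxBl !mulmx1 !mulmxA.
move: (_ *m k) (_ *m k) (_ *m k) (_ *m k) => a1 a2 a3 a4.
by apply/matrixP => i j; rewrite !mxE; ring.
Qed.

Lemma mul_telescope (q b x y x' y' : 'M[K]_n) :
  q *m b *m (x' *m y' - x *m y) =
  q *m b *m (x' - x) *m y' + q *m (b *m x) *m (y' - y).
Proof.
rewrite !mulmxBr !mulmxBl !mulmxA.
move: (_ *m y) (_ *m y') (_ *m y') => a1 a2 a3.
by apply/matrixP => i j; rewrite !mxE; ring.
Qed.

Lemma mulmx_mulrnr (a b : 'M[K]_n) k : a *m (b *+ k) = (a *m b) *+ k.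
Proof. by elim: k => [|k IH]; rewrite ?mulr0n ?mulmx0// !mulrS mulmxDr IH. Qed.

Lemma mulmx_mulrnl (a b : 'M[K]_n) k : (b *+ k) *m a = (b *m a) *+ k.
Proof. by elim: k => [|k IH]; rewrite ?mulr0n ?mul0mx// !mulrS mulmxDl IH. Qed.

End MatrixIdentities.

Section WordDiff.
Variable R : realType.
Local Notation Cx := R[i]%C.
Local Notation Q := (@slice R _ _ _).
Local Notation T := (@slice_swap R _ _ _).
Variables (n : nat) (C : finType) (U V : C -> finType)
  (sp : forall c, splitting n (U c) (V c)).
Local Notation M := 'M[Cx]_n.
Local Notation perms := {dffun forall c, {perm U c}}.
Local Notation signs := {ffun 'I_n -> bool}.
Implicit Types (sg : perms) (c : C) (w : seq (M * M)).
Local Notation good_factors c w := (forall p, p \in w -> good_factor (sp c) p).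

(** A diagonal sign matrix to the left of a piece is absorbed into its first
    diagonal factor, so that a piece with a sign is again the factor list of a word. *)
Definition scale_head (e : signs) w : seq (M * M) :=
  if w is p :: w' then (sign_mx R e *m p.1, p.2) :: w' else [::].

(** The beginnings of a factor list after which T - 1 is inserted when the factors
    are transposed one at a time; a cut in front of X is written with X = 1. *)
Fixpoint cut_prefixes w : seq (seq (M * M)) :=
  if w is p :: w' then [:: [:: (p.1, 1%:M)], [:: p] & map (cons p) (cut_prefixes w')] else [::].

(** The places where a word is broken off inside a letter of colour c: the letters
    before it, and the piece of the letter, without and with signs; the latter come
    from [Delta_signs]. *)
Fixpoint cuts c (e : signs) (ws : seq (C * seq (M * M))) : seq (seq (C * seq (M * M)) * seq (M * M)) :=
  if ws is l :: ws' then
    (if l.1 == c then [seq ([::], A) | A <- cut_prefixes l.2 ++ map (scale_head e) (cut_prefixes l.2)] else [::])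
    ++ [seq (l :: q.1, q.2) | q <- cuts c e ws']
  else [::].

Lemma cut_prefixesP c w A : good_factors c w -> A \in cut_prefixes w ->
  [/\ good_factors c A, (size A <= size w)%N & A != [::]].
Proof.
elim: w A => [//|p w IH] A g; have gp := g p (mem_head _ _).
have gw : good_factors c w by move=> q qw; apply: g; rewrite in_cons qw orbT.
rewrite /= !inE => /or3P[/eqP ->|/eqP ->|/mapP[B /(IH _ gw)[h1 h2 h3] ->]]; split=> //.
- move=> q; rewrite inE => /eqP ->; case: gp => d1 c1 c2 b2; split=> //=; first exact: contr1.
  exact: blk1.
- by move=> q; rewrite inE => /eqP ->.
- by move=> q; rewrite in_cons => /orP[/eqP ->|/h1].
Qed.

Lemma scale_head_good c e w : good_factors c w -> good_factors c (scale_head e w).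
Proof.
case: w => [//|p w] g q; rewrite /= in_cons => /orP[/eqP ->|qw].
  have [d1 c1 c2 b2] := g p (mem_head _ _).
  split; rewrite /=; [exact (diagM (sign_mx_diag R e) d1)|exact (contrM (contr_sign_mx e) c1)|exact c2|exact b2].
by apply: g; rewrite in_cons qw orbT.
Qed.

Lemma size_scale_head e w : size (scale_head e w) = size w.
Proof. by case: w. Qed.

Lemma mono_scale sg c e w : w != [::] -> mono sp sg c (scale_head e w) = sign_mx R e *m mono sp sg c w.
Proof. by case: w => [//|p w] _ /=; rewrite /factor /= !mulmxA. Qed.

Lemma size_cut_prefixes w : size (cut_prefixes w) = (2 * size w)%N.
Proof. by elim: w => [//|p w IH] /=; rewrite size_map IH mulnS. Qed.

Lemma cutsP c e ws q : good_word sp ws -> q \in cuts c e ws ->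
  exists w post, [/\ ws = q.1 ++ (c, w) :: post, good_factors c q.2 & (size q.2 <= size w)%N].
Proof.
elim: ws q => [//|l ws IH] q /good_word_cons[gl gw]; rewrite /= mem_cat => /orP[|].
  case: eqP => // lc; move=> /mapP[A hA ->] /=.
  exists l.2, ws; split; first by rewrite -lc; case: (l).
    move: hA; rewrite lc in gl; rewrite mem_cat => /orP[/(cut_prefixesP gl)[//]|/mapP[B /(cut_prefixesP gl)[h1 _ _] ->]].
    exact: scale_head_good.
  move: hA; rewrite mem_cat => /orP[/(cut_prefixesP gl)[//]|/mapP[B /(cut_prefixesP gl)[_ h1 _] ->]].
  by rewrite size_scale_head.
move=> /mapP[q' /(IH _ gw)[w [post [h1 h2 h3]]] ->] /=.
by exists w, post; split=> //; rewrite h1.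
Qed.

Lemma size_cuts c e ws L : (forall l, l \in ws -> (size l.2 <= L)%N) ->
  (size (cuts c e ws) <= 4 * L * size ws)%N.
Proof.
elim: ws => [//|l ws IH] h /=; rewrite size_cat size_map mulnS leq_add//; last first.
  by apply: IH => l' lw; apply: h; rewrite in_cons lw orbT.
case: ifP => // _; rewrite size_map size_cat size_map size_cut_prefixes -mulnDl.
by apply: leq_mul => //; apply: h; rewrite mem_head.
Qed.

(** Transpose the factors one at a time. *)
Lemma mono_diff c (u v : U c) sg w (H C0 K : M) :
  good_factors c w -> contr H -> contr K ->
  `|ip H (Q (sp c) u *m C0 *m (mono sp (swap u v sg) c w - mono sp sg c w) *m K)|
  <= \sum_(A <- cut_prefixes w) cut_bound sp u v (C0 *m mono sp sg c A).
Proof.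
elim: w C0 => [|p w IH] C0 g cH cK /=.
  by rewrite big_nil subrr mulmx0 mul0mx ip0r normr0.
have gp := g p (mem_head _ _); have [d1 c1 c2 b2] := gp.
have gw : good_factors c w by move=> q qw; apply: g; rewrite in_cons qw orbT.
rewrite !big_cons big_map.
set t := T (sp c) u v; set M' := mono sp (swap u v sg) c w; set M0 := mono sp sg c w.
set x := conj_lift sp (sg c) p.2.
have cM' : contr M' by apply: contr_mono.
have cx : contr x by apply: contr_conj_lift.
have -> : mono sp sg c [:: (p.1, 1%:M)] = p.1 by rewrite /= /factor conj_lift1 !mulmx1.
have -> : mono sp sg c [:: p] = p.1 *m x by rewrite /= mulmx1.
have e : Q (sp c) u *m C0 *m (factor sp (swap u v sg) c p *m M' - factor sp sg c p *m M0) *m K =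
   Q (sp c) u *m (C0 *m p.1) *m (t - 1%:M) *m (x *m t *m M' *m K) +
   (Q (sp c) u *m (C0 *m (p.1 *m x)) *m (t - 1%:M) *m (M' *m K) +
   Q (sp c) u *m (C0 *m (p.1 *m x)) *m (M' - M0) *m K).
  by rewrite /factor conj_lift_swap -/t -/x; exact: (@swap_telescope Cx).
rewrite e !ipDr; apply: le_trans (ler_normD _ _) _; apply: lerD.
  exact (ip_cut_le sp u v _ cH (contrM (contrM (contrM cx (contr_T (sp c) u v)) cM') cK)).
apply: le_trans (ler_normD _ _) _; apply: lerD.
  exact (ip_cut_le sp u v _ cH (contrM cM' cK)).
apply: le_trans (IH (C0 *m (p.1 *m x)) gw cH cK) _.
apply: ler_sum => A _.
by rewrite /= /factor -/x !mulmxA.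
Qed.

Lemma ip_mulrn m (H A : 'M[Cx]_m) k : ip H (A *+ k) = ip H A *+ k.
Proof. by elim: k => [|k IH]; rewrite ?mulr0n ?ip0r// !mulrS ipDr IH. Qed.

(** Write the diagonal part of the difference as an average over signs; for each
    choice of signs both terms are handled by [mono_diff]. *)
Lemma letter_diff c (u v : U c) sg w (H C0 K : M) :
  good_factors c w -> contr H -> contr K ->
  #|signs|%:R * `|ip H (Q (sp c) u *m C0 *m (letter sp (swap u v sg) (c, w) - letter sp sg (c, w)) *m K)|
  <= \sum_(e : signs) \sum_(A <- cut_prefixes w ++ map (scale_head e) (cut_prefixes w)) cut_bound sp u v (C0 *m mono sp sg c A).
Proof.
move=> g cH cK.
set D := mono sp (swap u v sg) c w - mono sp sg c w.
have e1 : ip H (Q (sp c) u *m C0 *m (letter sp (swap u v sg) (c, w) - letter sp sg (c, w)) *m K) *+ #|signs|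
   = 2^-1 * \sum_(e : signs) (ip H (Q (sp c) u *m C0 *m D *m K)
        - ip H (Q (sp c) u *m (C0 *m sign_mx R e) *m D *m (sign_mx R e *m K))).
  have -> : letter sp (swap u v sg) (c, w) - letter sp sg (c, w) = ((2^-1)%:C)%C *: (D - Delta D).
    rewrite /letter /half_center /= -scalerBr; congr (_ *: _).
    by rewrite /D !Delta_pin pinB sub_sub_swap.
  rewrite -scalemxAr -scalemxAl ipZr -mulrnAr -ip_mulrn; congr (_ * _).
  rewrite mulmxBr mulmxBl mulrnBl ipBr sumrB sumr_const; congr (_ - _).
    by rewrite ip_mulrn.
  have -> : (Q (sp c) u *m C0 *m Delta D *m K) *+ #|signs| =
      Q (sp c) u *m C0 *m (Delta D *+ #|signs|) *m K.
    by rewrite mulmx_mulrnr mulmx_mulrnl.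
  rewrite Delta_signs mulmx_sumr mulmx_suml ip_sumr; apply: eq_bigr => e _.
  by rewrite !mulmxA.
rewrite mulr_natl -normrMn e1 normrM ger0_norm ?invr_ge0//.
apply: le_trans (_ : 2^-1 * \sum_(e : signs) 2 * \sum_(A <- cut_prefixes w ++ map (scale_head e) (cut_prefixes w)) cut_bound sp u v (C0 *m mono sp sg c A) <= _); last first.
  by rewrite -mulr_sumr mulrA mulVf// mul1r.
rewrite ler_wpM2l ?invr_ge0//; apply: le_trans (ler_norm_sum _ _ _) _.
apply: ler_sum => e _; rewrite big_cat big_map /=.
apply: le_trans (ler_normB _ _) _.
have h1 := mono_diff u v sg C0 g cH cK.
have h2 := mono_diff u v sg (C0 *m sign_mx R e) g cH (contrM (contr_sign_mx e) cK).
have h3 : \sum_(A <- cut_prefixes w) cut_bound sp u v (C0 *m sign_mx R e *m mono sp sg c A) =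
    \sum_(A <- cut_prefixes w) cut_bound sp u v (C0 *m mono sp sg c (scale_head e A)).
  by apply: eq_big_seq => A /(cut_prefixesP g)[_ _ A0]; rewrite (mono_scale _ _ _ A0) (mulmxA C0).
rewrite h3 in h2.
rewrite mulr_natl mulr2n; apply: lerD.
  apply: le_trans h1 _; rewrite lerDl; exact: le_trans (normr_ge0 _) h2.
apply: le_trans h2 _; rewrite lerDr; exact: le_trans (normr_ge0 _) h1.
Qed.

Lemma letter_swap_out c (u v : U c) sg (l : C * seq (M * M)) : c != l.1 ->
  letter sp (swap u v sg) l = letter sp sg l.
Proof. by move=> cl; rewrite /letter mono_swap_out. Qed.

(** Transpose the letters one at a time; the letters of other colours do not
    change. *)
Lemma word_val_diff c (u v : U c) sg ws (H C0 : M) :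
  good_word sp ws -> contr H ->
  #|signs|%:R * `|ip H (Q (sp c) u *m C0 *m (word_val sp (swap u v sg) ws - word_val sp sg ws))|
  <= \sum_(e : signs) \sum_(q <- cuts c e ws) cut_bound sp u v (C0 *m (word_val sp sg q.1 *m mono sp sg c q.2)).
Proof.
elim: ws C0 => [|l ws IH] C0 g cH /=.
  by rewrite subrr mulmx0 ip0r normr0 mulr0 big1// => e _; rewrite big_nil.
have [gl gw] := good_word_cons g.
set y' := letter sp (swap u v sg) l; set y := letter sp sg l.
have -> : Q (sp c) u *m C0 *m (y' *m word_val sp (swap u v sg) ws - y *m word_val sp sg ws) =
   Q (sp c) u *m C0 *m (y' - y) *m word_val sp (swap u v sg) ws +
   Q (sp c) u *m (C0 *m y) *m (word_val sp (swap u v sg) ws - word_val sp sg ws).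
  exact: (@mul_telescope Cx).
rewrite ipDr; apply: le_trans (ler_wpM2l _ (ler_normD _ _)) _; first by [].
rewrite mulrDr.
under [leRHS]eq_bigr => e _ do rewrite big_cat /= big_map /=.
rewrite big_split /=; apply: lerD; last first.
  apply: le_trans (IH (C0 *m y) gw cH) _; apply: ler_sum => e _; apply: ler_sum => q _.
  by rewrite !mulmxA.
have [lc|lc] := eqVneq l.1 c; last first.
  rewrite /y' letter_swap_out 1?eq_sym// subrr mulmx0 mul0mx ip0r normr0 mulr0.
  by apply: sumr_ge0 => e _; rewrite big_nil.
have el : l = (c, l.2) by rewrite -lc; case: (l).
rewrite /y' /y el; rewrite lc in gl.
apply: le_trans (letter_diff u v sg C0 gl cH (contr_word_val _ gw)) _.
apply: ler_sum => e _; rewrite big_map; apply: ler_sum => A _.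
by rewrite mul1mx.
Qed.

Definition nrm m (A : 'M[Cx]_m) : R := fro A / Num.sqrt m%:R.

Lemma nrm_ge0 m (A : 'M[Cx]_m) : 0 <= nrm A.
Proof. by rewrite divr_ge0 ?fro_ge0 ?sqrtr_ge0. Qed.

End WordDiff.

(** * Sums over transpositions *)

Section Averaging.
Variable R : realType.
Local Notation Cx := R[i]%C.
Local Notation Q := (@slice R _ _ _).
Local Notation T := (@slice_swap R _ _ _).

Lemma sqrt_le_div (N m : nat) : (0 < N)%N -> (N <= m)%N ->
  Num.sqrt m%:R <= m%:R / Num.sqrt N%:R :> R.
Proof.
move=> N0 Nm; have N0' : 0 < Num.sqrt N%:R :> R by rewrite sqrtr_gt0 ltr0n.
rewrite ler_pdivlMr// -[X in _ <= X](@sqr_sqrtr R)// expr2 ler_wpM2l ?sqrtr_ge0//.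
by rewrite ler_wsqrtr// ler_nat.
Qed.

Lemma nrmE n (A : 'M[Cx]_n) : fro A = nrm A * Num.sqrt n%:R.
Proof.
rewrite /nrm; case: n A => [|n] A.
  by rewrite sqrtr0 mulr0 /fro hsE big_ord0 sqrtr0.
by rewrite divfK// sqrtr_eq0 -ltNge ltr0n.
Qed.

Lemma nrm_contr n (A : 'M[Cx]_n) : contr A -> nrm A <= 1.
Proof.
case: n A => [|n] A cA; first by rewrite /nrm sqrtr0 invr0 mulr0.
by rewrite /nrm ler_pdivrMr ?sqrtr_gt0 ?ltr0n// mul1r fro_contr_le.
Qed.

(** The geometric sum formula for the difference of two powers. *)
Lemma pow_diff (a b c : R) P : 0 <= a <= c -> 0 <= b <= c ->
  `|a ^+ P - b ^+ P| <= P%:R * `|a - b| * c ^+ P.-1.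
Proof.
move=> /andP[a0 ac] /andP[b0 bc]; have c0 := le_trans a0 ac.
rewrite subrXX normrM -mulrA mulrCA ler_wpM2l//.
apply: le_trans (ler_norm_sum _ _ _) _.
apply: le_trans (_ : \sum_(i < P) c ^+ P.-1 <= _); last first.
  by rewrite sumr_const card_ord mulr_natl.
apply: ler_sum => i _; rewrite normrM !normrX !ger0_norm//.
apply: le_trans (ler_pM _ _ (lerXn2r _ _ _ ac) (lerXn2r _ _ _ bc)) _; rewrite ?nnegrE ?exprn_ge0//.
by rewrite -exprD; case: P i => [[]//|P] i /=; rewrite subnK// -ltnS.
Qed.

(** The weight b ^ P is replaced by the constant a ^ P, so that the cancellation in
    the sum of t can be used; the total of |t| pays for the variation of the
    weight. *)
Lemma weighted_sum (I : finType) (a h : R) (b t r : I -> I -> R) P :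
  0 <= a -> 0 <= h -> (forall i j, 0 <= b i j) -> (forall i j, `|b i j - a| <= h) ->
  \sum_i \sum_j b i j ^+ P * r i j <=
  a ^+ P * `|\sum_i \sum_j t i j| + P%:R * h * (a + h) ^+ P.-1 * (\sum_i \sum_j `|t i j|)
  + (a + h) ^+ P * \sum_i \sum_j `|r i j - t i j|.
Proof.
move=> a0 h0 b0 hb.
have bh i j : b i j <= a + h.
  by have := hb i j; rewrite ler_norml => /andP[_]; rewrite lerBlDr addrC.
apply: le_trans (_ : \sum_i \sum_j (a ^+ P * t i j + P%:R * h * (a + h) ^+ P.-1 * `|t i j| +
    (a + h) ^+ P * `|r i j - t i j|) <= _).
  apply: ler_sum => i _; apply: ler_sum => j _.
  have -> : b i j ^+ P * r i j = a ^+ P * t i j + (b i j ^+ P - a ^+ P) * t i j +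
     b i j ^+ P * (r i j - t i j) by ring.
  apply: lerD; first apply: lerD => //.
    apply: le_trans (ler_norm _) _; rewrite normrM ler_wpM2r//.
    apply: le_trans (pow_diff (c := a + h) P _ _) _; rewrite ?b0 ?bh ?a0 ?lerDl//.
    by rewrite ler_wpM2r ?exprn_ge0 ?addr_ge0// ler_wpM2l.
  apply: le_trans (ler_norm _) _; rewrite normrM normrX ger0_norm// ler_wpM2r//.
  by rewrite lerXn2r ?nnegrE ?addr_ge0.
rewrite (eq_bigr (fun i => a ^+ P * (\sum_j t i j) + P%:R * h * (a + h) ^+ P.-1 * (\sum_j `|t i j|) +
    (a + h) ^+ P * \sum_j `|r i j - t i j|)); last first.
  by move=> i _; rewrite !big_split /= -!mulr_sumr.
rewrite !big_split /= -!mulr_sumr !lerD2r.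
by rewrite ler_wpM2l ?exprn_ge0// ler_norm.
Qed.

Variables (n : nat) (C : finType) (U V : C -> finType)
  (sp : forall c, splitting n (U c) (V c)).
Local Notation M := 'M[Cx]_n.
Local Notation perms := {dffun forall c, {perm U c}}.
Local Notation signs := {ffun 'I_n -> bool}.
Implicit Types (sg : perms) (c : C) (w : seq (M * M)).
Local Notation good_factors c w := (forall p, p \in w -> good_factor (sp c) p).

(** By Cauchy--Schwarz.  The blocks (u, u), each counted #|U| times, add up to the
    pinching.  The blocks (u, v) add up to A, of norm at most n^(1/2); spread over
    #|U|^2 blocks, this is smaller than the trivial bound by #|U|^(-1/2) <= N^(-1/2). *)
Lemma sum_cut_bound c (N : nat) (A : M) : (0 < N)%N -> (N <= #|U c|)%N -> contr A ->
  \sum_(u : U c) \sum_(v : U c) cut_bound sp u v A <=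
   2 * (#|U c|%:R * n%:R) * (nrm (pin (spi (sp c)) A) + (Num.sqrt N%:R)^-1).
Proof.
move=> N0 NU cA.
pose x : R := Num.sqrt #|U c|%:R; pose y : R := Num.sqrt #|V c|%:R.
have x0 : 0 <= x by exact: sqrtr_ge0.
have y0 : 0 <= y by exact: sqrtr_ge0.
have xx : #|U c|%:R = x ^+ 2 by rewrite sqr_sqrtr.
have yy : #|V c|%:R = y ^+ 2 by rewrite sqr_sqrtr.
have nE : n%:R = x ^+ 2 * y ^+ 2 by rewrite -xx -yy -natrM -(card_split (sp c)).
have sn : Num.sqrt n%:R = x * y :> R.
  by rewrite nE -exprMn sqrtr_sqr ger0_norm ?mulr_ge0.
have xr := sqrt_le_div N0 NU; rewrite xx sqrtr_sqr ger0_norm// in xr.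
pose S1 : R := \sum_u fro (Q (sp c) u *m A *m Q (sp c) u).
pose S2 : R := \sum_u \sum_v fro (Q (sp c) u *m A *m Q (sp c) v).
have -> : \sum_(u : U c) \sum_(v : U c) cut_bound sp u v A = 2 * y * (#|U c|%:R * S1 + S2).
  rewrite /S1 /S2 mulr_sumr -big_split /= mulr_sumr; apply: eq_bigr => u _.
  rewrite /cut_bound -mulr_sumr; congr (_ * _).
  by rewrite big_split /= sumr_const -[X in X + _ = _]mulr_natl.
have h1 : S1 <= x * (nrm (pin (spi (sp c)) A) * (x * y)).
  rewrite -sn -nrmE -[leLHS]ger0_norm; last by apply: sumr_ge0 => u _; exact: fro_ge0.
  rewrite -sqrtr_sqr /fro -sqrtrM ?ler0n// ler_wsqrtr//.
  apply: le_trans (sum_sqr_le _) _; rewrite ler_wpM2l// -hs_pin_pi.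
  by apply: ler_sum => u _; rewrite fro_sqr.
have h2 : S2 <= x ^+ 2 * (x * y).
  rewrite -xx -sn; apply: fro_sum_le => //.
  by rewrite hs_sumQQ; apply: hs_contr_le.
rewrite xx nE; set rho := (Num.sqrt N%:R)^-1 in xr *; set q := nrm _ in h1 *.
have -> : 2 * (x ^+ 2 * (x ^+ 2 * y ^+ 2)) * (q + rho) =
    2 * y * (x ^+ 2 * (x * (q * (x * y))) + x ^+ 2 * y * (x ^+ 2 * rho)) by ring.
rewrite ler_wpM2l ?mulr_ge0//; apply: lerD; first by rewrite ler_wpM2l ?sqr_ge0.
apply: le_trans h2 _; have -> : x ^+ 2 * (x * y) = x ^+ 2 * y * x by ring.
by rewrite ler_wpM2l ?mulr_ge0 ?sqr_ge0.
Qed.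

Lemma fro_swp_sub c (u v : U c) : fro (T (sp c) u v - 1%:M) <= 4 * Num.sqrt #|V c|%:R.
Proof.
rewrite -(slice_swap_sub1 R (sp c) u v) mulmxDr; apply: le_trans (fro_add _ _) _.
have h (z : U c) : fro ((T (sp c) u v - 1%:M) *m Q (sp c) z) <= 2 * Num.sqrt #|V c|%:R.
  rewrite mulmxBl mul1mx; apply: le_trans (fro_sub _ _) _.
  rewrite mulr_natl mulr2n -(fro_Q R (sp c) z) lerD2r.
  exact: fro_contr _ (contr_T (sp c) u v).
have -> : 4 = 2 + 2 :> R by rewrite -natrD.
by rewrite mulrDl lerD.
Qed.

(** T - 1 lives on two slices, of norm #|V|^(1/2) each. *)
Lemma fro_mono_swap c (u v : U c) sg w : good_factors c w ->
  fro (mono sp (swap u v sg) c w - mono sp sg c w) <= (8 * size w)%:R * Num.sqrt #|V c|%:R.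
Proof.
elim: w => [|p w IH] g /=; first by rewrite subrr fro0 mulr_ge0 ?sqrtr_ge0.
have [d1 c1 c2 b2] := g p (mem_head _ _).
have gw : good_factors c w by move=> q qw; apply: g; rewrite in_cons qw orbT.
set M' := mono sp (swap u v sg) c w; set M0 := mono sp sg c w.
have cM' : contr M' by apply: contr_mono.
set t := T (sp c) u v; set x := conj_lift sp (sg c) p.2.
have cx : contr x by apply: contr_conj_lift.
have ct : contr t := contr_T (sp c) u v.
have := @swap_telescope Cx n 1%:M 1%:M p.1 t x M' M0 1%:M.
rewrite !mul1mx !mulmx1 => e.
rewrite /factor conj_lift_swap -/t -/x e.
have h0 := fro_swp_sub u v; rewrite -/t in h0.
apply: le_trans (fro_add _ _) _; rewrite mulnS natrD mulrDl; apply: le_trans (lerD _ (fro_add _ _)) _.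
  by apply: le_trans (fro_contr_r _ (contrM (contrM cx ct) cM')) (fro_contr _ c1).
rewrite addrA; apply: lerD.
  have -> : 8 = 4 + 4 :> R by rewrite -natrD.
  rewrite mulrDl; apply: (lerD h0).
  by apply: le_trans (fro_contr_r _ cM') (le_trans (fro_contr _ (contrM c1 cx)) h0).
by apply: le_trans (fro_contr _ (contrM c1 cx)) (IH gw).
Qed.

Lemma fro_letter_swap c (u v : U c) sg (l : C * seq (M * M)) : good_factors l.1 l.2 ->
  fro (letter sp (swap u v sg) l - letter sp sg l) <= (8 * size l.2)%:R * Num.sqrt #|V c|%:R.
Proof.
case: l => c' w g /=; have [e|ne] := eqVneq c c'; last first.
  by rewrite letter_swap_out// subrr fro0 mulr_ge0 ?sqrtr_ge0.
rewrite -e in g *.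
set D := mono sp (swap u v sg) c w - mono sp sg c w.
have -> : letter sp (swap u v sg) (c, w) - letter sp sg (c, w) = ((2^-1)%:C)%C *: (D - Delta D).
  rewrite /letter /half_center /= -scalerBr; congr (_ *: _).
  by rewrite /D !Delta_pin pinB sub_sub_swap.
have hD : fro D <= (8 * size w)%:R * Num.sqrt #|V c|%:R := fro_mono_swap u v sg g.
rewrite froZ ger0_norm ?invr_ge0//.
have := fro_sub D (Delta D); rewrite Delta_pin; have := fro_pin id D.
move: (fro _) (fro _) (fro _) (_ * Num.sqrt _) hD => a b d z; lra.
Qed.

Lemma fro_word_val_swap c (u v : U c) sg (ws : seq (C * seq (M * M))) : good_word sp ws ->
  fro (word_val sp (swap u v sg) ws - word_val sp sg ws) <=
  (8 * \sum_(l <- ws) size l.2)%:R * Num.sqrt #|V c|%:R.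
Proof.
elim: ws => [|l ws IH] g /=; first by rewrite subrr fro0 mulr_ge0 ?sqrtr_ge0.
have [gl gw] := good_word_cons g.
have := @mul_telescope Cx n 1%:M 1%:M (letter sp sg l) (word_val sp sg ws) (letter sp (swap u v sg) l) (word_val sp (swap u v sg) ws).
rewrite !mul1mx => ->; rewrite big_cons mulnDr natrD mulrDl.
apply: le_trans (fro_add _ _) _; apply: lerD.
  by apply: le_trans (fro_contr_r _ (contr_word_val _ gw)) (fro_letter_swap u v sg gl).
have cl : contr (letter sp sg l) by apply: contr_half_center; apply: contr_mono.
by apply: le_trans (fro_contr _ cl) (IH gw).
Qed.

End Averaging.

Section Recursion.
Variable R : realType.
Local Notation Cx := R[i]%C.
Local Notation Q := (@slice R _ _ _).
Local Notation T := (@slice_swap R _ _ _).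

(** This is the quantity e of the recursion; it is small by induction, as it involves
    only pieces of shorter words. *)
Definition cut_error n (C : finType) (U V : C -> finType) (sp : forall c, splitting n (U c) (V c))
    (c : C) (ws : seq (C * seq ('M[Cx]_n * 'M[Cx]_n))) (sg : {dffun forall c, {perm U c}}) : R :=
  (\sum_(e : {ffun 'I_n -> bool}) \sum_(q <- cuts c e ws)
     nrm (pin (spi (sp c)) (word_val sp sg q.1 *m mono sp sg c q.2))) / #|{ffun 'I_n -> bool}|%:R.

Section Fixed.
Variables (n : nat) (C : finType) (U V : C -> finType)
  (sp : forall c, splitting n (U c) (V c)).
Local Notation M := 'M[Cx]_n.
Local Notation perms := {dffun forall c, {perm U c}}.
Local Notation signs := {ffun 'I_n -> bool}.

Lemma sum_Q c : \sum_u Q (sp c) u = 1%:M :> M.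
Proof.
apply/matrixP => a b; rewrite summxE (bigD1 (spi (sp c) a))//= big1 ?addr0.
  by rewrite !mxE eqxx andbT.
by move=> u ua; rewrite mxE eq_sym [_ == u]eq_sym (negPf ua) andbF.
Qed.

Lemma card_signs_gt0 : 0 < #|signs|%:R :> R.
Proof. by rewrite ltr0n; apply/card_gt0P; exists [ffun=> true]. Qed.

Lemma word_val_diff_le c (u v : U c) sg ws (H : M) : good_word sp ws -> contr H ->
  `|ip H (Q (sp c) u *m (word_val sp (swap u v sg) ws - word_val sp sg ws))| <=
  (\sum_(e : signs) \sum_(q <- cuts c e ws) cut_bound sp u v (word_val sp sg q.1 *m mono sp sg c q.2)) / #|signs|%:R.
Proof.
move=> g cH; rewrite ler_pdivlMr ?card_signs_gt0// mulrC.
have := word_val_diff u v sg 1%:M g cH; rewrite mulmx1 => h; apply: le_trans h _.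
by apply: ler_sum => e _; apply: ler_sum => q _; rewrite mul1mx.
Qed.

Lemma cuts_good_val c e (ws : seq (C * seq (M * M))) q : good_word sp ws -> q \in cuts c e ws -> good_word sp q.1.
Proof.
move=> g /(cutsP g)[w [post [h _ _]]] l lq; apply: g.
by rewrite h mem_cat lq.
Qed.

Lemma sum_cut_errors c (N : nat) sg (ws : seq (C * seq (M * M))) (Lm k : nat) :
  (0 < N)%N -> (N <= #|U c|)%N -> good_word sp ws -> (size ws <= k)%N ->
  (forall l, l \in ws -> (size l.2 <= Lm)%N) ->
  \sum_(u : U c) \sum_(v : U c) ((\sum_(e : signs) \sum_(q <- cuts c e ws)
     cut_bound sp u v (word_val sp sg q.1 *m mono sp sg c q.2)) / #|signs|%:R) <=
  2 * (#|U c|%:R * n%:R) * (cut_error sp c ws sg + (4 * Lm * k)%:R / Num.sqrt N%:R).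
Proof.
move=> N0 NU g sk sL.
have e0 := card_signs_gt0.
set mn := _ * n%:R; have mn0 : 0 <= mn by rewrite mulr_ge0.
have r0 : 0 <= (Num.sqrt N%:R)^-1 :> R by rewrite invr_ge0 sqrtr_ge0.
under eq_bigr do rewrite -mulr_suml.
rewrite -mulr_suml ler_pdivrMr//.
rewrite /cut_error; set S := \sum_(e : signs) _.
have -> : 2 * mn * (S / #|signs|%:R + (4 * Lm * k)%:R / Num.sqrt N%:R) * #|signs|%:R =
   2 * mn * (S + #|signs|%:R * ((4 * Lm * k)%:R / Num.sqrt N%:R)).
  move: (_%:R / Num.sqrt _) (#|signs|%:R) e0 => a b b0.
  by rewrite -mulrA; congr (_ * _); rewrite mulrDl divfK ?gt_eqF// (mulrC a).
rewrite (eq_bigr (fun u => \sum_e \sum_(v : U c) \sum_(q <- cuts c e ws)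
     cut_bound sp u v (word_val sp sg q.1 *m mono sp sg c q.2))); last first.
  by move=> u _; rewrite exchange_big.
rewrite exchange_big /=.
have -> : 2 * mn * (S + #|signs|%:R * ((4 * Lm * k)%:R / Num.sqrt N%:R)) =
    \sum_(e : signs) 2 * mn * (\sum_(q <- cuts c e ws)
      nrm (pin (spi (sp c)) (word_val sp sg q.1 *m mono sp sg c q.2)) + (4 * Lm * k)%:R / Num.sqrt N%:R).
  by rewrite -mulr_sumr big_split /= sumr_const -[X in _ = _ * (_ + X)]mulr_natl.
apply: ler_sum => e _.
rewrite (eq_bigr (fun u => \sum_(q <- cuts c e ws) \sum_(v : U c)
     cut_bound sp u v (word_val sp sg q.1 *m mono sp sg c q.2))); last first.
  by move=> u _; rewrite exchange_big.
rewrite exchange_big /=.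
apply: le_trans (_ : \sum_(q <- cuts c e ws) 2 * mn *
    (nrm (pin (spi (sp c)) (word_val sp sg q.1 *m mono sp sg c q.2)) + (Num.sqrt N%:R)^-1) <= _).
  rewrite big_seq_cond [X in _ <= X]big_seq_cond; apply: ler_sum => q /andP[qc _].
  rewrite /mn; apply: (sum_cut_bound sp N0 NU); apply: contrM.
    by apply: contr_word_val; apply: cuts_good_val qc.
  have [w [post [h1 h2 h3]]] := cutsP g qc.
  exact: contr_mono.
rewrite -mulr_sumr ler_wpM2l ?mulr_ge0// big_split /= lerD2l.
rewrite big_const_seq count_predT iter_addr_0 -[leLHS]mulr_natl ler_wpM2r// ler_nat.
apply: leq_trans (size_cuts c e sL) _.
by rewrite leq_mul2l sk orbT.
Qed.

End Fixed.

End Recursion.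

(** * Recursive inequality for the moments *)

Section Moments.
Variable R : realType.
Local Notation Cx := R[i]%C.
Local Notation Q := (@slice R _ _ _).
Local Notation T := (@slice_swap R _ _ _).

(** Collects the three terms of [weighted_sum] under the common factor
    (a + rho) ^ P.-1 * (rho + e). *)
Lemma combine_bounds (P : nat) (a rho e K1 k0 q mn S0 S1 S2 : R) : (0 < P)%N ->
  0 <= a <= 1 -> 0 <= rho <= 1 -> 0 <= e -> 0 <= K1 -> 0 <= k0 -> 0 <= q -> 0 <= mn ->
  S0 <= K1 * mn * rho -> S1 <= K1 * mn ->
  S2 <= K1 * (1 + k0) * mn * rho + 2 * mn * (e + q * rho) ->
  a ^+ P * S0 + P%:R * (2 * k0 * rho) * (a + 2 * k0 * rho) ^+ P.-1 * S1 +
     (a + 2 * k0 * rho) ^+ P * S2 <=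
  (K1 + 2 * P%:R * k0 * (1 + 2 * k0) ^+ P.-1 * K1 + 2 * (1 + 2 * k0) ^+ P * (K1 * (1 + k0) + 2 + 2 * q))
    * mn * ((a + rho) ^+ P.-1 * (rho + e)).
Proof.
move=> P0 /andP[a0 a1] /andP[r0 r1] e0 K10 k00 q0 mn0 h0 h1 h2.
set B := (a + rho) ^+ P.-1; set k1 := 1 + 2 * k0.
have k1_1 : 1 <= k1 by rewrite lerDl mulr_ge0.
have k10 : 0 <= k1 by apply: le_trans k1_1.
have B0 : 0 <= B by rewrite exprn_ge0 ?addr_ge0.
have ak : a + 2 * k0 * rho <= k1 * (a + rho) by rewrite /k1; nra.
have ak0 : 0 <= a + 2 * k0 * rho by rewrite addr_ge0// mulr_ge0// mulr_ge0.
have b1 : (a + 2 * k0 * rho) ^+ P.-1 <= k1 ^+ P.-1 * B.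
  by rewrite -exprMn lerXn2r// nnegrE// mulr_ge0// addr_ge0.
have b2 : (a + 2 * k0 * rho) ^+ P <= 2 * k1 ^+ P * B.
  apply: le_trans (_ : (k1 * (a + rho)) ^+ P <= _).
    by rewrite lerXn2r// nnegrE// mulr_ge0// addr_ge0.
  rewrite exprMn (_ : (a + rho) ^+ P = (a + rho) * B); last by rewrite -exprS prednK.
  have -> : 2 * k1 ^+ P * B = k1 ^+ P * (2 * B) by ring.
  rewrite ler_wpM2l ?exprn_ge0// ler_wpM2r//; lra.
have b3 : a ^+ P <= B.
  rewrite -(prednK P0) exprS; apply: le_trans (_ : 1 * a ^+ P.-1 <= _).
    by rewrite ler_wpM2r ?exprn_ge0.
  by rewrite mul1r lerXn2r ?nnegrE ?addr_ge0// lerDl.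
have c1 : a ^+ P * S0 <= B * (K1 * mn * rho).
  apply: le_trans (_ : a ^+ P * (K1 * mn * rho) <= _); first by rewrite ler_wpM2l ?exprn_ge0.
  by rewrite ler_wpM2r ?mulr_ge0.
have c2 : P%:R * (2 * k0 * rho) * (a + 2 * k0 * rho) ^+ P.-1 * S1 <=
    P%:R * (2 * k0 * rho) * (k1 ^+ P.-1 * B) * (K1 * mn).
  apply: le_trans (_ : P%:R * (2 * k0 * rho) * (a + 2 * k0 * rho) ^+ P.-1 * (K1 * mn) <= _).
    by rewrite ler_wpM2l// ?mulr_ge0// exprn_ge0.
  by rewrite ler_wpM2r ?mulr_ge0// ler_wpM2l ?mulr_ge0.
have S20 : 0 <= K1 * (1 + k0) * mn * rho + 2 * mn * (e + q * rho).
  by rewrite addr_ge0 ?mulr_ge0 ?addr_ge0 ?mulr_ge0.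
have c3 : (a + 2 * k0 * rho) ^+ P * S2 <=
    2 * k1 ^+ P * B * (K1 * (1 + k0) * mn * rho + 2 * mn * (e + q * rho)).
  apply: le_trans (ler_wpM2l _ h2) _; first by rewrite exprn_ge0.
  by rewrite ler_wpM2r.
apply: le_trans (lerD (lerD c1 c2) c3) _.
set kP := k1 ^+ P; set kp := k1 ^+ P.-1; have kP0 : 0 <= kP by rewrite exprn_ge0.
have kp0 : 0 <= kp by rewrite exprn_ge0.
have p0 : 0 <= P%:R :> R by [].
have z1 : 0 <= B * K1 * mn * e by rewrite !mulr_ge0.
have z2 : 0 <= P%:R * k0 * kp * B * K1 * mn * e by rewrite !mulr_ge0.
have z3 : 0 <= kP * B * K1 * (1 + k0) * mn * e by rewrite !mulr_ge0// addr_ge0.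
have z4 : 0 <= kP * B * mn * rho by rewrite !mulr_ge0.
have z5 : 0 <= kP * B * mn * q * e by rewrite !mulr_ge0.
rewrite -subr_ge0.
have -> : (K1 + 2 * P%:R * k0 * kp * K1 + 2 * kP * (K1 * (1 + k0) + 2 + 2 * q)) * mn * (B * (rho + e)) -
   (B * (K1 * mn * rho) + P%:R * (2 * k0 * rho) * (kp * B) * (K1 * mn) +
   2 * kP * B * (K1 * (1 + k0) * mn * rho + 2 * mn * (e + q * rho))) =
   B * K1 * mn * e + 2 * (P%:R * k0 * kp * B * K1 * mn * e) +
   2 * (kP * B * K1 * (1 + k0) * mn * e) + 4 * (kP * B * mn * rho) + 4 * (kP * B * mn * q * e) by ring.
lra.
Qed.

Lemma sqr_diff_le (a b d : R) : 0 <= a -> a <= 1 -> 0 <= b -> b <= 1 ->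
  `|a - b| <= d -> `|a ^+ 2 - b ^+ 2| <= 2 * d.
Proof.
move=> a0 a1 b0 b1 d1; rewrite subr_sqr normrM mulrC.
by apply: ler_pM => //; rewrite ger0_norm ?addr_ge0//; lra.
Qed.

Lemma nrm_diff n (A B : 'M[Cx]_n) : `|nrm A - nrm B| <= nrm (A - B).
Proof.
have s0 : 0 <= (Num.sqrt n%:R)^-1 :> R by rewrite invr_ge0 sqrtr_ge0.
rewrite /nrm -mulrBl normrM (ger0_norm s0) ler_wpM2r//.
have e : fro (B - A) = fro (A - B) by rewrite -froN opprB.
have := fro_dist B A; have := fro_dist A B; rewrite e.
by move: (fro _) (fro _) (fro _) => a b d h1 h2; rewrite ler_norml; apply/andP; split; lra.
Qed.

(** For one family of permutations, the average over the transpositions (u v).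
    [trace_estimate_unif] provides the frozen pairings, [word_val_diff] the cost of
    freezing W, and [fro_word_val_swap] the cost of freezing Delta_s Z and shows that
    the weights F ^ P are nearly constant; [weighted_sum] combines them. *)
Lemma pathwise (L k P : nat) : (0 < P)%N -> exists K : R, 0 <= K /\
  forall n (C : finType) (U V : C -> finType) (sp : forall c, splitting n (U c) (V c))
    (Lb : finType) (c : C) (fU : U c -> Lb) (N : nat)
    (w : seq ('M[Cx]_n * 'M[Cx]_n)) (ws : seq (C * seq ('M[Cx]_n * 'M[Cx]_n)))
    (sg : {dffun forall c, {perm U c}}),
  let f a := fU (spi (sp c) a) in
  let Z sg' := word_val sp sg' ((c, w) :: ws) in
  let F sg' := nrm (pin f (Z sg')) ^+ 2 in
  let rho := (Num.sqrt N%:R)^-1 in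
  (0 < n)%N -> (0 < N)%N -> (N <= #|U c|)%N ->
  (forall t, (#|[pred u | fU u == t]| * N <= #|U c|)%N) ->
  (size w <= L)%N -> (size ws <= k)%N -> (forall l, l \in ws -> (size l.2 <= L)%N) ->
  good_word sp ((c, w) :: ws) ->
  \sum_(u : U c) \sum_(v : U c) F (swap u v sg) ^+ P *
     ip (pin f (Z (swap u v sg))) (letter sp (swap u v sg) (c, w) *m Q (sp c) u *m word_val sp (swap u v sg) ws)
  <= K * (#|U c|%:R * n%:R) * ((F sg + rho) ^+ P.-1 * (rho + cut_error sp c ws sg)).
Proof.
move=> P0; have [K1 [K10 H]] := trace_estimate_unif R L.
pose k0 : R := (8 * (L * k.+1))%:R.
pose q : R := (4 * L * k)%:R.
exists (K1 + 2 * P%:R * k0 * (1 + 2 * k0) ^+ P.-1 * K1 + 2 * (1 + 2 * k0) ^+ P * (K1 * (1 + k0) + 2 + 2 * q)).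
split.
  have k00 : 0 <= k0 by exact: ler0n.
  have q0 : 0 <= q by exact: ler0n.
  have k1 : 0 <= 1 + k0 by rewrite addr_ge0.
  have k2 : 0 <= 1 + 2 * k0 by rewrite addr_ge0// mulr_ge0.
  apply: addr_ge0; first by apply: addr_ge0 => //; rewrite !mulr_ge0 ?exprn_ge0.
  apply: mulr_ge0; first by rewrite mulr_ge0 ?exprn_ge0.
  by apply: addr_ge0; [apply: addr_ge0 => //|]; rewrite mulr_ge0.
move=> n C U V sp Lb c fU N w ws sg f Z F rho n0 N0 NU hf sw sws sl g.
have [gw gws] := good_word_cons g; rewrite /= in gw.
have e0 : 0 <= cut_error sp c ws sg.
  rewrite divr_ge0//; apply: sumr_ge0 => e _; apply: sumr_ge0 => p _; exact: nrm_ge0.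
have cZ sg' : contr (Z sg') by apply: contr_word_val.
have cG sg' : contr (pin f (Z sg')) by apply: contr_pin.
have kb : (8 * \sum_(l <- (c, w) :: ws) size l.2)%:R <= k0.
  rewrite ler_nat leq_mul2l /= big_cons mulnS leq_add//.
  apply: leq_trans (_ : \sum_(l <- ws) L <= _)%N.
    by rewrite big_seq [leqRHS]big_seq; apply: leq_sum => l /sl.
  by rewrite big_const_seq count_predT iter_addn_0 leq_mul2l sws orbT.
have hG (u v : U c) : fro (pin f (Z (swap u v sg)) - pin f (Z sg)) <= k0 * Num.sqrt #|V c|%:R.
  rewrite -pinB; apply: le_trans (fro_pin _ _) _.
  apply: le_trans (fro_word_val_swap u v sg g) _.
  by rewrite ler_wpM2r ?sqrtr_ge0.
have := H (size w) sw n (U c) (V c) (sp c) Lb fU N (conj_factors sp sg c w) (word_val sp sg ws) (pin f (Z sg))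
  (fun u v => word_val sp (swap u v sg) ws) (fun u v => pin f (Z (swap u v sg))) k0
  (fun u v => (\sum_(e : {ffun 'I_n -> bool}) \sum_(q <- cuts c e ws) cut_bound sp u v (word_val sp sg q.1 *m mono sp sg c q.2)) / #|{ffun 'I_n -> bool}|%:R)
  N0 NU hf.
case.
- by rewrite size_map.
- exact: conj_factors_good.
- exact: contr_word_val.
- exact: cG.
- by move=> u v; apply: contr_word_val.
- by move=> u v; apply: cG.
- exact: pin_id.
- by move=> u v; apply: pin_id.
- exact: ler0n.
- exact: hG.
- by move=> u v A cA; apply: word_val_diff_le.
move=> t [t1 t2 t3].
have rho01 : 0 <= rho <= 1.
  rewrite invr_ge0 sqrtr_ge0 /= invf_le1 ?sqrtr_gt0 ?ltr0n//.
  by rewrite -[leLHS]sqrtr1 ler_wsqrtr// ler1n.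
have F01 sg' : 0 <= F sg' <= 1.
  by rewrite sqr_ge0 /= exprn_ile1 ?nrm_ge0// nrm_contr.
have hF (u v : U c) : `|F (swap u v sg) - F sg| <= 2 * k0 * rho.
  have d1 : `|nrm (pin f (Z (swap u v sg))) - nrm (pin f (Z sg))| <= k0 * rho.
    apply: le_trans (nrm_diff _ _) _.
    rewrite {1}/nrm ler_pdivrMr ?sqrtr_gt0 ?ltr0n//; apply: le_trans (hG u v) _.
    rewrite -mulrA ler_wpM2l ?ler0n// (card_split (sp c)) natrM sqrtrM// mulrA.
    rewrite ler_peMl ?sqrtr_ge0// mulrC ler_pdivlMr ?mul1r ?sqrtr_gt0 ?ltr0n//.
    by rewrite ler_wsqrtr// ler_nat.
  rewrite -(mulrA 2).
  exact: (sqr_diff_le (nrm_ge0 _) (nrm_contr (cG _)) (nrm_ge0 _) (nrm_contr (cG _)) d1).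
have E (u v : U c) : letter sp (swap u v sg) (c, w) = half_center (T (sp c) u v *m twisted_mono (sp c) u v (conj_factors sp sg c w) *m T (sp c) u v).
  by rewrite /letter mono_swap.
apply: le_trans (@weighted_sum R (U c) (F sg) (2 * k0 * rho) (fun u v => F (swap u v sg)) t _ P _ _ _ _) _.
- by case/andP: (F01 sg).
- by rewrite !mulr_ge0//; case/andP: rho01.
- by move=> u v; case/andP: (F01 (swap u v sg)).
- exact: hF.
have m0 : 0 <= #|U c|%:R * n%:R :> R by rewrite mulr_ge0.
apply: combine_bounds => //.
apply: le_trans (_ : K1 * (1 + k0) * (#|U c|%:R * n%:R) * rho + _ <= _); last first.
  by rewrite lerD2l; apply: (sum_cut_errors sg N0 NU gws sws sl).
apply: le_trans t1; apply: ler_sum => u _; apply: ler_sum => v _.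
by rewrite E.
Qed.

End Moments.

Section RecursionInequality.
Variable R : realType.
Local Notation Cx := R[i]%C.
Local Notation Q := (@slice R _ _ _).

Lemma sum_swap (C : finType) (U : C -> finType) c
    (H : {dffun forall c, {perm U c}} -> U c -> U c -> R) :
  \sum_sg \sum_u \sum_v H sg u v = \sum_sg \sum_u \sum_v H (swap u v sg) u v.
Proof.
rewrite exchange_big [RHS]exchange_big; apply: eq_bigr => u _.
rewrite exchange_big [RHS]exchange_big; apply: eq_bigr => v _.
by rewrite (reindex_inj (inv_inj (swapK u v))).
Qed.

(** n F is the sum over u of the pairings with the letter cut at the slice u.
    By invariance under [swap], each family may be replaced by its transposed version,
    averaged over v, and [pathwise] applies. *)
Lemma recursion_ineq (L k P : nat) : (0 < P)%N -> exists K : R, 0 <= K /\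
  forall n (C : finType) (U V : C -> finType) (sp : forall c, splitting n (U c) (V c))
    (Lb : finType) (c : C) (fU : U c -> Lb) (N : nat)
    (w : seq ('M[Cx]_n * 'M[Cx]_n)) (ws : seq (C * seq ('M[Cx]_n * 'M[Cx]_n))),
  let f a := fU (spi (sp c) a) in
  let F sg := nrm (pin f (word_val sp sg ((c, w) :: ws))) ^+ 2 in
  let rho := (Num.sqrt N%:R)^-1 in
  (0 < n)%N -> (0 < N)%N -> (N <= #|U c|)%N ->
  (forall t, (#|[pred u | fU u == t]| * N <= #|U c|)%N) ->
  (size w <= L)%N -> (size ws <= k)%N -> (forall l, l \in ws -> (size l.2 <= L)%N) ->
  good_word sp ((c, w) :: ws) ->
  \sum_sg F sg ^+ P.+1 <= K * \sum_sg (F sg + rho) ^+ P.-1 * (rho + cut_error sp c ws sg).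
Proof.
move=> P0; have [K [K0 H]] := pathwise R L k P0; exists K; split=> //.
move=> n C U V sp Lb c fU N w ws f F rho n0 N0 NU hf sw sws sl g.
have m0 : (0 < #|U c|)%N by apply: leq_trans NU.
have mn0 : 0 < #|U c|%:R * n%:R :> R by rewrite mulr_gt0 ?ltr0n.
rewrite -(ler_pM2l mn0).
pose tr (u : U c) sg := ip (pin f (word_val sp sg ((c, w) :: ws)))
   (letter sp sg (c, w) *m Q (sp c) u *m word_val sp sg ws).
have e1 sg : n%:R * F sg = \sum_u tr u sg.
  have -> : n%:R * F sg = hs (pin f (word_val sp sg ((c, w) :: ws))).
    by rewrite /F expr_div_n fro_sqr sqr_sqrtr ?ler0n// mulrC divfK// pnatr_eq0 -lt0n.
  have <- : ip (pin f (word_val sp sg ((c, w) :: ws))) (word_val sp sg ((c, w) :: ws)) = hs (pin f (word_val sp sg ((c, w) :: ws))).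
    by rewrite ip_pin.
  rewrite /tr -ip_sumr; congr (ip _ _).
  by rewrite -mulmx_suml -mulmx_sumr sum_Q mulmx1.
have e2 : #|U c|%:R * n%:R * \sum_sg F sg ^+ P.+1 =
    \sum_sg \sum_(u : U c) \sum_(v : U c) F (swap u v sg) ^+ P * tr u (swap u v sg).
  rewrite mulr_sumr.
  transitivity (\sum_sg \sum_(u : U c) \sum_(v : U c) F sg ^+ P * tr u sg).
    apply: eq_bigr => sg _.
    have -> : #|U c|%:R * n%:R * F sg ^+ P.+1 = #|U c|%:R * (F sg ^+ P * (n%:R * F sg)).
      by rewrite exprSr; ring.
    rewrite e1 mulr_sumr mulr_sumr.
    by apply: eq_bigr => u _; rewrite sumr_const mulr_natl.
  exact: (sum_swap (fun sg u _ => F sg ^+ P * tr u sg)).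
rewrite e2 mulrCA mulrA mulr_sumr; apply: ler_sum => sg _.
exact: (H n C U V sp Lb c fU N w ws sg).
Qed.

(** Where t <= d F^2 with d small, F + t is at most 2 F, and the term on the right is
    at most half of the one on the left.  Elsewhere F^2 <= t / d, and the term on the
    right is bounded by t ^ q.+1. *)
Lemma young (C B : R) (q : nat) : 0 <= C -> 0 <= B -> exists C' : R, 0 <= C' /\
  forall (I : finType) (F t : I -> R),
  (forall i, 0 <= F i <= 1) -> (forall i, 0 <= t i <= B) ->
  \sum_i F i ^+ (2 * q.+1) <= C * \sum_i (F i + t i) ^+ (2 * q) * t i ->
  \sum_i F i ^+ (2 * q.+1) <= C' * \sum_i t i ^+ q.+1.
Proof.
move=> C0 B0.
(* Chosen so that C * (2 F) ^ (2 q) * (d F^2) is at most half of F ^ (2 q + 2). *)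
pose d := (2 * C * 4 ^+ q + 1)^-1.
have d0 : 0 < 2 * C * 4 ^+ q + 1.
  by rewrite ltr_wpDl// mulr_ge0 ?exprn_ge0// mulr_ge0.
pose D := 2 / d + 2 * B.
have dp : 0 < d by rewrite invr_gt0.
have D0 : 0 <= D by rewrite addr_ge0 ?divr_ge0 ?mulr_ge0// ltW.
exists (2 * C * D ^+ q); split; first by rewrite mulr_ge0 ?exprn_ge0// mulr_ge0.
move=> I F t F1 tB h.
have key i : C * ((F i + t i) ^+ (2 * q) * t i) <= 2^-1 * F i ^+ (2 * q.+1) + C * D ^+ q * t i ^+ q.+1.
  have /andP[F0 Fle] := F1 i; have /andP[t0 tle] := tB i.
  have [near|far] := lerP (t i) (d * F i ^+ 2).
    apply: le_trans (_ : 2^-1 * F i ^+ (2 * q.+1) <= _); last first.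
      by rewrite lerDl mulr_ge0 ?exprn_ge0// mulr_ge0 ?exprn_ge0.
    have d1 : d <= 1.
      rewrite invf_le1// lerDr mulr_ge0 ?exprn_ge0// mulr_ge0//.
    have tF : t i <= F i.
      apply: le_trans near _; apply: le_trans (_ : 1 * F i ^+ 2 <= _).
        by rewrite ler_wpM2r ?sqr_ge0.
      by rewrite mul1r expr2 ler_piMl.
    apply: le_trans (_ : C * ((2 * F i) ^+ (2 * q) * (d * F i ^+ 2)) <= _).
      rewrite ler_wpM2l// ler_pM ?exprn_ge0 ?addr_ge0//.
      by rewrite lerXn2r ?nnegrE ?addr_ge0 ?mulr_ge0//; lra.
    rewrite exprMn mulnS exprD exprM.
    have -> : C * ((2 ^+ 2) ^+ q * F i ^+ (2 * q) * (d * F i ^+ 2)) =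
       (C * 4 ^+ q * d) * (F i ^+ 2 * F i ^+ (2 * q)).
      by rewrite -natrX; ring.
    rewrite ler_wpM2r ?mulr_ge0 ?exprn_ge0//.
    rewrite ler_pdivrMr// ler_pdivlMl//; lra.
  apply: le_trans (_ : C * D ^+ q * t i ^+ q.+1 <= _); last first.
    by rewrite lerDr mulr_ge0 ?exprn_ge0// invr_ge0.
  rewrite -mulrA exprSr ler_wpM2l// mulrA ler_wpM2r// exprM -exprMn.
  rewrite lerXn2r ?nnegrE ?exprn_ge0 ?addr_ge0 ?mulr_ge0//.
  have F2 : F i ^+ 2 <= t i / d by rewrite ler_pdivlMr// mulrC ltW.
  have t2 : t i ^+ 2 <= B * t i by rewrite expr2 ler_wpM2r.
  apply: le_trans (_ : 2 * F i ^+ 2 + 2 * t i ^+ 2 <= _).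
    by have := sqr_ge0 (F i - t i); nra.
  rewrite /D; lra.
have h2 : C * \sum_i (F i + t i) ^+ (2 * q) * t i <= 2^-1 * \sum_i F i ^+ (2 * q.+1) + C * D ^+ q * \sum_i t i ^+ q.+1.
  by rewrite !mulr_sumr -big_split /=; apply: ler_sum => i _; exact: key.
move: (\sum_i F i ^+ _) (\sum_i _ * _) (\sum_i t i ^+ _) h h2 => a b z h h2.
have -> : 2 * C * D ^+ q * z = 2 * (C * D ^+ q * z) by ring.
move: (_ * z) h2 => zz h2; move: (C * b) h h2 => bb h h2; lra.
Qed.

(** Bernoulli's inequality in homogeneous form: a convex power lies above its
    tangent at a. *)
Lemma power_tangent (q : nat) (a x : R) : 0 <= a -> 0 <= x ->
  a ^+ q.+1 + q.+1%:R * a ^+ q * (x - a) <= x ^+ q.+1.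
Proof.
move=> a0 x0; elim: q => [|q IH]; first by rewrite !expr1 expr0; lra.
rewrite (exprSr x); apply: le_trans (ler_wpM2r x0 IH).
rewrite -subr_ge0 !exprSr -(natr1 q.+1) -(natr1 q).
have -> : (a ^+ q * a + (q%:R + 1) * a ^+ q * (x - a)) * x -
  (a ^+ q * a * a + (q%:R + 1 + 1) * (a ^+ q * a) * (x - a)) = (q%:R + 1) * a ^+ q * (x - a) ^+ 2.
  by ring.
apply: mulr_ge0; last exact: sqr_ge0.
by apply: mulr_ge0; rewrite ?exprn_ge0// addr_ge0.
Qed.

Lemma power_mean (I : finType) (q : nat) (x : I -> R) : (forall i, 0 <= x i) ->
  (0 < #|I|)%N ->
  ((\sum_i x i) / #|I|%:R) ^+ q.+1 <= (\sum_i x i ^+ q.+1) / #|I|%:R.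
Proof.
move=> x0 I0; set a := _ / _; have I0' : 0 < #|I|%:R :> R by rewrite ltr0n.
have a0 : 0 <= a by rewrite divr_ge0// sumr_ge0.
rewrite ler_pdivlMr//.
apply: le_trans (_ : \sum_i (a ^+ q.+1 + q.+1%:R * a ^+ q * (x i - a)) <= _); last first.
  by apply: ler_sum => i _; apply: power_tangent.
rewrite big_split /= -mulr_sumr big_split /= !sumr_const.
have -> : \sum_i x i + - a *+ #|I| = 0.
  by rewrite mulNrn -[a *+ _]mulr_natr divfK ?subrr// gt_eqF.
by rewrite mulr0 addr0 mulr_natr.
Qed.

Lemma power_sum_le (J : eqType) (s : seq J) (q : nat) (x : J -> R) : (forall i, 0 <= x i) ->
  (\sum_(i <- s) x i) ^+ q.+1 <= (size s)%:R ^+ q.+1 * \sum_(i <- s) x i ^+ q.+1.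
Proof.
move=> x0; case: s => [|j0 s']; first by rewrite !big_nil expr0n mulr0.
set s := j0 :: s'; have s0 : (0 < size s)%N by [].
have := @power_mean 'I_(size s) q (fun i => x (nth j0 s i)) (fun i => x0 _).
rewrite card_ord => /(_ s0).
rewrite -(big_mkord xpredT (fun i => x (nth j0 s i))) -(big_nth j0 xpredT x).
rewrite -(big_mkord xpredT (fun i => x (nth j0 s i) ^+ q.+1)) -(big_nth j0 xpredT (fun j => x j ^+ q.+1)).
have b0 : 0 <= \sum_(i <- s) x i ^+ q.+1.
  by apply: sumr_ge0 => i _; apply: exprn_ge0.
move: (\sum_(i <- s) x i) (\sum_(i <- s) x i ^+ q.+1) b0 => a b b0.
have p : 0 < (size s)%:R ^+ q.+1 :> R by rewrite exprn_gt0// ltr0n.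
rewrite expr_div_n ler_pdivrMr// => h; apply: le_trans h _.
rewrite mulrC ler_wpM2l ?exprn_ge0// ler_piMr// invf_le1 ?ltr0n//.
by rewrite ler1n.
Qed.

End RecursionInequality.

(** * Reduced words and the tensor product model *)

Section Reduced.
Variables (C : finType) (E : rel C).

(** For a word given as a sequence it suffices to compare each letter with the next
    one of the same colour: a separating letter before it also separates all later
    occurrences. *)
Fixpoint redseq (cs : seq C) : bool :=
  if cs is c :: cs' then
    ((c \in cs') ==> has (fun d => ~~ E c d) (take (index c cs') cs')) && redseq cs'
  else true.

Lemma redseq_prefix a b : redseq (a ++ b) -> redseq a.
Proof.
elim: a => [//|c a IH] /= /andP[h /IH ->]; rewrite andbT; apply/implyP => ca.
move: h; rewrite mem_cat ca /= index_cat ca takel_cat// index_size//.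
Qed.

Lemma redseq_between c p q : redseq (c :: p ++ c :: q) -> has (fun d => ~~ E c d) p.
Proof.
rewrite /= => /andP[h _]; move: h; rewrite mem_cat mem_head orbT /= => h.
have [cp|cp] := boolP (c \in p).
  rewrite index_cat cp takel_cat ?index_size// in h.
  by move/hasP: h => [d /mem_take dp Ed]; apply/hasP; exists d.
by move: h; rewrite index_cat (negPf cp) /= eqxx addn0 take_size_cat.
Qed.

Lemma redseq_word k (chi : 'I_k -> C) : reduced_word E chi -> redseq [seq chi i | i <- enum 'I_k].
Proof.
case: k chi => [|k] chi h; first by rewrite (size0nil (size_enum_ord 0)).
set cs := map _ _.
have sz : size cs = k.+1 by rewrite size_map size_enum_ord.
have nE (i : 'I_k.+1) c : nth c cs i = chi i.
  by rewrite (nth_map ord0) ?size_enum_ord// nth_ord_enum.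
have {}h c i j : (i < j)%N -> (j < size cs)%N -> nth c cs i = nth c cs j ->
    exists m, [/\ (i < m)%N, (m < j)%N & ~~ E (nth c cs i) (nth c cs m)].
  rewrite sz => ij jk e; have ik := ltn_trans ij jk.
  have := h (Ordinal ik) (Ordinal jk) ij; rewrite -!(nE _ c) => /(_ e)[m [h1 h2 h3]].
  by exists m; split=> //; rewrite -(nE _ c) in h3.
elim: cs h {sz nE} => [//|c cs IH] h /=; apply/andP; split; last first.
  apply: IH => c' i j ij js e.
  by have [[|m] [h1 h2 h3]] := h c' i.+1 j.+1 ij js e => //; exists m.
apply/implyP => cc.
have j1 : ((index c cs).+1 < size (c :: cs))%N by rewrite /= ltnS index_mem.
have j2 : nth c (c :: cs) 0 = nth c (c :: cs) (index c cs).+1 by rewrite /= nth_index.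
have [[|m] [h1 h2 h3]] := h c 0%N (index c cs).+1 isT j1 j2 => //.
apply/hasP; exists (nth c cs m) => //.
rewrite -(nth_take c (n0 := index c cs))// mem_nth// size_take index_mem cc.
by rewrite ltnS in h2.
Qed.

End Reduced.

(** Both branches carry a proof, as needed to apply functions on the subtypes
    {s | s \in A} and {s | s \notin A}. *)
Definition bool_cases (b : bool) : {b} + {~~ b} :=
  if b as b0 return {b0} + {~~ b0} then left isT else right isT.

Section TensorModel.
Variables (S : finType) (N : nat) (A : {set S}).

Definition glue (u : sidx N A) (v : {ffun {s | s \notin A} -> 'I_N}) : idx S N :=
  [ffun s => match bool_cases (s \in A) with
    | left h => u (exist _ s h)
    | right h => v (exist (fun s => s \notin A) s h)
    end].

Definition corestr (f : idx S N) : {ffun {s | s \notin A} -> 'I_N} :=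
  [ffun s => f (sval s)].

Lemma restr_glue u v : restr A (glue u v) = u.
Proof.
apply/ffunP => -[s h]; rewrite !ffunE /=.
case: (bool_cases (s \in A)) => h'; first by rewrite (bool_irrelevance h h').
by case/negP: (h').
Qed.
Lemma corestr_glue u v : corestr (glue u v) = v.
Proof.
apply/ffunP => -[s h]; rewrite !ffunE /=.
case: (bool_cases (s \in A)) => h'; first by case/negP: (h).
by rewrite (bool_irrelevance h h').
Qed.
Lemma glueK f : glue (restr A f) (corestr f) = f.
Proof.
by apply/ffunP => s; rewrite ffunE; case: (bool_cases (s \in A)) => h; rewrite ffunE.
Qed.

(** [N]^S = [N]^A x [N]^(S \ A). *)
Definition tensor_split : splitting #|idx S N| (sidx N A) {ffun {s | s \notin A} -> 'I_N}.
Proof.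
apply: (@Splitting _ _ _ (fun a => restr A (enum_val a)) (fun a => corestr (enum_val a))
  (fun u v => enum_rank (glue u v))).
- by move=> u v; rewrite enum_rankK restr_glue.
- by move=> u v; rewrite enum_rankK corestr_glue.
- by move=> a; rewrite glueK enum_valK.
Defined.

(** Transposing two values of the coordinate x exchanges the fibres, so they all have
    the same size. *)
Lemma card_fiber (x : {s | s \in A}) (t : 'I_N) :
  (#|[pred u : sidx N A | u x == t]| * N <= #|{: sidx N A}|)%N.
Proof.
have e t' : #|[pred u : sidx N A | u x == t]| = #|[pred u : sidx N A | u x == t']|.
  pose g (u : sidx N A) : sidx N A := [ffun y => if y == x then tperm t t' (u y) else u y].
  have gK : involutive g.
    by move=> u; apply/ffunP => y; rewrite !ffunE; case: eqP => // _; rewrite tpermK.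
  rewrite -(fintype.card_image (inv_inj gK)); apply: eq_card => u; rewrite !inE.
  apply/fintype.imageP/idP => [[u' + ->]|ux].
    by rewrite inE ffunE eqxx => /eqP ->; rewrite tpermL.
  by exists (g u); rewrite ?gK// inE ffunE eqxx (eqP ux) tpermR.
rewrite mulnC -[X in (X * _)%N]card_ord -sum_nat_const -[leqRHS]sum1_card.
rewrite (partition_big (fun u : sidx N A => u x) xpredT)//=.
by apply: leq_sum => t' _; rewrite (e t') -sum1_card.
Qed.

Lemma card_sidx_ge (x : {s | s \in A}) : (0 < N)%N -> (N <= #|{: sidx N A}|)%N.
Proof.
move=> N0; apply: leq_trans (card_fiber x (Ordinal N0)); rewrite leq_pmull//.
by apply/card_gt0P; exists [ffun=> Ordinal N0]; rewrite inE ffunE.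
Qed.

Lemma card_idx_gt0 : (0 < N)%N -> (0 < #|{: idx S N}|)%N.
Proof. by move=> N0; apply/card_gt0P; exists [ffun=> Ordinal N0]. Qed.

End TensorModel.

(** * Smallness of reduced words *)

Section BrokenWords.
Variable R : realType.
Local Notation Cx := R[i]%C.

Lemma eq_pin n (L L' : eqType) (f : 'I_n -> L) (g : 'I_n -> L') (A : 'M[Cx]_n) :
  (forall a b, (f a == f b) = (g a == g b)) -> pin f A = pin g A.
Proof. by move=> fg; apply/matrixP => a b; rewrite !mxE fg. Qed.

Lemma nrm_le n (A B : 'M[Cx]_n) : fro A <= fro B -> nrm A <= nrm B.
Proof. by move=> h; rewrite /nrm ler_wpM2r// invr_ge0 sqrtr_ge0. Qed.

Lemma nrm_add n (A B : 'M[Cx]_n) : nrm (A + B) <= nrm A + nrm B.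
Proof. by rewrite /nrm -mulrDl ler_wpM2r ?fro_add// invr_ge0 sqrtr_ge0. Qed.

Lemma nrmZ n (r : R) (A : 'M[Cx]_n) : nrm ((r%:C)%C *: A) = `|r| * nrm A.
Proof. by rewrite /nrm froZ mulrA. Qed.

Variables (S C : finType) (E : rel C) (Sc : C -> {set S}).
Hypothesis hSc : forall c c', Sc c :&: Sc c' = finset.set0 <-> E c c'.

Definition color_split N c := tensor_split N (Sc c).
Definition coord N (s : S) (a : 'I_#|idx S N|) : 'I_N := enum_val a s.
Local Notation perms N := {dffun forall c, {perm sidx N (Sc c)}}.
Local Notation M N := 'M[Cx]_#|idx S N|.
Local Notation word N := (seq (C * seq (M N * M N))).

Lemma pi_coord N c s a b : s \in Sc c ->
  spi (color_split N c) a = spi (color_split N c) b -> coord s a = coord s b.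
Proof.
move=> h /= /ffunP /(_ (exist _ s h)); by rewrite !ffunE.
Qed.

Lemma rho_coord N c s a b : s \notin Sc c ->
  srho (color_split N c) a = srho (color_split N c) b -> coord s a = coord s b.
Proof.
move=> h /= /ffunP /(_ (exist (fun s => s \notin Sc c) s h)); by rewrite !ffunE.
Qed.

Lemma word_val_cat N (sg : perms N) (p q : word N) :
  word_val (color_split N) sg (p ++ q) = word_val (color_split N) sg p *m word_val (color_split N) sg q.
Proof. by elim: p => [|l p IH] /=; rewrite ?mul1mx// IH mulmxA. Qed.

(** The last piece m of a broken word is not centred: m = 2 half_center m + Delta m.
    The first term gives a word with one more letter.  In the second the diagonal
    matrix comes out of the pinching, and leaves the word without m.  A pinching by
    the coordinates of c is dominated by one by a single coordinate. *)
Lemma cut_piece N (sg : perms N) c s (pre : word N) A : s \in Sc c ->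
  (forall p, p \in A -> good_factor (color_split N c) p) ->
  nrm (pin (spi (color_split N c)) (word_val (color_split N) sg pre *m mono (color_split N) sg c A)) <=
  2 * nrm (pin (coord s) (word_val (color_split N) sg (pre ++ [:: (c, A)]))) +
  nrm (pin (coord s) (word_val (color_split N) sg pre)).
Proof.
move=> sc gA; rewrite word_val_cat /= mulmx1.
set P := word_val _ _ pre; set m := mono _ _ _ _.
have em : m = ((2 : R)%:C)%C *: letter (color_split N) sg (c, A) + Delta m.
  rewrite /letter /half_center /= scalerA -/m -(rmorphM (real_complex R)) divff ?scale1r ?subrK//.
have ref (X : M N) : nrm (pin (spi (color_split N c)) X) <= nrm (pin (coord s) X).
  apply: nrm_le; apply: fro_le; apply: hs_pin_refine => a b.
  exact: pi_coord.
rewrite {1}em mulmxDr -scalemxAr pinD pinZ.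
apply: le_trans (nrm_add _ _) _; rewrite nrmZ ger0_norm//; apply: lerD.
  by rewrite ler_wpM2l.
rewrite (pin_mulr _ _ (is_diag_Delta m)); apply: le_trans (ref _).
apply: nrm_le; apply: fro_contr_r; apply: contr_Delta.
exact: contr_mono.
Qed.

Lemma shared_site c d : ~~ E c d -> exists2 s, s \in Sc c & s \in Sc d.
Proof.
move=> ncd; have : Sc c :&: Sc d != finset.set0.
  by apply: contra ncd => /eqP /hSc.
by move=> /finset.set0Pn[s]; rewrite finset.in_setI => /andP[h1 h2]; exists s.
Qed.

Lemma expr_le01 (x : R) p q : 0 <= x <= 1 -> (p <= q)%N -> x ^+ q <= x ^+ p.
Proof. by move=> /andP[x0 x1] pq; apply: ler_wiXn2l. Qed.

Lemma powD_le (a b : R) q : 0 <= a -> 0 <= b ->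
  (a + b) ^+ q <= 2 ^+ q * (a ^+ q + b ^+ q).
Proof.
move=> a0 b0; wlog ab : a b a0 b0 / a <= b.
  move=> H; have [ab|ba] := lerP a b; first exact: H.
  by rewrite addrC [a ^+ q + _]addrC; apply: H => //; apply: ltW.
apply: le_trans (_ : (2 * b) ^+ q <= _).
  by rewrite lerXn2r ?nnegrE ?addr_ge0 ?mulr_ge0//; lra.
by rewrite exprMn ler_wpM2l ?exprn_ge0// lerDr exprn_ge0.
Qed.

(** K / N^2 times the number of families of permutations: an upper bound by this for a
    sum over all families says that the average is at most K / N^2. *)
Definition moment_bound N (K : R) : R := K * #|{: perms N}|%:R / N%:R ^+ 2.

Lemma moment_boundD N K1 K2 : moment_bound N K1 + moment_bound N K2 = moment_bound N (K1 + K2).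
Proof. by rewrite /moment_bound -!mulrDl. Qed.

Lemma moment_boundM N a K : a * moment_bound N K = moment_bound N (a * K).
Proof. by rewrite /moment_bound !mulrA. Qed.

Lemma moment_bound_le N K1 K2 : K1 <= K2 -> moment_bound N K1 <= moment_bound N K2.
Proof. by move=> h; rewrite /moment_bound -!mulrA ler_wpM2r// mulr_ge0// invr_ge0 exprn_ge0. Qed.

(** A broken word consists of the letters before some later letter of colour c, and a
    piece of that letter.  As the word is reduced, one of those letters shares a site s
    with c.  Pinching at s, [cut_piece] reduces the broken word to two reduced words
    that are shorter than the word including its first letter c, and have a letter
    at s. *)
Lemma cut_error_moment N c (ws : word N) (L k q : nat) (K : R) :
  (0 < N)%N -> (size ws <= k)%N -> redseq E (c :: [seq l.1 | l <- ws]) ->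
  good_word (color_split N) ws -> (forall l, l \in ws -> (size l.2 <= L)%N) -> 0 <= K ->
  (forall ws' : word N, (size ws' <= k)%N -> redseq E [seq l.1 | l <- ws'] ->
    good_word (color_split N) ws' -> (forall l, l \in ws' -> (size l.2 <= L)%N) ->
    forall l s, l \in ws' -> s \in Sc l.1 ->
    \sum_sg nrm (pin (coord s) (word_val (color_split N) sg ws')) ^+ q.+1 <= moment_bound N K) ->
  \sum_sg cut_error (color_split N) c ws sg ^+ q.+1 <=
    moment_bound N ((4 * L * k)%:R ^+ q.+2 * (2 ^+ q.+1 * (2 ^+ q.+1 * K + K))).
Proof.
move=> N0 sk red g sL K0 IH.
pose signs := {ffun 'I_#|idx S N| -> bool}.
have E0 : 0 < #|signs|%:R :> R := card_signs_gt0 R _.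
pose x (qq : word N * seq (M N * M N)) sg :=
  nrm (pin (spi (color_split N c)) (word_val (color_split N) sg qq.1 *m mono (color_split N) sg c qq.2)).
have x0 qq sg : 0 <= x qq sg by exact: nrm_ge0.
have Kx (e : signs) qq : qq \in cuts c e ws ->
    \sum_sg x qq sg ^+ q.+1 <= moment_bound N (2 ^+ q.+1 * (2 ^+ q.+1 * K + K)).
  move=> qc; have [w [post [ews gA sA]]] := cutsP g qc.
  have red' := red; rewrite ews map_cat /= in red'.
  have /hasP[d dp ncd] := redseq_between red'.
  have [s sc sd] := shared_site ncd.
  have /mapP[l0 l0p ed] := dp; rewrite ed in sd.
  have gp : good_word (color_split N) qq.1 := cuts_good_val g qc.
  have sp1 : (size qq.1 < size ws)%N by rewrite ews size_cat /= addnS ltnS leq_addr.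
  apply: le_trans (_ : \sum_sg 2 ^+ q.+1 * ((2 * nrm (pin (coord s) (word_val (color_split N) sg (qq.1 ++ [:: (c, qq.2)])))) ^+ q.+1 +
     nrm (pin (coord s) (word_val (color_split N) sg qq.1)) ^+ q.+1) <= _).
    apply: ler_sum => sg _; apply: le_trans (powD_le _ _ _); rewrite ?mulr_ge0 ?nrm_ge0//.
    rewrite lerXn2r ?nnegrE ?addr_ge0 ?mulr_ge0 ?nrm_ge0//.
    exact: cut_piece.
  rewrite -mulr_sumr -moment_boundM ler_wpM2l ?exprn_ge0// big_split /= -moment_boundD; apply: lerD.
    under eq_bigr do rewrite exprMn.
    rewrite -mulr_sumr -moment_boundM ler_wpM2l ?exprn_ge0//.
    apply: (IH _ _ _ _ _ (c, qq.2) s); rewrite ?mem_cat ?mem_head ?orbT//.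
    - by rewrite size_cat addn1; apply: leq_trans sk.
    - rewrite map_cat; move: red; rewrite ews /= => /andP[_].
      by rewrite map_cat /= -cat_rcons -cats1; apply: redseq_prefix.
    - move=> l; rewrite mem_cat => /orP[/gp//|]; rewrite inE => /eqP -> /=; exact: gA.
    - move=> l; rewrite mem_cat => /orP[lq|].
        by apply: sL; rewrite ews mem_cat lq.
      rewrite inE => /eqP -> /=; apply: leq_trans sA _.
      by apply: (sL (c, w)); rewrite ews mem_cat mem_head orbT.
  apply: (IH _ _ _ _ _ l0 s) => //.
  - by apply: leq_trans (ltnW sp1) sk.
  - by move: red; rewrite ews /= => /andP[_]; rewrite map_cat; apply: redseq_prefix.
  - by move=> l lq; apply: sL; rewrite ews mem_cat lq.
apply: le_trans (_ : \sum_sg (\sum_(e : signs) (4 * L * k)%:R ^+ q.+1 * \sum_(qq <- cuts c e ws) x qq sg ^+ q.+1) / #|signs|%:R <= _).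
  apply: ler_sum => sg _; apply: le_trans (power_mean q _ _) _.
  - by move=> e; apply: sumr_ge0 => qq _; apply: x0.
  - by rewrite -(ltr0n R).
  rewrite ler_wpM2r ?invr_ge0//; apply: ler_sum => e _.
  apply: le_trans (power_sum_le _ q (fun qq => x0 qq sg)) _.
  rewrite ler_wpM2r ?sumr_ge0//; first by move=> qq _; rewrite exprn_ge0.
  rewrite lerXn2r ?nnegrE// ler_nat.
  by apply: leq_trans (size_cuts c e sL) _; rewrite leq_mul2l sk orbT.
rewrite -mulr_suml ler_pdivrMr// exchange_big /=.
apply: le_trans (_ : \sum_(e : signs) moment_bound N ((4 * L * k)%:R ^+ q.+2 * (2 ^+ q.+1 * (2 ^+ q.+1 * K + K))) <= _).
  apply: ler_sum => e _.
  set Y := 2 ^+ q.+1 * _; have -> : moment_bound N ((4 * L * k)%:R ^+ q.+2 * Y) =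
      (4 * L * k)%:R ^+ q.+1 * moment_bound N ((4 * L * k)%:R * Y).
    by rewrite moment_boundM [in LHS]exprSr mulrA.
  rewrite -mulr_sumr ler_wpM2l ?exprn_ge0// /Y.
  rewrite exchange_big /=.
  apply: le_trans (_ : \sum_(qq <- cuts c e ws) moment_bound N (2 ^+ q.+1 * (2 ^+ q.+1 * K + K)) <= _).
    by rewrite big_seq_cond [X in _ <= X]big_seq_cond; apply: ler_sum => qq /andP[qc _]; apply: Kx qc.
  rewrite big_const_seq count_predT iter_addr_0 -[leLHS]mulr_natl moment_boundM; apply: moment_bound_le.
  rewrite ler_wpM2r//; first by rewrite mulr_ge0 ?addr_ge0 ?mulr_ge0 ?exprn_ge0.
  by rewrite ler_nat; apply: leq_trans (size_cuts c e sL) _; rewrite leq_mul2l sk orbT.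
by rewrite sumr_const -[leLHS]mulr_natr.
Qed.

End BrokenWords.

Section MomentSmall.
Variable R : realType.
Local Notation Cx := R[i]%C.
Variables (S C : finType) (E : rel C) (Sc : C -> {set S}).
Hypothesis hSc : forall c c', Sc c :&: Sc c' = finset.set0 <-> E c c'.
Local Notation color_split := (color_split Sc).
Local Notation moment_bound := (@moment_bound R S C Sc).
Local Notation perms N := {dffun forall c, {perm sidx N (Sc c)}}.
Local Notation M N := 'M[Cx]_#|idx S N|.
Local Notation word N := (seq (C * seq (M N * M N))).

Lemma nrm_word_val01 N (sg : perms N) (L : finType) (f : 'I_#|idx S N| -> L) (ws : word N) :
  good_word (color_split N) ws -> 0 <= nrm (pin f (word_val (color_split N) sg ws)) <= 1.
Proof.
by move=> g; rewrite nrm_ge0 nrm_contr//; apply: contr_pin; apply: contr_word_val.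
Qed.

Lemma cut_error_bounds N c (sg : perms N) (ws : word N) (L k : nat) :
  good_word (color_split N) ws -> (size ws <= k)%N -> (forall l, l \in ws -> (size l.2 <= L)%N) ->
  0 <= cut_error (color_split N) c ws sg <= (4 * L * k)%:R.
Proof.
move=> g sk sL; have E0 := card_signs_gt0 R #|idx S N|.
rewrite /cut_error divr_ge0//=; last first.
  by apply: sumr_ge0 => e _; apply: sumr_ge0 => q _; apply: nrm_ge0.
rewrite ler_pdivrMr//.
have -> : (4 * L * k)%:R * #|{ffun 'I_#|idx S N| -> bool}|%:R =
    \sum_(e : {ffun 'I_#|idx S N| -> bool}) (4 * L * k)%:R :> R.
  by rewrite sumr_const mulr_natr.
apply: ler_sum => e _.
apply: le_trans (_ : \sum_(q <- cuts c e ws) 1 <= _).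
  rewrite big_seq_cond [X in _ <= X]big_seq_cond; apply: ler_sum => q /andP[qc _].
  apply: nrm_contr; apply: contr_pin; apply: contrM.
    by apply: contr_word_val; apply: cuts_good_val qc.
  have [w [post [h1 h2 h3]]] := cutsP g qc.
  exact: contr_mono.
rewrite big_const_seq count_predT iter_addr_0 ler_nat.
by apply: leq_trans (size_cuts c e sL) _; rewrite leq_mul2l sk orbT.
Qed.

(** Induction on the number of letters, with [recursion_ineq] when the first letter
    has s among its sites, and by removing that letter otherwise. *)
Theorem moment_small L k : exists (q : nat) (K : R), 0 <= K /\
  forall N (ws : word N), (0 < N)%N -> (size ws <= k)%N -> redseq E [seq l.1 | l <- ws] ->
    good_word (color_split N) ws -> (forall l, l \in ws -> (size l.2 <= L)%N) ->
    forall l s, l \in ws -> s \in Sc l.1 ->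
    \sum_sg nrm (pin (@coord S N s) (word_val (color_split N) sg ws)) ^+ q.+1 <= moment_bound N K.
Proof.
elim: k => [|k [q0 [K0 [K00 IH]]]].
  exists 0%N, 0; split=> // N ws _; rewrite leqn0 => /eqP/size0nil -> //.
(* q.+1 >= 4 turns rho = N^(-1/2) into N^-2; q >= q0 lets the induction
   hypothesis apply to quantities at most 1. *)
pose q := maxn 3 q0.
have [K1 [K10 Hrec]] := @recursion_ineq R L k (2 * q).+1 isT.
have B0 : 0 <= 1 + (4 * L * k)%:R :> R by rewrite addr_ge0.
have [C' [C'0 Hy]] := young q K10 B0.
pose K2 := (4 * L * k)%:R ^+ q.+2 * (2 ^+ q.+1 * (2 ^+ q.+1 * K0 + K0)).
have pw (a : R) j : 0 <= a -> 0 <= a ^+ j by exact: exprn_ge0.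
have K20 : 0 <= K2.
  apply: mulr_ge0; first exact: pw.
  apply: mulr_ge0; first exact: pw.
  by apply: addr_ge0 => //; apply: mulr_ge0 => //; apply: pw.
have KC0 : 0 <= C' * (2 ^+ q.+1 * (1 + K2)).
  apply: mulr_ge0 => //; apply: mulr_ge0; first exact: pw.
  exact: addr_ge0.
(* [young] bounds F ^ (2 * q.+1), and F is the square of the norm. *)
exists (4 * q.+1).-1, (C' * (2 ^+ q.+1 * (1 + K2)) + K0); split.
  exact: addr_ge0.
move=> N ws N0; rewrite prednK ?muln_gt0//.
case: ws => [//|[c w] ws] sk red g sL l s lws sl.
have [gw gws] := good_word_cons g; rewrite /= in gw sk.
have sLws l' : l' \in ws -> (size l'.2 <= L)%N by move=> h; apply: sL; rewrite in_cons h orbT.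
have redws : redseq E [seq l.1 | l <- ws] by move: red => /= /andP[].
(* If s is not a site of the first letter, that letter leaves the pinching at s
   unchanged, and the rest of the word has a letter with site s. *)
have [sc|sc] := boolP (s \in Sc c); last first.
  have lw : l \in ws.
    by move: lws; rewrite in_cons => /orP[/eqP el|//]; rewrite el in sl; rewrite sl in sc.
  apply: le_trans (_ : moment_bound N K0 <= _); last by apply: moment_bound_le; rewrite lerDr.
  apply: le_trans (IH N ws N0 sk redws gws sLws l s lw sl).
  apply: ler_sum => sg _.
  apply: le_trans (_ : nrm (pin (@coord S N s) (word_val (color_split N) sg ws)) ^+ (4 * q.+1) <= _).
    rewrite lerXn2r ?nnegrE ?nrm_ge0//= pin_mull.
      apply: nrm_le; apply: fro_contr; apply: contr_half_center; exact: contr_mono.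
    move=> a b ab; apply: (@blk_half_center _ _ _ _ (color_split N c)); first exact: blk_mono.
    by apply: contra ab => /eqP h; apply/eqP; apply: (rho_coord sc h).
  apply: expr_le01; first exact: nrm_word_val01.
  by apply: (@leq_trans q.+1); [rewrite ltnS leq_maxr|rewrite leq_pmull].
pose x : {s | s \in Sc c} := exist _ s sc.
pose fU (u : sidx N (Sc c)) := u x.
have n0 := card_idx_gt0 S N0.
have NU : (N <= #|{: sidx N (Sc c)}|)%N := card_sidx_ge x N0.
pose F sg := nrm (pin (@coord S N s) (word_val (color_split N) sg ((c, w) :: ws))) ^+ 2.
pose rho : R := (Num.sqrt N%:R)^-1.
pose t (sg : perms N) := rho + cut_error (color_split N) c ws sg.
have rho0 : 0 <= rho by rewrite invr_ge0 sqrtr_ge0.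
have rho1 : rho <= 1.
  rewrite invf_le1 ?sqrtr_gt0 ?ltr0n// -[leLHS]sqrtr1 ler_wsqrtr// ler1n//.
have eb sg := cut_error_bounds c sg gws sk sLws.
have F01 sg : 0 <= F sg <= 1.
  have /andP[h0 h1] := nrm_word_val01 sg (@coord S N s) g.
  by rewrite sqr_ge0 exprn_ile1.
have tB sg : 0 <= t sg <= 1 + (4 * L * k)%:R.
  by have /andP[h0 h1] := eb sg; rewrite addr_ge0// lerD.
have hrec := Hrec _ C _ _ (color_split N) _ c fU N w ws n0 N0 NU (card_fiber x) (sL _ (mem_head _ _)) sk sLws g.
have eF sg : nrm (pin (fun a => fU (spi (color_split N c) a)) (word_val (color_split N) sg ((c, w) :: ws))) ^+ 2 = F sg.
  by rewrite /F; congr (nrm _ ^+ 2); apply: eq_pin => a b; rewrite /fU /= !ffunE.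
have hF : \sum_sg F sg ^+ (2 * q.+1) <= K1 * \sum_sg (F sg + t sg) ^+ (2 * q) * t sg.
  have -> : (2 * q.+1 = (2 * q).+2)%N by rewrite mulnS.
  apply: le_trans (_ : K1 * \sum_sg (F sg + rho) ^+ (2 * q) * t sg <= _).
    rewrite (eq_bigr (fun sg => nrm (pin (fun a => fU (spi (color_split N c) a)) (word_val (color_split N) sg ((c, w) :: ws))) ^+ 2 ^+ (2 * q).+2)); last first.
      by move=> sg _; rewrite eF.
    apply: le_trans hrec _; rewrite ler_wpM2l//.
    by apply: ler_sum => sg _; rewrite eF.
  rewrite ler_wpM2l//; apply: ler_sum => sg _.
  have /andP[h0 h1] := F01 sg; have /andP[h2 h3] := tB sg; have /andP[h4 h5] := eb sg.
  rewrite ler_wpM2r// lerXn2r ?nnegrE ?addr_ge0//.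
  by rewrite lerD2l /t lerDl.
have h1 := Hy _ F t F01 tB hF.
have hpow sg : F sg ^+ (2 * q.+1) = nrm (pin (@coord S N s) (word_val (color_split N) sg ((c, w) :: ws))) ^+ (4 * q.+1).
  by rewrite /F -exprM mulnA.
rewrite (eq_bigr (fun sg => F sg ^+ (2 * q.+1))); last by move=> sg _; rewrite hpow.
apply: le_trans h1 _.
rewrite -moment_boundD -moment_boundM -[leLHS]addr0; apply: lerD; last first.
  by rewrite /moment_bound mulr_ge0 ?mulr_ge0 ?invr_ge0 ?exprn_ge0.
rewrite ler_wpM2l//.
apply: le_trans (_ : \sum_sg 2 ^+ q.+1 * (rho ^+ q.+1 + cut_error (color_split N) c ws sg ^+ q.+1) <= _).
  by apply: ler_sum => sg _; apply: powD_le => //; have /andP[] := eb sg.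
rewrite -mulr_sumr -moment_boundM ler_wpM2l ?exprn_ge0// big_split /= -moment_boundD; apply: lerD.
  rewrite sumr_const -[leLHS]mulr_natl /moment_bound mul1r ler_wpM2l//.
  apply: le_trans (_ : rho ^+ 4 <= _).
    by apply: expr_le01; rewrite ?rho0// ltnS leq_maxl.
  by rewrite /rho exprVn (exprM _ 2 2) sqr_sqrtr.
apply: (cut_error_moment hSc) => // ws' sk' red' g' sL' l' s' lw' sl'.
apply: le_trans (IH N ws' N0 sk' red' g' sL' l' s' lw' sl').
apply: ler_sum => sg _; apply: expr_le01; first exact: nrm_word_val01.
by rewrite ltnS leq_maxr.
Qed.

End MomentSmall.

(** * Operator norms and embedded matrices *)

Section Translation.
Variable R : realType.
Local Notation Cx := R[i]%C.

Lemma l2normE n (v : 'cV[Cx]_n) : l2norm v = fro v.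
Proof. by rewrite /l2norm /fro hsE; congr Num.sqrt; apply: eq_bigr => i _; rewrite big_ord1. Qed.

Lemma norm2E n (A : 'M[Cx]_n) : norm2 A = nrm A.
Proof.
rewrite /norm2 /nrm /fro -sqrtrV ?ler0n// -sqrtrM ?hs_ge0//; congr Num.sqrt.
rewrite /ntr /hs /ip.
have -> : (n%:R : Cx)^-1 = (n%:R^-1)%:C%C.
  by rewrite (fmorphV (real_complex R)) rmorph_nat.
by rewrite cReM /= mulr0 subr0.
Qed.

(** The set whose supremum defines the operator norm is bounded: a vector of norm at
    most 1 has coordinates at most 1, so the norms of the columns of A add up to an
    upper bound. *)
Lemma opnorm_bound n (A : 'M[Cx]_n) (v : 'cV[Cx]_n) :
  l2norm v <= 1 -> l2norm (A *m v) <= opnorm A.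
Proof.
move=> v1; apply: ub_le_sup; last by exists v.
exists (\sum_j fro (col j A)) => _ [u /= u1 <-].
have -> : A *m u = \sum_j u j 0 *: col j A.
  apply/matrixP => i j; rewrite mxE summxE ord1; apply: eq_bigr => k _.
  by rewrite !mxE mulrC.
rewrite l2normE; apply: le_trans (fro_sum _ _ _) _; apply: ler_sum => j _.
rewrite /fro hsZ sqrtrM ?sqr_ge0// sqrtr_sqr ger0_norm ?normc_nonneg//.
rewrite ler_piMl ?sqrtr_ge0//; apply: le_trans u1.
rewrite -(ger0_norm (normc_nonneg _)) -sqrtr_sqr ler_wsqrtr// (bigD1 j)//= lerDl.
by apply: sumr_ge0 => k _; apply: sqr_ge0.
Qed.

Lemma contr_opnorm n (A : 'M[Cx]_n) (K : R) : 0 < K -> opnorm A <= K ->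
  contr ((K^-1)%:C%C *: A).
Proof.
move=> K0 AK v; have [v0|v0] := eqVneq (fro v) 0.
  have -> : v = 0 by apply: hs_eq0; rewrite -fro_sqr v0 expr0n.
  by rewrite mulmx0.
have vp : 0 < fro v by rewrite lt_def v0 fro_ge0.
have u1 : l2norm (((fro v)^-1)%:C%C *: v) <= 1.
  by rewrite l2normE froZ gtr0_norm ?invr_gt0// mulVf.
have := le_trans (opnorm_bound A u1) AK.
rewrite -scalemxAr l2normE froZ gtr0_norm ?invr_gt0// ler_pdivrMl// => h.
rewrite -!fro_sqr lerXn2r ?nnegrE ?fro_ge0//.
by rewrite -scalemxAl froZ gtr0_norm ?invr_gt0// ler_pdivrMl// mulrC.
Qed.

Variables (S : finType).

(** For each value of the coordinates outside A, the matrix X acts on the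
    corresponding part of v. *)
Lemma contr_tensor_id N (A : {set S}) (X : fmatrix R (sidx N A)) :
  contr X -> contr (tensor_id X).
Proof.
move=> cX v; pose sp := tensor_split N A.
pose vr (r : {ffun {s | s \notin A} -> 'I_N}) : 'cV[Cx]_#|{: sidx N A}| :=
  \col_i v (smk sp (enum_val i) r) 0.
have sumU (F : sidx N A -> R) : \sum_u F u = \sum_(i < #|{: sidx N A}|) F (enum_val i).
  rewrite (reindex_onto (@enum_val (sidx N A) _) enum_rank) /=; last by move=> u _; rewrite enum_rankK.
  by apply: eq_bigl => i; rewrite enum_valK eqxx.
have hv : hs v = \sum_r hs (vr r).
  rewrite hsE (sum_split sp); apply: eq_bigr => r _; rewrite sumU hsE.
  by apply: eq_bigr => i _; rewrite !big_ord1 mxE.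
rewrite hv.
have -> : hs (tensor_id X *m v) = \sum_r hs (X *m vr r).
  rewrite hsE (sum_split sp); apply: eq_bigr => r _; rewrite sumU hsE.
  apply: eq_bigr => i _; rewrite !big_ord1; congr (Normc.normc _ ^+ 2).
  rewrite !mxE.
  rewrite (reindex (fun p : sidx N A * {ffun {s | s \notin A} -> 'I_N} => smk sp p.1 p.2)) /=; last first.
    exists (fun a => (spi sp a, srho sp a)) => [[u r'] _|a _] /=.
      by rewrite !enum_rankK restr_glue corestr_glue.
    by rewrite glueK enum_valK.
  rewrite -(pair_bigA _ (fun u r' => tensor_id X (smk sp (enum_val i) r) (smk sp u r') * v (smk sp u r') 0)) /=.
  rewrite (reindex_onto (@enum_val (sidx N A) _) enum_rank) /=; last by move=> u _; rewrite enum_rankK.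
  rewrite (eq_bigl predT); last by move=> j; rewrite /= enum_valK eqxx.
  apply: eq_bigr => j _; rewrite (bigD1 r)//= big1 ?addr0.
    rewrite !mxE /= !enum_rankK !restr_glue !enum_valK.
    case: forallP => [_|[]]; first by rewrite mulr1.
    by move=> s; apply/implyP => sA; rewrite /glue !ffunE; case: (bool_cases _) => // h; case/negP: (sA).
  move=> r' rr; rewrite !mxE /= !enum_rankK; case: forallP => [h|_]; last by rewrite mulr0 mul0r.
  case/eqP: rr; apply/ffunP => -[s sA].
  rewrite -(corestr_glue (enum_val j) r') -(corestr_glue (enum_val i) r).
  rewrite [LHS]ffunE [RHS]ffunE /=; apply/esym/eqP.
  by move: (h s); rewrite sA.
by apply: ler_sum => r _.
Qed.

Lemma blk_tensor_id N (A : {set S}) (X : fmatrix R (sidx N A)) :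
  blk (tensor_split N A) (tensor_id X).
Proof.
move=> a b; rewrite mxE /=; case: forallP => [h|_]; last by rewrite mulr0.
move=> /eqP []; apply/ffunP => -[s sA]; rewrite !ffunE /=.
by apply/eqP; move: (h s); rewrite sA.
Qed.

Variables (C : finType) (Sc : C -> {set S}).

Lemma conj_tensorE N c (s : {perm sidx N (Sc c)}) (X : fmatrix R (sidx N (Sc c))) :
  conj_tensor s X = conj_lift (color_split Sc N) s (tensor_id X).
Proof.
have eP : adjmx (perm_matrix R s) *m X *m perm_matrix R s =
    \matrix_(i, j) X (enum_rank (s (enum_val i))) (enum_rank (s (enum_val j))).
  apply/matrixP => i j; rewrite mxE (bigD1 (enum_rank (s (enum_val j))))//= big1 ?addr0.
    rewrite [perm_matrix _ _ _ _]mxE. rewrite enum_rankK eqxx mulr1 mxE (bigD1 (enum_rank (s (enum_val i))))//= big1 ?addr0.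
      by rewrite adjmxE mxE enum_rankK eqxx rmorph1 mul1r mxE.
    move=> k ki; rewrite adjmxE mxE (_ : _ == _ = false) ?rmorph0 ?mul0r//.
    by apply: contraNF ki => /eqP <-; rewrite enum_valK.
  move=> k ki; rewrite [perm_matrix _ _ _ _]mxE (_ : _ == _ = false) ?mulr0//.
  by apply: contraNF ki => /eqP <-; rewrite enum_valK.
apply/matrixP => a b; rewrite conj_liftE /conj_tensor eP !mxE /= !mxE !enum_rankK.
have pe a' : restr (Sc c) (enum_val (lift_left (color_split Sc N c) s a')) = s (restr (Sc c) (enum_val a')).
  exact: (pi_lift_left (color_split Sc N c) s a').
rewrite !pe; congr (_ * (nat_of_bool _)%:R).
have re a' x : x \notin Sc c -> enum_val (lift_left (color_split Sc N c) s a') x = enum_val a' x.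
  move=> xc; have := congr1 (fun g : {ffun {s | s \notin Sc c} -> 'I_N} => g (exist (fun s => s \notin Sc c) x xc)) (rho_lift_left (color_split Sc N c) s a').
  by rewrite /= !ffunE.
by apply: eq_forallb => x; case xc: (x \in Sc c) => //=; rewrite !re ?xc.
Qed.

End Translation.

(** * Uniform random permutations and almost sure convergence *)

Section Probability.
Context d (Omega : measurableType d) (R : realType) (P : probability Omega R).
Local Open Scope ereal_scope.

Lemma measure_big_le (I : Type) (r : seq I) (p : pred I) (F : I -> set Omega) :
  (forall i, measurable (F i)) ->
  measurable (\big[setU/set0]_(i <- r | p i) F i) /\
  P (\big[setU/set0]_(i <- r | p i) F i) <= \sum_(i <- r | p i) P (F i).
Proof.
move=> mF; elim: r => [|i r [IH1 IH2]].
  by rewrite !big_nil measure0; split.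
rewrite !big_cons; case: (p i) => //; split; first exact: measurableU.
by apply: le_trans (measureU2 _ _ _) _ => //; rewrite leeD2l.
Qed.

Variables (C : finType) (T : C -> finType) (X : forall c, Omega -> T c).
Hypothesis Xm : forall c, random_element (X c).
Hypothesis Xu : forall c, uniformly_distributed P (X c).
Hypothesis Xi : independent P X.

Definition joint (w : Omega) : {dffun forall c, T c} := finfun (fun c => X c w).

Lemma joint_preimage t : joint @^-1` [set t] =
  \bigcap_(c in [set` [set: C]%SET]) (X c @^-1` [set` [set t c]%SET]).
Proof.
apply/seteqP; split => w /=.
  by move=> <- c _ /=; rewrite finset.inE ffunE.
move=> h; apply/ffunP => c; rewrite ffunE; apply/eqP.
by have := h c; rewrite /= !finset.inE => /(_ isT).
Qed.

Lemma joint_measurable t : measurable (joint @^-1` [set t]).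
Proof.
rewrite joint_preimage; apply: fin_bigcap_measurable; first exact: finite_finset.
by move=> c _; apply: Xm.
Qed.

Lemma joint_uniform t : P (joint @^-1` [set t]) = (#|{: {dffun forall c, T c}}|%:R^-1)%:E.
Proof.
rewrite joint_preimage Xi.
have -> : \prod_(c in [set: C]%SET) P (X c @^-1` [set` [set t c]%SET]) =
    \prod_(c in [set: C]%SET) ((#|T c|%:R^-1)%R)%:E.
  apply: eq_bigr => c _; rewrite -(Xu (t c)); congr (P _).
  by apply/seteqP; split => w /=; rewrite finset.inE => /eqP.
rewrite -(big_morph (@EFin R) (@EFinM R) (erefl 1)); congr (_%:E).
rewrite card_dep_ffun foldrE big_map big_enum /= natr_prod prodfV; congr (_^-1)%R.
by apply: eq_bigl => c; rewrite finset.inE.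
Qed.

(** The event is a finite union of the events that the family equals t, each of
    probability one over the number of families; this is Markov's inequality for the
    uniform law. *)
Lemma joint_markov (G : {dffun forall c, T c} -> R) (e B : R) (q : nat) :
  (0 < e)%R -> (forall t, 0 <= G t)%R ->
  (\sum_t G t ^+ q <= B * #|{: {dffun forall c, T c}}|%:R)%R ->
  measurable [set w | (e <= G (joint w))%R] /\
  P [set w | (e <= G (joint w))%R] <= (B / e ^+ q)%:E.
Proof.
move=> e0 G0 hB.
have -> : [set w | (e <= G (joint w))%R] =
    \big[setU/set0]_(t <- index_enum {dffun forall c, T c} | (e <= G t)%R) (joint @^-1` [set t]).
  apply/seteqP; split => w /=.
    by move=> h; rewrite -bigcup_seq_cond; exists (joint w) => //=; rewrite mem_index_enum.
  by rewrite -bigcup_seq_cond => -[t /= /andP[_ h] ->].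
have [m le] := measure_big_le (index_enum {dffun forall c, T c}) (fun t => (e <= G t)%R) joint_measurable.
split=> //; apply: le_trans le _.
under eq_bigr do rewrite joint_uniform.
rewrite sumEFin lee_fin.
have M0 : (0 < #|{: {dffun forall c, T c}}|%:R :> R)%R.
  rewrite ltr0n; apply/card_gt0P.
  have [w _] : exists w : Omega, True.
    apply: contrapT => h; have : P setT = 1 by exact: probability_setT.
    have -> : [set: Omega] = set0 by apply/seteqP; split => // w _; apply: h; exists w.
    by rewrite measure0 => /eqP; rewrite eq_sym onee_eq0.
  by exists (joint w).
rewrite -(ler_pM2r M0).
have eq0 : (0 < e ^+ q)%R by rewrite exprn_gt0.
rewrite [leRHS]mulrAC ler_pdivlMr// mulr_suml mulr_suml.
apply: le_trans hB; rewrite big_mkcond /=; apply: ler_sum => t _.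
case: ifP => h; last by rewrite exprn_ge0.
rewrite mulVf ?gt_eqF// mul1r lerXn2r ?nnegrE ?G0 ?(ltW e0)//.
Qed.

End Probability.

Section BorelCantelli.
Context d (Omega : measurableType d) (R : realType) (P : probability Omega R).

(** Telescoping, as 1/i^2 <= 2/(i (i+1)). *)
Lemma sum_inv_sqr (D : R) n : 0 <= D ->
  \sum_(0 <= i < n.+1) (if (0 < i)%N then D / i%:R ^+ 2 else 0) <= 2 * D * (1 - n.+1%:R^-1).
Proof.
move=> D0; elim: n => [|n IH].
  by rewrite big_nat1 /= invr1 subrr mulr0.
rewrite big_nat_recr//=; apply: le_trans (lerD IH (lexx _)) _.
have p1 : 0 < n.+1%:R :> R by rewrite ltr0n.
have p2 : 0 < n.+2%:R :> R by rewrite ltr0n.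
have e2 : n.+2%:R = n.+1%:R + 1 :> R by rewrite -natr1.
rewrite -subr_ge0.
have -> : 2 * D * (1 - n.+2%:R^-1) - (2 * D * (1 - n.+1%:R^-1) + D / n.+1%:R ^+ 2) =
   D * n%:R / (n.+1%:R ^+ 2 * n.+2%:R).
  rewrite (_ : n%:R = n.+1%:R - 1 :> R); last by rewrite -natr1 addrK.
  move: p1 p2; rewrite e2; move: (n.+1%:R : R) => x p1 p2.
  by field; rewrite !gt_eqF.
by rewrite !mulr_ge0// invr_ge0 mulr_ge0.
Qed.

(** Borel--Cantelli for each threshold 1/(j+1), with the convergent series of D / N^2. *)
Lemma as_cvg0 (g : nat -> Omega -> R) :
  (forall N w, 0 <= g N w) ->
  (forall j : nat, exists D : R, 0 <= D /\ forall N, (0 < N)%N ->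
    measurable [set w | j.+1%:R^-1 <= g N w] /\
    (P [set w | (j.+1%:R^-1 <= g N w)%R] <= (D / N%:R ^+ 2)%:E)%E) ->
  {ae P, forall w, (fun N => g N w) @ \oo --> (0 : R)}.
Proof.
move=> g0 h.
pose ex j N := if (0 < N)%N then [set w | j.+1%:R^-1 <= g N w] else set0.
have hj (j : nat) : {ae P, forall w, ~ lim_sup_set (ex j) w}.
  set F := ex j; have [D [D0 hD]] := h j.
  have mF N : measurable (F N) by rewrite /F /ex; case: ifP => // /hD[].
  have PF N : (P (F N) <= (if (0 < N)%N then D / N%:R ^+ 2 else 0)%:E)%E.
    by rewrite /F /ex; case: ifP => [/hD[]//|_]; rewrite measure0.
  have l0 : P (lim_sup_set F) = 0%E.
    apply: lim_sup_set_cvg0 => //.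
    apply: (@le_lt_trans _ _ (2 * D)%:E); last exact: ltry.
    apply: lime_le; first by apply: is_cvg_nneseries => n _ _; exact: measure_ge0.
    apply: nearW => n.
    apply: le_trans (_ : \sum_(0 <= i < n) (if (0 < i)%N then D / i%:R ^+ 2 else 0)%:E <= _)%E.
      by apply: lee_sum => i _; apply: PF.
    rewrite sumEFin lee_fin.
    case: n => [|n]; first by rewrite big_nil mulr_ge0.
    apply: le_trans (sum_inv_sqr n D0) _.
    by rewrite ler_piMr ?mulr_ge0// gerBl invr_ge0.
  exists (lim_sup_set F); split=> //; last by move=> w /= /contrapT.
  by apply: bigcap_measurableType => k _; apply: bigcup_measurable => i _.
have := ae_foralln hj.
apply: filterS => w hw; apply/cvgrPdist_lt => e e0.
have [j je] := ltr_add_invr e0; rewrite add0r in je.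
have := hw j; rewrite /lim_sup_set => /existsNP[n] /not_implyP[_] hn.
near=> N; rewrite sub0r normrN ger0_norm//.
apply: lt_trans je; rewrite ltNge; apply/negP => le.
apply: hn; exists N => /=; first by near: N; exists n.
by rewrite /ex ifT//; near: N; exists 1%N.
Unshelve. all: by end_near. Qed.

End BorelCantelli.

(** * Scaling the random words to contractions *)

Section Reduction.
Variables (R : realType) (S C : finType) (Sc : C -> {set S}).
Local Notation Cx := R[i]%C.

Lemma prod_enum_ord n m (F : 'I_m -> 'M[Cx]_n) :
  \prod_(i <- enum 'I_m) F i = \prod_(i < m) F i.
Proof. by rewrite enumT /index_enum; case: index_enum_key. Qed.

Lemma prod_scale n I (r : seq I) (a : I -> R) (F G : I -> 'M[Cx]_n) :
  (forall i, G i = (a i)%:C%C *: F i) ->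
  foldr (fun i A => G i *m A) 1%:M r = (\prod_(i <- r) a i)%:C%C *: \prod_(i <- r) F i.
Proof.
move=> GF; elim: r => [|i r IH] /=; first by rewrite !big_nil scale1r.
by rewrite IH GF !big_cons rmorphM -scalemxAl -scalemxAr scalerA.
Qed.

Variables (k : nat) (chi : 'I_k -> C) (ell : 'I_k -> nat) (N : nat).
Variables (Lam : forall i : 'I_k, 'I_(ell i) -> fmatrix R (idx S N))
  (X : forall i : 'I_k, 'I_(ell i) -> fmatrix R (sidx N (Sc (chi i)))) (K : R).
Hypothesis K0 : 0 < K.
Hypothesis Lam_diag : forall i (j : 'I_(ell i)), is_diag_mx (Lam j).
Hypothesis Lam_le : forall i (j : 'I_(ell i)), opnorm (Lam j) <= K.
Hypothesis X_le : forall i (j : 'I_(ell i)), opnorm (X j) <= K.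

Definition unit_word : seq (C * seq ('M[Cx]_#|idx S N| * 'M[Cx]_#|idx S N|)) :=
  [seq (chi i, [seq ((K^-1)%:C%C *: Lam j, tensor_id ((K^-1)%:C%C *: X j)) | j <- enum 'I_(ell i)])
  | i <- enum 'I_k].

Lemma good_unit_word : good_word (color_split Sc N) unit_word.
Proof.
move=> _ /mapP[i _ ->] _ /mapP[j _ ->]; split=> /=.
- by apply/is_diag_mxP => a b ab; rewrite mxE (is_diag_mxP (Lam_diag j))// mulr0.
- exact: contr_opnorm.
- by apply: contr_tensor_id; apply: contr_opnorm.
- exact: blk_tensor_id.
Qed.

Lemma DeltaZ n c (A : 'M[Cx]_n) : Delta (c *: A) = c *: Delta A.
Proof. by rewrite !Delta_pin pinZ. Qed.

Lemma letter_unit_word (sg : {dffun forall c, {perm sidx N (Sc c)}}) i :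
  letter (color_split Sc N) sg (chi i, [seq ((K^-1)%:C%C *: Lam j, tensor_id ((K^-1)%:C%C *: X j)) | j <- enum 'I_(ell i)])
  = (2^-1 * K^-1 ^+ 2 ^+ ell i)%:C%C *: (Yword Lam X sg i - Delta (Yword Lam X sg i)).
Proof.
have e : mono (color_split Sc N) sg (chi i)
    [seq ((K^-1)%:C%C *: Lam j, tensor_id ((K^-1)%:C%C *: X j)) | j <- enum 'I_(ell i)] =
    (K^-1 ^+ 2 ^+ ell i)%:C%C *: Yword Lam X sg i.
  rewrite /mono foldr_map.
  rewrite (@prod_scale _ _ _ (fun=> K^-1 ^+ 2)
    (fun j => Lam j *m conj_tensor (sg (chi i)) (X j))) => [|j].
    by rewrite big_const_seq count_predT size_enum_ord iter_mulr_1 prod_enum_ord.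
  rewrite /factor /= -conj_tensorE.
  have -> : conj_tensor (sg (chi i)) ((K^-1)%:C%C *: X j) = (K^-1)%:C%C *: conj_tensor (sg (chi i)) (X j).
    by rewrite /conj_tensor -scalemxAr -scalemxAl; apply/matrixP => a b; rewrite !mxE /= !mxE mulrA.
  by rewrite -scalemxAl -scalemxAr scalerA -rmorphM expr2.
rewrite /letter [mono _ _ _ _]e /half_center DeltaZ -scalerBr scalerA -rmorphM.
by [].
Qed.

Lemma word_val_unit_word (sg : {dffun forall c, {perm sidx N (Sc c)}}) :
  word_val (color_split Sc N) sg unit_word =
  (\prod_i (2^-1 * K^-1 ^+ 2 ^+ ell i))%:C%C *:
    \prod_(i < k) (Yword Lam X sg i - Delta (Yword Lam X sg i)).
Proof.
rewrite /word_val /unit_word foldr_map.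
rewrite -[\prod_(i < k) (_ - _)]prod_enum_ord -big_enum.
by apply: prod_scale => i; apply: letter_unit_word.
Qed.

(** Undo the scaling; Delta keeps fewer entries than the pinching at s. *)
Lemma norm2_Delta_le (sg : {dffun forall c, {perm sidx N (Sc c)}}) s :
  norm2 (Delta (\prod_(i < k) (Yword Lam X sg i - Delta (Yword Lam X sg i)))) <=
  (\prod_i (2 * K ^+ 2 ^+ ell i)) * nrm (pin (coord s) (word_val (color_split Sc N) sg unit_word)).
Proof.
rewrite norm2E word_val_unit_word; set A := \prod_(i < k) (_ - _).
have p0 : 0 < \prod_i (2^-1 * K^-1 ^+ 2 ^+ ell i).
  by apply: prodr_gt0 => i _; rewrite mulr_gt0 ?invr_gt0// !exprn_gt0// invr_gt0.
rewrite pinZ nrmZ gtr0_norm// mulrA -big_split /= big1 ?mul1r.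
  by rewrite Delta_pin; apply/nrm_le/fro_le; apply: hs_pin_refine => a b ->.
move=> i _; rewrite mulrACA divff// mul1r -!exprMn divff ?expr1n// gt_eqF//.
Qed.

End Reduction.

Theorem theorem1p1 (R : realType) (d : measure_display)
    (Omega : measurableType d) (P : probability Omega R)
    (C : finType) (E : rel C) (hE : simple_graph E)
    (S : finType) (Sc : C -> {set S})
    (hSc0 : forall c, Sc c != finset.set0)
    (hSc : forall c c', Sc c :&: Sc c' = finset.set0 <-> E c c')
    (k : nat) (hk : (0 < k)%N) (chi : 'I_k -> C) (hchi : reduced_word E chi)
    (ell : 'I_k -> nat) (hell : forall i, (0 < ell i)%N)
    (Lam : forall (N : nat) (i : 'I_k), 'I_(ell i) -> fmatrix R (idx S N))
    (hLam : forall (N : nat) (i : 'I_k) (j : 'I_(ell i)), (0 < N)%N ->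
      is_diag_mx (Lam N i j))
    (hLamb : exists K : R, forall (N : nat) (i : 'I_k) (j : 'I_(ell i)),
      (0 < N)%N -> opnorm (Lam N i j) <= K)
    (X : forall (N : nat) (i : 'I_k), 'I_(ell i) ->
      fmatrix R (sidx N (Sc (chi i))))
    (hXb : exists K : R, forall (N : nat) (i : 'I_k) (j : 'I_(ell i)),
      (0 < N)%N -> opnorm (X N i j) <= K)
    (Sigma : forall (N : nat) (c : C), Omega -> {perm sidx N (Sc c)})
    (hSigma : forall (N : nat) (c : C), (0 < N)%N ->
      random_element (Sigma N c) /\ uniformly_distributed P (Sigma N c))
    (hind : forall N : nat, (0 < N)%N -> independent P (Sigma N)) :
  {ae P, forall w : Omega,
    (fun N : nat =>
      norm2 (Delta (\prod_(i < k)
        (Yword (Lam N) (X N) (fun c => Sigma N c w) i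
         - Delta (Yword (Lam N) (X N) (fun c => Sigma N c w) i)))))
    @ \oo --> (0 : R)}.
Proof.
have [K1 hK1] := hLamb; have [K2 hK2] := hXb.
pose K := `|K1| + `|K2| + 1.
have K0 : 0 < K by rewrite ltr_wpDl// addr_ge0.
have LK N i j : (0 < N)%N -> opnorm (Lam N i j) <= K.
  move=> N0; apply: le_trans (hK1 _ _ _ N0) _; apply: le_trans (ler_norm _) _.
  by rewrite /K -addrA lerDl addr_ge0.
have XK N i j : (0 < N)%N -> opnorm (X N i j) <= K.
  move=> N0; apply: le_trans (hK2 _ _ _ N0) _; apply: le_trans (ler_norm _) _.
  by rewrite /K addrAC lerDr addr_ge0.
have [s sS] : exists s, s \in Sc (chi (Ordinal hk)) by apply/finset.set0Pn; exact: hSc0.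
have [q [B [B0 hB]]] := @moment_small R S C E Sc hSc (\max_i ell i) k.
pose ws N := unit_word (Lam N) (X N) K.
pose G N (sg : {dffun forall c, {perm sidx N (Sc c)}}) :=
  nrm (pin (coord s) (word_val (color_split Sc N) sg (ws N))).
pose J N := joint (Sigma N).
have G0 N sg : 0 <= G N sg by exact: nrm_ge0.
have moments N : (0 < N)%N ->
    \sum_sg G N sg ^+ q.+1 <= B / N%:R ^+ 2 * #|{: {dffun forall c, {perm sidx N (Sc c)}}}|%:R.
  move=> N0; rewrite mulrAC.
  have szw : size (ws N) = k by rewrite size_map size_enum_ord.
  apply: (hB N (ws N) N0 _ _ _ _ (chi (Ordinal hk), [seq ((K^-1)%:C%C *: Lam N (Ordinal hk) j,
    tensor_id ((K^-1)%:C%C *: X N (Ordinal hk) j)) | j <- enum 'I_(ell (Ordinal hk))]) s) => //.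
  - by rewrite szw.
  - by rewrite /ws /unit_word -map_comp; apply: redseq_word.
  - by apply: good_unit_word => // *; auto.
  - move=> _ /mapP[i _ ->] /=; rewrite size_map size_enum_ord.
    exact: (@leq_bigmax _ ell i).
  - by apply/mapP; exists (Ordinal hk); rewrite ?mem_enum.
have cv : {ae P, forall w, (fun N => G N (J N w)) @ \oo --> (0 : R)}.
  apply: as_cvg0 => [N w|j]; first exact: G0.
  have j0 : 0 < j.+1%:R^-1 :> R by rewrite invr_gt0.
  exists (B / j.+1%:R^-1 ^+ q.+1); split.
    by rewrite divr_ge0// exprn_ge0// ltW.
  move=> N N0; rewrite mulrAC.
  apply: joint_markov => //; first by move=> c; have [] := hSigma N c N0.
  - by move=> c; have [] := hSigma N c N0.
  - exact: hind.
  - exact: moments.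
move: cv; apply: filterS => w cw.
pose kp := \prod_i (2 * K ^+ 2 ^+ ell i).
have cw' : (fun N => kp * G N (J N w)) @ \oo --> (0 : R).
  by rewrite -(mulr0 kp); apply: cvgM => //; exact: cvg_cst.
apply: (squeeze_cvgr _ (cvg_cst 0) cw').
near=> N.
have N0 : (0 < N)%N by near: N; exists 1%N.
apply/andP; split; first exact: sqrtr_ge0.
have -> : (fun c => Sigma N c w) = J N w :> (forall c, {perm sidx N (Sc c)}).
  by apply: functional_extensionality_dep => c; rewrite ffunE.
by apply: norm2_Delta_le => *; auto.
Unshelve. all: by end_near. Qed.
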